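(* Let $S$ be a closed hyperbolic surface with marked point $p$, and let $\mathcal{HP}(S,p)$ denote the collection of half-pants lasso-induced at $p$. Let $\mathrm{Gap}:\mathcal{HP}(S,p)\to[0,\pi]$ be the function assigning to $P$ its gap-angle, i.e. the measure (with respect to the angular measure of total length $2\pi$ on the unit tangent circle at $p$) of the set of directions from $p$ that shoot out geodesic rays whose lassos induce $P$. Then $$\sum_{P\in\mathcal{HP}(S,p)}\mathrm{Gap}(P)=2\pi .$$
   Context: Lasso: for a self-intersecting geodesic ray $\alpha$ emanating from $p$, the lasso of $\alpha$ is the geodesic segment of $\alpha$ from $p$ up to its first self-intersection. The spoke of the lasso is its segment from $p$ to the intersection point, and its loop is the simple closed geodesic, broken at the intersection point, formed by the remainder of the lasso. Half-pants: a hyperbolic pair of pants is a thrice-punctured sphere with a hyperbolic metric such that each boundary component is a cone point, a cusp or a closed geodesic; the zipper with respect to a boundary component $\beta$ is the unique shortest geodesic arc starting and ending at $\beta$ that cannot be homotoped into the boundary. A pair of half-pants is a connected component obtained by cutting a pair of pants, with one cone-point boundary and two closed geodesic boundaries, along the zipper with respect to the cone point. Thus it is a hyperbolic annulus bounded by a closed geodesic (its cuff) and by a geodesic loop with a single corner at the former cone point (its zipper). Lasso-induced half-pants: traversing the length of a lasso emanating from $p$ and then going back along its spoke gives a closed path based at $p$, representing a simple element of $\pi_1(S,p)$. Let $\gamma_p$ be the unique geodesic representative of this class that begins and ends at $p$ (locally geodesic except at its endpoints), and let $\gamma$ be the unique simple closed geodesic on $S$ freely homotopic to $\gamma_p$.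 Then $\gamma_p$ and $\gamma$ bound the isometrically immersed image in $S$ of a pair of half-pants (with zipper mapped to $\gamma_p$, corner at $p$, and cuff mapped to $\gamma$); this immersed pair of half-pants is said to be induced by the lasso. An immersed pair of half-pants is lasso-induced at $p$ if it is induced by the lasso of some geodesic ray emanating from $p$. It is determined by $\gamma_p$ considered up to orientation. *)

(* Defs.v *)
From HB Require Import structures.
From mathcomp Require Import all_boot all_order all_algebra generic_quotient.
From mathcomp Require Import all_classical all_reals all_analysis.
Import Order.TTheory GRing.Theory Num.Theory.
Import numFieldNormedType.Exports.

Set Implicit Arguments.
Unset Strict Implicit.
Unset Printing Implicit Defensive.

Local Open Scope classical_set_scope.
Local Open Scope ring_scope.
Local Open Scope quotient_scope.

(* The hyperbolic plane is the upper sheet [<x, x> = -1, 0 < x_2] of the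
   hyperboloid for the Minkowski form [<x, y> = x_0 y_0 + x_1 y_1 - x_2 y_2].
   Its metric is the restriction of [<., .>] to the tangent planes, and a closed
   hyperbolic surface is its quotient by a group of orientation-preserving
   isometries acting freely and properly discontinuously, with compact
   quotient. *)
Section HyperbolicPlane.
Variable R : realType.

Definition mink (x y : 'rV[R]_3) : R :=
  \sum_(i < 3) (-1) ^+ (i == ord_max) * (x 0 i * y 0 i).

Definition hyperboloid : set 'rV[R]_3 :=
  [set x | mink x x = -1 /\ 0 < x 0 ord_max].

Definition hyp := set_type hyperboloid.

Definition cosh (t : R) : R := (expR t + expR (- t)) / 2.
Definition sinh (t : R) : R := (expR t - expR (- t)) / 2.

Definition unit_tangent (z : hyp) (v : 'rV[R]_3) :=
  mink (val z) v = 0 /\ mink v v = 1.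

(* [c] is the complete unit-speed geodesic with [c 0 = z] and velocity [v]. *)
Definition geodesic_from (z : hyp) (v : 'rV[R]_3) (c : R -> hyp) :=
  unit_tangent z v /\
  forall t, val (c t) = cosh t *: val z + sinh t *: v.

Definition geodesic_line (c : R -> hyp) := exists z v, geodesic_from z v c.

Definition orthonormal_frame (z : hyp) (e1 e2 : 'rV[R]_3) :=
  [/\ unit_tangent z e1, unit_tangent z e2 & mink e1 e2 = 0].

Definition direction (e1 e2 : 'rV[R]_3) (th : R) : 'rV[R]_3 :=
  cos th *: e1 + sin th *: e2.

(* Isometries act on row vectors on the right. *)
Definition orientation_preserving_isometry (A : 'M[R]_3) :=
  [/\ forall x y, mink (x *m A) (y *m A) = mink x y,
      forall x, hyperboloid x -> hyperboloid (x *m A) & \det A = 1].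

Record isometry_group := IsometryGroup {
  isometry_set : set 'M[R]_3 ;
  isometry_setP : isometry_set `<=` orientation_preserving_isometry ;
  isometry_set1 : isometry_set 1%:M ;
  isometry_setM : forall A B,
    isometry_set A -> isometry_set B -> isometry_set (A *m B) ;
  isometry_setV : forall A, isometry_set A -> isometry_set (invmx A) }.

End HyperbolicPlane.

Section Surface.
Variables (R : realType) (G : isometry_group R).

Definition same_orbit (x y : hyp R) : bool :=
  `[< exists2 A, isometry_set G A & val y = val x *m A >].

Lemma same_orbit_refl : reflexive same_orbit.
Proof.
by move=> x; apply/asboolP; exists 1%:M; [exact: isometry_set1|rewrite mulmx1].
Qed.

Lemma same_orbit_sym : symmetric same_orbit.
Proof.
suff sym x y : same_orbit x y -> same_orbit y x.
  by move=> x y; apply/idP/idP; exact: sym.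
move=> /asboolP[A GA yE]; apply/asboolP; exists (invmx A).
  exact: isometry_setV.
have [_ _ detA] := isometry_setP GA.
by rewrite yE mulmxK// unitmxE detA unitr1.
Qed.

Lemma same_orbit_trans : transitive same_orbit.
Proof.
move=> y x z /asboolP[A GA yE] /asboolP[B GB zE]; apply/asboolP.
by exists (A *m B); [exact: isometry_setM|rewrite zE yE mulmxA].
Qed.

Definition orbit_equiv :=
  EquivRel same_orbit same_orbit_refl same_orbit_sym same_orbit_trans.

Definition surface : Type := quotient_topology {eq_quot orbit_equiv}.

HB.instance Definition _ :=
  Topological.copy surface (quotient_topology {eq_quot orbit_equiv}).
HB.instance Definition _ := Quotient.on surface.

Definition covering_map : hyp R -> surface := \pi_surface.

Definition acts_freely :=
  forall A (x : hyp R), isometry_set G A -> val x *m A = val x -> A = 1%:M.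

Definition acts_properly_discontinuously :=
  forall K : set (hyp R), compact K ->
    finite_set [set A | isometry_set G A /\
      exists x y, [/\ K x, K y & val y = val x *m A]].

Definition closed_hyperbolic_surface :=
  [/\ acts_freely, acts_properly_discontinuously &
      compact [set: surface]].

Implicit Types (a b c g : R -> surface) (F f : R * R -> surface).

Definition square : set (R * R) := `[0, 1] `*` `[0, 1].
Definition strip : set (R * R) := [set: R] `*` `[0, 1].

Definition path_homotopic a b :=
  exists F, [/\ {within square, continuous F},
    forall x, x \in `[0, 1] -> F (x, 0) = a x /\ F (x, 1) = b x &
    forall y, y \in `[0, 1] -> F (0, y) = a 0 /\ F (1, y) = a 1].

Definition freely_homotopic a b :=
  exists F, [/\ {within square, continuous F},
    forall x, x \in `[0, 1] -> F (x, 0) = a x /\ F (x, 1) = b x &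
    forall y, y \in `[0, 1] -> F (0, y) = F (1, y)].

(* A geodesic arc is parametrized on [0, 1] proportionally to arc length; as a
   function on [R], it is the complete geodesic that extends it. *)
Definition geodesic_arc g :=
  exists (l : R -> hyp R) (L : R),
    [/\ geodesic_line l, 0 < L & forall x, g x = covering_map (l (L * x))].

Definition closed_geodesic g :=
  geodesic_arc g /\ forall x, g (x + 1) = g x.

Definition simple_closed_geodesic g :=
  closed_geodesic g /\ {in `[0, 1[ &, injective g}.

Definition reverse g : R -> surface := fun x => g (1 - x).

(* [t] is the time of the first self-intersection of the ray [a], and [s] the
   length of the spoke.  The spoke is reduced to a point when [s = 0]. *)
Definition is_lasso a (s t : R) :=
  [/\ 0 <= s, s < t, a s = a t & {in `[0, t[ &, injective a}].

(* The lasso followed by the spoke backwards, parametrized on [0, 1]. *)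
Definition lasso_loop a (s t : R) : R -> surface := fun x =>
  let u := (s + t) * x in if u <= t then a u else a (s + t - u).

(* The annulus is the strip modulo [(x, y) ~ (x + 1, y)]. *)
Definition immersed_annulus f :=
  [/\ {within strip, continuous f},
      forall x y, y \in `[0, 1] -> f (x + 1, y) = f (x, y) &
      forall w, strip w ->
        exists2 V, nbhs w V & {in V `&` strip &, injective f}].

(* An immersed pair of half-pants is encoded by the parametrizations of its
   zipper and of its cuff, together with all the parametrizations of the
   half-pants by an annulus, whose metric is the one pulled back from the
   surface. *)
Record half_pants := HalfPants {
  zipper : set (R -> surface) ;
  cuff : set (R -> surface) ;
  body : set (R * R -> surface) }.

HB.instance Definition _ := gen_eqMixin half_pants.
HB.instance Definition _ := gen_choiceMixin half_pants.

Definition zipper_of g : set (R -> surface) := [set g; reverse g].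

Definition cuff_of g : set (R -> surface) :=
  [set c | simple_closed_geodesic c /\
    exists2 b, zipper_of g b & freely_homotopic b c].

(* Off [0, 1], [b] is not the zipper but the geodesic extending it. *)
Definition body_of g : set (R * R -> surface) :=
  [set f | immersed_annulus f /\
    exists b c, [/\ zipper_of g b, cuff_of g c,
      forall x, x \in `[0, 1] -> f (x, 0) = b x &
      forall x, f (x, 1) = c x]].

Definition half_pants_of g : half_pants :=
  HalfPants (zipper_of g) (cuff_of g) (body_of g).

(* [g] is the geodesic loop with the class of the loop of the lasso.  When it
   closes up smoothly, it coincides with the cuff and bounds no half-pants. *)
Definition lasso_induces a (P : half_pants) :=
  exists (s t : R) g,
    [/\ is_lasso a s t,
        geodesic_arc g,
        path_homotopic (lasso_loop a s t) g,
        ~ closed_geodesic g &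
        P = half_pants_of g].

Section MarkedPoint.
(* The marked point is [covering_map z]; the unit tangent circle there is
   identified with the one at [z], on which an orthonormal frame gives the
   angle. *)
Variables (z : hyp R) (e1 e2 : 'rV[R]_3).

Definition ray_induces (th : R) (P : half_pants) :=
  exists2 l, geodesic_from z (direction e1 e2 th) l &
    lasso_induces (fun t => covering_map (l t)) P.

Definition inducing_directions (P : half_pants) : set R :=
  [set th | 0 <= th < 2 * pi /\ ray_induces th P].

Definition lasso_half_pants : set half_pants :=
  [set P | inducing_directions P !=set0].

Definition gap (P : half_pants) : \bar R :=
  lebesgue_measure (inducing_directions P).

End MarkedPoint.
End Surface.

(* Main.v *)
Require Import Defs.
From mathcomp Require Import all_boot all_order all_algebra.
From mathcomp Require Import generic_quotient finmap.
From mathcomp Require Import all_classical all_reals all_analysis.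
From mathcomp Require Import ring lra.
Import Order.TTheory GRing.Theory Num.Theory.
Import numFieldNormedType.Exports.
Set Implicit Arguments.
Unset Strict Implicit.
Unset Printing Implicit Defensive.
Local Open Scope classical_set_scope.
Local Open Scope ring_scope.

(** Fix a lift [z] of the marked point.  If the first self-intersection of the
    ray [l] from [z] joins the times [s < t], then [l t = l s *m B] for exactly
    one [B] of the group, and the lift of the lasso that starts at [z] ends at
    [z *m B].  So the geodesic loop of the lasso is the projection of the
    segment from [z] to [z *m B] ([lasso_arc]).  The half-pants depend on [B]
    only and, as they remember their zipper up to reversal, they determine [B]
    up to inversion ([zipper_classes_eq]).  The directions that induce some
    half-pants are thus split into countably many disjoint measurable sets, and
    the sum of the gaps is the measure of their union: it remains to see that
    the union has full measure, and that each gap is at most [pi].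

    Almost every ray crosses itself ([simple_null]).  Let [th] be a density
    point of the set of directions of simple rays.  Bring the points of the ray
    of direction [th] at integer times back to a compact set by the group, and
    pass to a limit.  At the scale [exp (- n)], the rays with directions near
    [th] then look like the fan of all geodesics issued from one ideal point
    [xi].  A discrete cocompact group contains some [h] that moves [xi]
    ([no_fixed_null_line]), and among the geodesics of the fan, those that end
    close to [xi h^-1], on the appropriate side, cross their image under [h]
    ([crossing_parameter]).  Crossing is an open condition; hence, for
    infinitely many [n], a fixed proportion of the directions at distance
    [exp (- n)] from [th] belong to rays that cross themselves
    ([crossing_proportion]), which contradicts the density of [th].

    Lassos whose loop closes up smoothly, and the bound on the gaps.  An
    orientation-preserving isometry [B] fixes a nonzero vector [n] of Minkowski
    space, so that [mink (l u) n] takes the same value at the two ends [s] and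
    [t] of the loop.  This function of [u] is
    [cosh u * mink z n + sinh u * mink v n], where [v] is the direction of the
    ray: either both coefficients vanish, or they have opposite signs
    ([class_sign]).  If [mink z n] is not zero, then [v] lies in a half circle,
    whence the bound [pi] ([gap_le_pi]); moreover the geodesic loop has a corner
    at the marked point, because the function above is not periodic along it
    ([arc_not_closed]).  If [mink z n = 0], only two directions are left.  So
    the lassos that induce nothing take up countably many directions
    ([smooth_directions_countable]).

    That the class [B] depends only on the homotopy class of the lasso is the
    lifting of homotopies; it is obtained from sequences of points of a fine
    grid, each of which lifts near the previous one, since the points of an
    orbit are uniformly separated ([group_separated], [homotopy_endpoint]). *)

(** * The Minkowski form and the light cone *)
Section Minkowski.
Variable R : realType.
Implicit Types (x y z u v w n : 'rV[R]_3) (A B : 'M[R]_3) (a b c s t : R).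

Lemma sum3E (F : 'I_3 -> R) : \sum_(i < 3) F i = F 0 + F 1 + F ord_max.
Proof.
rewrite !big_ord_recr big_ord0 /= add0r; congr (F _ + F _ + F _);
  exact: val_inj.
Qed.

Lemma minkE x y :
  mink x y = x 0 0 * y 0 0 + x 0 1 * y 0 1 - x 0 ord_max * y 0 ord_max.
Proof. by rewrite /mink sum3E /= expr0 expr1 !mul1r mulN1r. Qed.

Lemma ord3P (P : 'I_3 -> Prop) : P 0 -> P 1 -> P ord_max -> forall i, P i.
Proof.
move=> P0 P1 P2 [[|[|[|//]]] i3].
- by rewrite (_ : Ordinal i3 = 0)//; exact: val_inj.
- by rewrite (_ : Ordinal i3 = 1)//; exact: val_inj.
- by rewrite (_ : Ordinal i3 = ord_max)//; exact: val_inj.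
Qed.

Lemma rV3P x y : x 0 0 = y 0 0 -> x 0 1 = y 0 1 ->
  x 0 ord_max = y 0 ord_max -> x = y.
Proof. by move=> h0 h1 h2; apply/rowP; apply: ord3P. Qed.

Lemma minkC x y : mink x y = mink y x.
Proof. rewrite !minkE; ring. Qed.

Lemma minkDl x y z : mink (x + y) z = mink x z + mink y z.
Proof. rewrite !minkE !mxE; ring. Qed.

Lemma minkDr x y z : mink z (x + y) = mink z x + mink z y.
Proof. rewrite !minkE !mxE; ring. Qed.

Lemma minkZl a x y : mink (a *: x) y = a * mink x y.
Proof. rewrite !minkE !mxE; ring. Qed.

Lemma minkZr a x y : mink x (a *: y) = a * mink x y.
Proof. rewrite !minkE !mxE; ring. Qed.

Lemma minkNl x y : mink (- x) y = - mink x y.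
Proof. rewrite !minkE !mxE; ring. Qed.

Lemma minkNr x y : mink x (- y) = - mink x y.
Proof. rewrite !minkE !mxE; ring. Qed.

Lemma mink0l x : mink 0 x = 0.
Proof. rewrite minkE !mxE; ring. Qed.

Lemma mink0r x : mink x 0 = 0.
Proof. rewrite minkE !mxE; ring. Qed.

Definition minklin :=
  (minkDl, minkDr, minkZl, minkZr, minkNl, minkNr, mink0l, mink0r).

(** The determinant of three vectors. Up to sign, [trip x y z] is the Minkowski
    product of [x] with the normal to the plane of [y] and [z]: its sign tells
    on which side of the geodesic through [y] and [z] the point [x] lies. *)
Definition trip x y z : R :=
  x 0 0 * (y 0 1 * z 0 ord_max - y 0 ord_max * z 0 1)
  - x 0 1 * (y 0 0 * z 0 ord_max - y 0 ord_max * z 0 0)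
  + x 0 ord_max * (y 0 0 * z 0 1 - y 0 1 * z 0 0).

Lemma mulmx3E x A i : (x *m A) 0 i =
  x 0 0 * A 0 i + x 0 1 * A 1 i + x 0 ord_max * A ord_max i.
Proof. by rewrite mxE sum3E. Qed.

Lemma det3E A : \det A = trip (row 0 A) (row 1 A) (row ord_max A).
Proof.
rewrite (expand_det_row _ 0) sum3E /cofactor /trip !mxE.
rewrite !(expand_det_row _ 0) !big_ord_recr !big_ord0 /= /cofactor.
rewrite !det_mx11 !mxE /=.
have l1 : lift 0 0 = 1 :> 'I_3 by exact: val_inj.
have l2 : lift 0 (lift 0 0) = ord_max :> 'I_3 by exact: val_inj.
have l3 : lift 0 (widen_ord (leqnSn 1) ord_max) = 1 :> 'I_3 by exact: val_inj.
have l4 : lift 0 (lift (widen_ord (leqnSn 1) ord_max) 0) = ord_max :> 'I_3.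
  by exact: val_inj.
have l5 : lift 0 ord_max = ord_max :> 'I_3 by exact: val_inj.
have l6 : lift 0 (lift ord_max 0) = 1 :> 'I_3 by exact: val_inj.
have l7 : lift 1 (widen_ord (leqnSn 1) ord_max) = 0 :> 'I_3 by exact: val_inj.
have l8 : lift 1 (lift (widen_ord (leqnSn 1) ord_max) 0) = ord_max :> 'I_3.
  by exact: val_inj.
have l9 : lift 1 ord_max = ord_max :> 'I_3 by exact: val_inj.
have l10 : lift 1 (lift ord_max 0) = 0 :> 'I_3 by exact: val_inj.
have l11 : lift ord_max (widen_ord (leqnSn 1) ord_max) = 0 :> 'I_3.
  by exact: val_inj.
have l12 : lift ord_max (lift (widen_ord (leqnSn 1) ord_max) 0) = 1 :> 'I_3.
  by exact: val_inj.
have l13 : lift ord_max ord_max = 1 :> 'I_3 by exact: val_inj.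
have l14 : lift ord_max (lift ord_max 0) = 0 :> 'I_3 by exact: val_inj.
rewrite ?l2 ?l1 ?l3 ?l4 ?l5 ?l6 ?l7 ?l8 ?l9 ?l10 ?l11 ?l12 ?l13 ?l14.
rewrite modn_small// !expr0 expr1 expr2; ring.
Qed.

Lemma trip_mulmx x y z A : trip (x *m A) (y *m A) (z *m A) = \det A * trip x y
  z.
Proof. rewrite det3E /trip !mulmx3E !mxE; ring. Qed.

Lemma tripD1 x x' y z : trip (x + x') y z = trip x y z + trip x' y z.
Proof. rewrite /trip !mxE; ring. Qed.

Lemma tripD3 x y z z' : trip x y (z + z') = trip x y z + trip x y z'.
Proof. rewrite /trip !mxE; ring. Qed.

Lemma tripZ1 a x y z : trip (a *: x) y z = a * trip x y z.
Proof. rewrite /trip !mxE; ring. Qed.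

Lemma tripZ2 a x y z : trip x (a *: y) z = a * trip x y z.
Proof. rewrite /trip !mxE; ring. Qed.

Lemma tripZ3 a x y z : trip x y (a *: z) = a * trip x y z.
Proof. rewrite /trip !mxE; ring. Qed.

Lemma trip_rot x y z : trip x y z = trip y z x.
Proof. rewrite /trip; ring. Qed.

Lemma trip_swap x y z : trip x y z = - trip y x z.
Proof. rewrite /trip; ring. Qed.

Lemma trip112 x y : trip x x y = 0. Proof. rewrite /trip; ring. Qed.
Lemma trip121 x y : trip x y x = 0. Proof. rewrite /trip; ring. Qed.
Lemma trip122 x y : trip x y y = 0. Proof. rewrite /trip; ring. Qed.

Lemma cramer3 x y z u :
  trip x y z *: u = trip u y z *: x + trip x u z *: y + trip x y u *: z.
Proof. by apply: rV3P; rewrite /trip !mxE; ring. Qed.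

(** The Minkowski form has determinant [-1], hence the sign. *)
Lemma trip_gram x y z :
  mink x x * (mink y y * mink z z - mink y z ^+ 2)
  - mink x y * (mink x y * mink z z - mink y z * mink x z)
  + mink x z * (mink x y * mink y z - mink y y * mink x z) = - trip x y z ^+ 2.
Proof. rewrite !minkE /trip; ring. Qed.

(** The orthogonal of a timelike vector is spacelike, by Lagrange's identity;
    this is the source of all inequalities of hyperbolic geometry below. *)
Lemma timelike_orth_ge0 z u : mink z z < 0 -> mink z u = 0 -> 0 <= mink u u.
Proof.
rewrite !minkE => z0 zu.
set z0' := z 0 0 in z0 zu *; set z1 := z 0 1 in z0 zu *.
set z2 := z 0 ord_max in z0 zu *; set u0 := u 0 0 in zu *.
set u1 := u 0 1 in zu *; set u2 := u 0 ord_max in zu *.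
have z2gt : 0 < z2 ^+ 2.
  by have := sqr_ge0 z0'; have := sqr_ge0 z1; rewrite !expr2 => *; lra.
suff : 0 <= z2 ^+ 2 * (u0 * u0 + u1 * u1 - u2 * u2) by rewrite pmulr_rge0.
have -> : z2 ^+ 2 * (u0 * u0 + u1 * u1 - u2 * u2) =
  (u0 ^+ 2 + u1 ^+ 2) * - (z0' * z0' + z1 * z1 - z2 * z2)
  + (z0' * u1 - z1 * u0) ^+ 2
  + (z0' * u0 + z1 * u1 - z2 * u2) * (z0' * u0 + z1 * u1 + z2 * u2) by ring.
rewrite zu mul0r addr0 addr_ge0 ?sqr_ge0// mulr_ge0 ?addr_ge0 ?sqr_ge0//.
by rewrite oppr_ge0 ltW.
Qed.

Lemma timelike_orth_eq0 z u : mink z z < 0 -> mink z u = 0 -> mink u u = 0 ->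
  u = 0.
Proof.
rewrite !minkE => z0 zu uu.
set z0' := z 0 0 in z0 zu *; set z1 := z 0 1 in z0 zu *.
set z2 := z 0 ord_max in z0 zu *; set u0 := u 0 0 in zu uu *.
set u1 := u 0 1 in zu uu *; set u2 := u 0 ord_max in zu uu *.
have z2gt : 0 < z2 ^+ 2.
  by have := sqr_ge0 z0'; have := sqr_ge0 z1; rewrite !expr2 => *; lra.
have : 0 = (u0 ^+ 2 + u1 ^+ 2) * - (z0' * z0' + z1 * z1 - z2 * z2)
  + (z0' * u1 - z1 * u0) ^+ 2.
  transitivity (z2 ^+ 2 * (u0 * u0 + u1 * u1 - u2 * u2)
    - (z0' * u0 + z1 * u1 - z2 * u2) * (z0' * u0 + z1 * u1 + z2 * u2)).
    by rewrite uu zu mulr0 mul0r subr0.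
  by ring.
move/esym/eqP; rewrite paddr_eq0 ?sqr_ge0//; last first.
  by rewrite mulr_ge0 ?addr_ge0 ?sqr_ge0// oppr_ge0 ltW.
move=> /andP[]; rewrite mulf_eq0 oppr_eq0 (lt_eqF z0) orbF.
rewrite paddr_eq0 ?sqr_ge0// !sqrf_eq0 => /andP[/eqP u00 /eqP u10] _.
move: uu; rewrite u00 u10 !mul0r !add0r => /eqP; rewrite oppr_eq0 mulf_eq0 orbb.
by move=> /eqP u20; apply: rV3P; rewrite !mxE.
Qed.

Lemma hyperboloid_ge1 x : hyperboloid x -> 1 <= x 0 ord_max.
Proof.
move=> [+ x2]; rewrite minkE => xx; rewrite leNgt; apply/negP => h.
have := sqr_ge0 (x 0 0); have := sqr_ge0 (x 0 1); rewrite !expr2 => *; nra.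
Qed.

(** The solid upper light cone without its apex: up to positive factors, the
    points of the hyperbolic plane and of its circle at infinity. *)
Definition future x := mink x x <= 0 /\ 0 < x 0 ord_max.

Lemma hyperboloid_future x : hyperboloid x -> future x.
Proof. by move=> [xx x2]; split; rewrite ?xx. Qed.

Lemma future_mink_le0 x y : future x -> future y -> mink x y <= 0.
Proof.
rewrite /future !minkE => -[xx x2] [yy y2].
set a := x 0 0 in xx *; set b := x 0 1 in xx *; set c := x 0 ord_max in xx x2 *.
set d := y 0 0 in yy *; set e := y 0 1 in yy *; set f := y 0 ord_max in yy y2 *.
rewrite subr_le0; apply: le_trans (ler_norm _) _.
rewrite -(ler_pXn2r (ltn0Sn 1)) ?nnegrE ?mulr_ge0 ?(ltW x2) ?(ltW y2)//.
rewrite real_normK ?num_real//.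
have -> : (a * d + b * e) ^+ 2 = (a * a + b * b) * (d * d + e * e)
   - (a * e - b * d) ^+ 2 by ring.
apply: (@le_trans _ _ ((a * a + b * b) * (d * d + e * e))).
  by rewrite gerBl sqr_ge0.
rewrite exprMn; apply: ler_pM; rewrite ?addr_ge0 -?expr2 ?sqr_ge0//;
  rewrite !expr2; lra.
Qed.

(** A future vector is orthogonal to another one only if both lie on the same
    line of the light cone: distinct ideal points have a negative product. *)
Lemma future_mink_eq0 x y : future x -> future y -> mink x y = 0 ->
  mink x x = 0 /\ x = (x 0 ord_max / y 0 ord_max) *: y.
Proof.
move=> fx fy xy; have [xx x2] := fx; have [yy y2] := fy.
have xx0 : mink x x = 0.
  apply/eqP; rewrite eq_le xx /= leNgt; apply/negP => xlt.
  have yy0 : mink y y = 0 by apply/eqP;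
    rewrite eq_le yy (timelike_orth_ge0 xlt).
  have y0 := timelike_orth_eq0 xlt xy yy0.
  by move: y2; rewrite y0 mxE ltxx.
split=> //; set k := _ / _.
have k0 : k * y 0 ord_max = x 0 ord_max by rewrite divfK// gt_eqF.
have dd : mink (x - k *: y) (x - k *: y) <= 0.
  have := mulr_ge0_le0 (sqr_ge0 k) yy; rewrite expr2 => h.
  rewrite !minklin xx0 (minkC y x) xy; lra.
move: dd; rewrite minkE !mxE k0 subrr mulr0 subr0 => dd.
have : (x 0 0 - k * y 0 0) ^+ 2 + (x 0 1 - k * y 0 1) ^+ 2 == 0.
  by rewrite eq_le addr_ge0 ?sqr_ge0// !expr2 dd.
rewrite paddr_eq0 ?sqr_ge0// !sqrf_eq0 !subr_eq0 => /andP[/eqP h0 /eqP h1].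
by apply: rV3P; rewrite !mxE.
Qed.

(** [- mink x y] is the hyperbolic cosine of the distance of [x] and [y]. *)
Lemma hyperboloid_mink_le x y : hyperboloid x -> hyperboloid y ->
  mink x y <= -1.
Proof.
move=> [xx x2] [yy y2].
have xy0 := future_mink_le0 (hyperboloid_future (conj xx x2))
  (hyperboloid_future (conj yy y2)).
have : 0 <= mink (y + mink x y *: x) (y + mink x y *: x).
  by apply: (@timelike_orth_ge0 x); rewrite ?xx ?ltrN10// !minklin xx; ring.
rewrite !minklin xx yy (minkC y x) => h.
have : 1 <= (mink x y) ^+ 2 by rewrite expr2; lra.
rewrite -(sqrrN (mink x y)) expr_ge1// ?oppr_ge0//; lra.
Qed.

Lemma hyperboloid_mink_eq x y : hyperboloid x -> hyperboloid y ->
  mink x y = -1 -> x = y.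
Proof.
move=> [xx x2] [yy y2] xy.
apply/eqP; rewrite -subr_eq0; apply/eqP; apply: (@timelike_orth_eq0 (x + y)).
- by rewrite !minklin xx yy (minkC y x) xy; lra.
- by rewrite !minklin xx yy (minkC y x) xy; lra.
- by rewrite !minklin xx yy (minkC y x) xy; lra.
Qed.

(** Points may be compared up to positive factors, instead of being
    normalized. *)
Lemma hyperboloid_scale x y k k' : hyperboloid x -> hyperboloid y ->
  0 < k -> k *: x = k' *: y -> x = y.
Proof.
move=> [xx x2] [yy y2] k0 e.
have k'0 : 0 < k'.
  move: (congr1 (fun u : 'rV_3 => u 0 ord_max) e); rewrite !mxE => e2.
  by rewrite -(pmulr_lgt0 _ y2) -e2 mulr_gt0.
have : mink (k *: x) (k *: x) = mink (k' *: y) (k' *: y) by rewrite e.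
rewrite !minklin xx yy !mulrN1 !mulrN => /oppr_inj kk.
have kE : k = k'.
  have : (k - k') * (k + k') == 0 by apply/eqP; rewrite mulrDr !mulrBl kk; ring.
  by rewrite mulf_eq0 subr_eq0 (gt_eqF (addr_gt0 k0 k'0)) orbF => /eqP.
by move: e; rewrite -kE => /scalerI; apply; rewrite gt_eqF.
Qed.

End Minkowski.

(** * Isometries, geodesics and their crossings *)
Section Geodesics.
Variable R : realType.
Implicit Types (x y z u v w n : 'rV[R]_3) (A B : 'M[R]_3) (a b c s t : R).

Lemma future_mink_lt0 x y : hyperboloid x -> future y -> mink x y < 0.
Proof.
move=> hx fy; rewrite lt_neqAle (future_mink_le0 (hyperboloid_future hx))//
  andbT.
apply/eqP => xy; have [+ _] := future_mink_eq0 (hyperboloid_future hx) fy xy.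
by move: hx => [-> _] /eqP; rewrite oppr_eq0 oner_eq0.
Qed.

(** The two halves of the solid light cone are told apart by the sign of the
    product with any point of the hyperboloid, a sign that isometries keep. *)
Lemma future_mink x y : hyperboloid x -> mink y y <= 0 -> mink x y < 0 ->
  future y.
Proof.
move=> hx yy xy; split=> //; rewrite ltNge le_eqVlt; apply/negP =>
  /orP[/eqP y2|y2].
  suff y0 : y = 0 by move: xy; rewrite y0 mink0r ltxx.
  have := sqr_ge0 (y 0 0); have := sqr_ge0 (y 0 1).
  move: yy; rewrite minkE y2 mulr0 subr0 => yy h1 h0.
  have : y 0 0 ^+ 2 + y 0 1 ^+ 2 == 0 by rewrite eq_le addr_ge0// !expr2 yy.
  rewrite paddr_eq0// !sqrf_eq0 => /andP[/eqP e0 /eqP e1].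
  by apply: rV3P; rewrite !mxE.
have : mink x (- y) < 0.
  apply: future_mink_lt0 => //; split; first by rewrite !minklin opprK.
  by rewrite mxE oppr_gt0.
by rewrite minkNr oppr_lt0 => /ltW; rewrite leNgt xy.
Qed.

Section Isometries.
Variable A : 'M[R]_3.
Hypothesis iA : orientation_preserving_isometry A.

Lemma isom_mink x y : mink (x *m A) (y *m A) = mink x y.
Proof. by case: iA. Qed.

Lemma isom_hyp x : hyperboloid x -> hyperboloid (x *m A).
Proof. by case: iA => _ + _; apply. Qed.

Lemma isom_trip x y z : trip (x *m A) (y *m A) (z *m A) = trip x y z.
Proof. by rewrite trip_mulmx; case: iA => _ _ ->; rewrite mul1r. Qed.

Lemma isom_unit : A \in unitmx.
Proof. by case: iA => _ _ dA; rewrite unitmxE dA unitr1. Qed.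

Lemma isom_mulK x : x *m A *m invmx A = x.
Proof. by rewrite mulmxK// isom_unit. Qed.

Lemma isom_mulVK x : x *m invmx A *m A = x.
Proof. by rewrite mulmxKV// isom_unit. Qed.

Lemma isom_future x : future x -> future (x *m A).
Proof.
move=> fx; have [xx x2] := fx.
pose o : 'rV[R]_3 := \row_i (i == ord_max)%:R.
have ho : hyperboloid o by split; rewrite ?minkE !mxE/= ?ltr01//; lra.
apply: (@future_mink (o *m A)); rewrite ?isom_mink//; first exact: isom_hyp.
exact: future_mink_lt0.
Qed.

Lemma isom_adj x y : mink (x *m A) y = mink x (y *m invmx A).
Proof. by rewrite -{1}(isom_mulVK y) isom_mink. Qed.

(** [A] preserves the form, so that [A - 1] and the adjoint of [1 - A] have the
    same determinant up to a unit of determinant 1; in odd dimension that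
    determinant is its own opposite.  For a hyperbolic [A] the vector is the
    normal to its axis. *)
Lemma isom_fixed_vector : exists2 n : 'rV[R]_3, n != 0 & n *m A = n.
Proof.
have d0 : \det (A - 1%:M) = 0.
  have [hm _ dA] := iA.
  pose J : 'M[R]_3 := \matrix_(i, j) mink (delta_mx 0 i) (delta_mx 0 j).
  have JE x y : mink x y = (x *m J *m y^T) 0 0.
    rewrite mxE sum3E !mulmx3E !mxE !minkE !mxE /=; ring.
  have AJA : A *m J *m A^T = J.
    apply/matrixP => i j; rewrite [RHS]mxE -(hm (delta_mx 0 i)) JE.
    rewrite trmx_mul !mulmxA.
    by rewrite -!(mulmxA 'e_i) -rowE trmx_delta -colE !mxE.
  have dJ : \det J != 0.
    rewrite det3E /trip !mxE !minkE !mxE /= !(mulr0, mul0r, mulr1, addr0,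
      subr0, add0r, sub0r).
    by rewrite ?(mulrN1, mulr1, mulr0, mulN1r, mul1r, oppr0, addr0,
      subr0) oppr_eq0 oner_eq0.
  (* multiplying by J and the transpose of A turns [A - 1] into [1 - A] *)
  have e : (A - 1%:M) *m J *m A^T = J *m (1%:M - A)^T.
    by rewrite !mulmxBl mul1mx AJA linearB /= trmx1 mulmxBr mulmx1.
  have dN : \det (1%:M - A) = - \det (A - 1%:M).
    by rewrite -(opprB A) -[- (A - _)]scaleN1r detZ -signr_odd expr1 mulN1r.
  move: (congr1 determinant e); rewrite !det_mulmx !det_tr dA mulr1 dN mulrC.
  by move=> /(mulfI dJ) /eqP; rewrite -subr_eq0 opprK -mulr2n mulrn_eq0 => /eqP.
move/eqP/det0P : d0 => [n n0 /eqP]; rewrite mulmxBr mulmx1 subr_eq0 => /eqP nA.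
by exists n.
Qed.

End Isometries.

Lemma cosh2 t : cosh t ^+ 2 - sinh t ^+ 2 = 1 :> R.
Proof.
have : expR t * expR (- t) = 1 by rewrite -expRD subrr expR0.
by move=> h; rewrite -[RHS]h /cosh /sinh; field.
Qed.

Lemma coshDsinh t : cosh t + sinh t = expR t :> R.
Proof. by rewrite /cosh /sinh; field. Qed.

Lemma coshBsinh t : cosh t - sinh t = expR (- t) :> R.
Proof. by rewrite /cosh /sinh; field. Qed.

Lemma cosh_gt0 t : 0 < cosh t :> R.
Proof. by rewrite divr_gt0// addr_gt0// expR_gt0. Qed.

Lemma sinhS s t : s < t -> sinh s < sinh t :> R.
Proof.
move=> st; have : expR s < expR t by rewrite ltr_expR.
have : expR (- t) < expR (- s) by rewrite ltr_expR ltrN2.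
by rewrite /sinh => *; lra.
Qed.

Lemma sinh_inj : injective (@sinh R).
Proof. by move=> s t e; have [/sinhS|/sinhS|//] := ltgtP s t; rewrite e ltxx.
  Qed.

Lemma sinh0 : sinh 0 = 0 :> R.
Proof. by rewrite /sinh oppr0 subrr mul0r. Qed.

Lemma cosh0 : cosh 0 = 1 :> R.
Proof. by rewrite /cosh oppr0 expR0; field. Qed.

Lemma sinh_gt0 t : 0 < t -> 0 < sinh t :> R.
Proof. by move=> /sinhS; rewrite sinh0. Qed.

Lemma coshS s t : 0 <= s -> s < t -> cosh s < cosh t :> R.
Proof.
move=> s0 st; have := sinhS st; have := cosh2 s; have := cosh2 t.
have ss : 0 <= sinh s by move: s0; rewrite le_eqVlt =>
  /predU1P[<-|/sinh_gt0/ltW//]; rewrite sinh0.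
have := cosh_gt0 s; have := cosh_gt0 t; rewrite !expr2 => *; nra.
Qed.

(** Geodesics as curves of vectors: computing with them requires no membership
    proof. *)
Definition geo z v t := cosh t *: z + sinh t *: v.

Definition utangent z v := mink z v = 0 /\ mink v v = 1.

(** [z + v] and [z - v] represent the endpoints at infinity. *)
Lemma geoE z v t : geo z v t = (expR t / 2) *: (z + v) + (expR (- t) / 2) *: (z
  - v).
Proof. by apply: rV3P; rewrite !mxE /cosh /sinh; field. Qed.

Lemma geo0 z v : geo z v 0 = z.
Proof. by rewrite /geo cosh0 sinh0 scale1r scale0r addr0. Qed.

Lemma geo_mulmx z v t A : geo z v t *m A = geo (z *m A) (v *m A) t.
Proof. by rewrite mulmxDl -!scalemxAl. Qed.

Lemma utangent_future z v : hyperboloid z -> utangent z v ->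
  future (z + v) /\ future (z - v).
Proof.
move=> hz [zv vv]; have [zz _] := hz.
by split; apply: (@future_mink z) => //;
  rewrite !minklin zz ?vv ?(minkC v z) zv; lra.
Qed.

Lemma geo_hyp z v t : hyperboloid z -> utangent z v -> hyperboloid (geo z v t).
Proof.
move=> hz zv; have [zz _] := hz; have [zv0 vv] := zv; split.
  transitivity (- (cosh t ^+ 2 - sinh t ^+ 2)); last by rewrite cosh2.
  rewrite /geo !minklin zz vv (minkC v z) zv0; ring.
have [[_ h1] [_ h2]] := utangent_future hz zv.
by rewrite geoE !mxE addr_gt0// mulr_gt0 ?divr_gt0 ?expR_gt0//;
  move: h1 h2; rewrite !mxE.
Qed.

Lemma geo_inj z v : utangent z v -> injective (geo z v).
Proof.
move=> [zv vv] s t /(congr1 (mink v)); rewrite /geo !minklin (minkC v) zv vv.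
by rewrite !mulr0 !add0r !mulr1 => /sinh_inj.
Qed.

(** The product with [z] determines the length, and the length the direction. *)
Lemma geo_uniq z v v' L L' : hyperboloid z -> utangent z v -> utangent z v' ->
  0 < L -> 0 < L' -> geo z v L = geo z v' L' -> v = v' /\ L = L'.
Proof.
move=> [zz _] [zv vv] [zv' vv'] L0 L'0 e.
have LL : L = L'.
  move: (congr1 (mink z) e); rewrite /geo !minklin zz zv zv' => h.
  have {}h : cosh L = cosh L' by lra.
  by have [/(coshS (ltW L0))|/(coshS (ltW L'0))|//] := ltgtP L L';
    rewrite h ltxx.
split=> //; move: e; rewrite /geo LL => /addrI /scalerI; apply.
by rewrite gt_eqF// sinh_gt0.
Qed.

Lemma geo_exists z y : hyperboloid z -> hyperboloid y -> z <> y ->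
  exists v L, [/\ utangent z v, 0 < L & geo z v L = y].
Proof.
move=> hz hy zy; have [zz _] := hz; have [yy _] := hy.
set c := - mink z y.
have c1 : 1 < c.
  rewrite lt_neqAle lerNr hyperboloid_mink_le// andbT; apply/eqP => c1.
  by apply: zy; apply: hyperboloid_mink_eq => //; rewrite c1 opprK.
pose d := Num.sqrt (c ^+ 2 - 1).
have c2 : 0 < c ^+ 2 - 1 by rewrite expr2; nra.
have d0 : 0 < d by rewrite sqrtr_gt0.
have dd : d ^+ 2 = c ^+ 2 - 1 by rewrite sqr_sqrtr// ltW.
have dc : 1 < c + d by lra.
have eL : expR (ln (c + d)) = c + d by rewrite lnK// posrE; lra.
have eNL : expR (- ln (c + d)) = c - d.
  have cd0 : c + d != 0 by rewrite gt_eqF//; lra.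
  rewrite expRN eL; apply: (mulfI cd0).
  by rewrite divff// mulrC -subr_sqr dd; ring.
have cE : cosh (ln (c + d)) = c by rewrite /cosh eL eNL; field.
have sE : sinh (ln (c + d)) = d by rewrite /sinh eL eNL; field.
exists (d^-1 *: (y - c *: z)), (ln (c + d)); split.
- have zyE : mink z y = - c by rewrite opprK.
  split; first by rewrite !minklin zz zyE; ring.
  transitivity ((c ^+ 2 - 1) / d ^+ 2); last by rewrite dd divff// gt_eqF.
  by rewrite !minklin zz yy (minkC y z) zyE; field; rewrite gt_eqF.
- by rewrite ln_gt0.
- rewrite /geo cE sE scalerA divff ?gt_eqF// scale1r.
  by rewrite addrC subrK.
Qed.

(** [z + v] represents the endpoint at infinity of the ray, so that positive
    combinations of [z] and [z + v] represent its points. *)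
Lemma sector_geo z v a b : 0 < a -> 0 < b ->
  exists k t, [/\ 0 < k, 0 <= t & a *: z + b *: (z + v) = k *: geo z v t].
Proof.
move=> a0 b0; pose r := 1 + 2 * (b / a).
have r1 : 1 < r by rewrite /r ltrDl mulr_gt0// divr_gt0.
have r0 : 0 < r by lra.
pose t := ln r / 2.
have t0 : 0 <= t by rewrite divr_ge0// ln_ge0// ltW.
have et : expR t * expR t = r by rewrite -expRD -splitr lnK.
have ent : expR t * expR (- t) = 1 by rewrite -expRD subrr expR0.
exists (a * expR t), t; split=> //; first by rewrite mulr_gt0// expR_gt0.
have e1 : a * expR t * (expR t / 2) = a / 2 + b.
  transitivity (a * (expR t * expR t) / 2); first by field.
  by rewrite et /r; field; rewrite gt_eqF.
have e2 : a * expR t * (expR (- t) / 2) = a / 2.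
  transitivity (a * (expR t * expR (- t)) / 2); first by field.
  by rewrite ent mulr1.
rewrite geoE [RHS]scalerDr !scalerA e1 e2.
by apply: rV3P; rewrite !mxE; field.
Qed.

Lemma opp_signs_comb p q : p * q < 0 -> exists a b : R, [/\ 0 < a,
  0 < b & a * p + b * q = 0].
Proof.
move=> pq; have [p0|p0|p0] := ltgtP p 0.
- by exists q, (- p); split; [nra|lra|ring].
- by exists (- q), p; split; [nra|lra|ring].
- by move: pq; rewrite p0 mul0r ltxx.
Qed.

(** The hypotheses say that the line of each of the two rays separates the
    origin and the ideal end of the other ray. Then both rays meet the
    intersection of the two lines, which is a single point. *)
Lemma ray_crosses z v A : hyperboloid z -> utangent z v ->
  orientation_preserving_isometry A ->
  let w := z + v in
  trip (z *m invmx A) z w * trip (w *m invmx A) z w < 0 ->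
  trip (z *m A) z w * trip (w *m A) z w < 0 ->
  exists s t, [/\ 0 <= s, 0 <= t & geo z v t = geo z v s *m A].
Proof.
move=> hz zv iA w h1 h2.
have [a [b [a0 b0 ab]]] := opp_signs_comb h1.
have [c [d [c0 d0 cd]]] := opp_signs_comb h2.
set Z := z *m invmx A in h1 ab *; set W := w *m invmx A in h1 ab *.
have D0 : trip Z z w != 0 by apply: contraTneq h1 => ->; rewrite mul0r ltxx.
have E0 : trip (z *m A) z w != 0 by apply: contraTneq h2 => ->;
  rewrite mul0r ltxx.
(* a point of the translate by [invmx A], on the line of z and w *)
pose p := a *: Z + b *: W.
have p0 : trip p z w = 0 by rewrite /p tripD1 !tripZ1 ab.
have pE : trip Z z w *: p = trip Z p w *: z + trip Z z p *: w.
  by rewrite cramer3 p0 scale0r add0r.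
have pA : p *m A = a *: z + b *: w.
  by rewrite mulmxDl -!scalemxAl !(isom_mulVK iA).
have pA0 : trip (p *m A) z w = 0.
  by rewrite pA tripD1 !tripZ1 trip112 trip121 !mulr0 addr0.
have : trip Z p w * trip (z *m A) z w + trip Z z p * trip (w *m A) z w = 0.
  by rewrite -!tripZ1 -tripD1 !scalemxAl -mulmxDl -pE -scalemxAl tripZ1 pA0
    mulr0.
set al := trip Z p w in pE *; set be := trip Z z p in pE * => ab2.
(* hence p is a multiple of c z + d w *)
have prop : (d * trip Z z w) *: p = be *: (c *: z + d *: w).
  rewrite -scalerA pE !scalerDr !scalerA.
  have -> : d * al = be * c; last by rewrite (mulrC d).
  apply: (mulIf E0).
  transitivity (d * (al * trip (z *m A) z w)); first by ring.
  rewrite (_ : al * _ = - (be * trip (w *m A) z w)); last by apply/eqP;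
    rewrite -addr_eq0 ab2.
  transitivity (be * (- (d * trip (w *m A) z w))); first by ring.
  rewrite (_ : - _ = c * trip (z *m A) z w); first by ring.
  by apply/eqP; rewrite eq_sym -addr_eq0 cd.
have [k [t [k0 t0 kt]]] := sector_geo z v a0 b0.
have [k' [s [k'0 s0 ks]]] := sector_geo z v c0 d0.
exists s, t; split=> //; apply: (@hyperboloid_scale _ _ _ k (k' * (be / (d *
  trip Z z w)))) => //.
- exact: geo_hyp.
- by apply: isom_hyp => //; exact: geo_hyp.
rewrite mulrC -scalerA scalemxAl -ks -kt -/w -pA scalemxAl; congr (_ *m _).
rewrite mulrC -scalerA -prop scalerA mulVf ?scale1r// mulf_neq0// gt_eqF//.
Qed.

End Geodesics.

(** * Topology of the hyperboloid *)

(** The subtype carries the initial topology, so that a cluster point in the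
    ambient space is one in the subtype as soon as it lies in it. *)
Lemma compact_set_type (T : topologicalType) (A K : set T) : closed A ->
  compact K -> compact ((set_val : A -> T) @^-1` K).
Proof.
move=> cA cK F PF FK.
have GK : (set_val @ F) K by [].
have [p [Kp clp]] := cK _ _ GK.
have Ap : A p.
  apply: cA => W Wp.
  have [] := clp A W => //.
    by apply: (@filterS _ F _ setT) => [a _|]; [exact: set_valP|exact: filterT].
  by move=> q [Aq Wq]; exists q.
exists (exist _ p (mem_set Ap) : A); split=> // U V FU Vx.
have [W [[Q oQ <-] Qx QV]] := Vx.
have [] := clp (set_val @` U) Q.
- by apply: (@filterS _ F _ U) => // u Uu; exists u.
- by apply: open_nbhs_nbhs; split.
by move=> q [[u Uu <-] Qu]; exists u; split=> //; apply: QV.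
Qed.

Lemma cont_comp (U V W : topologicalType) (f : U -> V) (g : V -> W) :
  continuous f -> continuous g -> continuous (fun p => g (f p)).
Proof. by move=> cf cg p; apply: continuous_comp (cf p) (cg (f p)). Qed.

Section RealContinuity.
Variables (R : realType) (T : topologicalType).
Implicit Types f g : T -> R.

Lemma contD f g : continuous f -> continuous g -> continuous (fun p =>
  f p + g p).
Proof. by move=> cf cg p; exact: cvgD (cf p) (cg p). Qed.

Lemma contB f g : continuous f -> continuous g -> continuous (fun p =>
  f p - g p).
Proof. by move=> cf cg p; exact: cvgB (cf p) (cg p). Qed.

Lemma contN f : continuous f -> continuous (fun p => - f p).
Proof. by move=> cf p; exact: cvgN (cf p). Qed.

Lemma contM f g : continuous f -> continuous g -> continuous (fun p =>
  f p * g p).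
Proof. by move=> cf cg p; exact: cvgM (cf p) (cg p). Qed.

Lemma cont_cst (a : R) : continuous (fun _ : T => a).
Proof. by move=> p; exact: cvg_cst. Qed.

End RealContinuity.

Section Topology.
Variable R : realType.
Implicit Types (x y z u v w n : 'rV[R]_3) (A B : 'M[R]_3) (a b c s t : R).

(** Continuity of vector-valued maps is reduced to that of polynomials in the
    coordinates. *)
Lemma coord_cvg (T : topologicalType) (f : T -> 'rV[R]_3) : 
  (forall i, continuous (fun p => f p 0 i)) -> continuous f.
Proof.
move=> h p; apply/cvg_ballP => e e0; near=> q; split=> // i j; rewrite ord1.
move: j; apply: ord3P; near: q; move: (h) => /(_ _ p)/cvg_ballP; exact.
Unshelve. all: by end_near. Qed.

Lemma cvg_coord (T : topologicalType) (f : T -> 'rV[R]_3) i : 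
  continuous f -> continuous (fun p => f p 0 i).
Proof. by move=> cf p; apply: (@continuous_comp _ _ _ f (fun M : 'rV[R]_3 =>
  M 0 i) p (cf p)); exact: coord_continuous. Qed.

Lemma continuous_mink (T : topologicalType) (f g : T -> 'rV[R]_3) :
  continuous f -> continuous g -> continuous (fun p => mink (f p) (g p)).
Proof.
move=> cf cg.
rewrite (_ : (fun p => _) = fun p => f p 0 0 * g p 0 0 + f p 0 1 * g p 0 1
   - f p 0 ord_max * g p 0 ord_max); last by apply/funext => p; rewrite minkE.
by apply: contB; [apply: contD|]; apply: contM; exact: cvg_coord.
Qed.

Lemma continuous_mulmx3 (T : topologicalType) (f : T -> 'rV[R]_3) A :
  continuous f -> continuous (fun p => f p *m A).
Proof.
move=> cf; apply: coord_cvg => i.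
rewrite (_ : (fun p => _) = fun p => f p 0 0 * A 0 i + f p 0 1 * A 1 i
   + f p 0 ord_max * A ord_max i); last by apply/funext => p; rewrite mulmx3E.
apply: contD; [apply: contD|]; apply: contM; try exact: cont_cst.
all: exact: cvg_coord.
Qed.

Lemma closed_hyperboloid : closed (@hyperboloid R).
Proof.
have -> : @hyperboloid R = [set x | mink x x = -1] `&` [set x | 1 <= x 0
  ord_max].
  rewrite eqEsubset; split=> x [h1 h2]; split=> //.
    exact: hyperboloid_ge1.
  by apply: lt_le_trans h2.
have ci : continuous (@idfun 'rV[R]_3) by move=> ?; exact: cvg_id.
apply: closedI.
  apply: (@preimage_closed _ _ (fun x => mink x x) [set y | y = -1]).
    by move=> x _; exact: continuous_mink.
  exact: closed_eq.
apply: (@preimage_closed _ _ (fun x : 'rV[R]_3 =>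
  x 0 ord_max) [set y : R | 1 <= y]).
  by move=> x _; exact: coord_continuous.
exact: closed_ge.
Qed.

Lemma compact_box c : compact [set x : 'rV[R]_3 | forall i, `[- c,
  c]%classic (x 0 i)].
Proof.
by apply: (@rV_compact R 3 (fun=> `[- c, c]%classic)) => i;
  exact: segment_compact.
Qed.

(** Closed balls around the apex of the hyperboloid. *)
Lemma hyp_compact c : compact [set p : hyp R | (val p) 0 ord_max <= c].
Proof.
have cK : compact (@hyperboloid R `&` [set x | x 0 ord_max <= c]).
  apply: (subclosed_compact _ (@compact_box c)); last first.
    move=> x [hx /= xc] i; have x1 := hyperboloid_ge1 hx.
    have [+ _] := hx; rewrite minkE => xx.
    have := sqr_ge0 (x 0 0); have := sqr_ge0 (x 0 1); rewrite !expr2 => *.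
    rewrite /= in_itv/=; move: i; apply: ord3P; nra.
  apply: closedI; first exact: closed_hyperboloid.
  apply: (@preimage_closed _ _ (fun x : 'rV[R]_3 =>
    x 0 ord_max) [set y : R | y <= c]).
    by move=> x _; exact: coord_continuous.
  exact: closed_le.
have := compact_set_type closed_hyperboloid cK.
congr compact; rewrite eqEsubset; split=> p /=; first by case.
by move=> h; split=> //; exact: set_valP.
Qed.

Lemma continuous_hyp (T : topologicalType) (f : T -> hyp R) :
  continuous (fun p => val (f p)) -> continuous f.
Proof. by move=> h; apply/continuous_comp_initial. Qed.

Lemma continuous_val : continuous (fun p : hyp R => val p).
Proof. exact: initial_continuous. Qed.

Definition mkhyp x (hx : hyperboloid x) : hyp R := exist _ x (mem_set hx).

Lemma hypP (p : hyp R) : hyperboloid (val p). Proof. exact: set_valP. Qed.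

End Topology.

(** * Cocompact discrete groups of isometries *)
Lemma near_finite (T : eqType) I (F : set_system I) (S : set T)
    (P : T -> I -> Prop) : Filter F -> finite_set S ->
  (forall a, S a -> \forall i \near F, P a i) ->
  \forall i \near F, forall a, S a -> P a i.
Proof.
move=> FF /finite_seqP[s ->]; elim: s => [|b s IH] h.
  by apply: nearW.
have h1 : \forall i \near F, P b i by apply: h; rewrite /= mem_head.
have h2 : \forall i \near F, forall a, [set` s] a -> P a i.
  by apply: IH => a sa; apply: h; rewrite /= in_cons sa orbT.
by near=> i => a /=; rewrite in_cons => /predU1P[->|sa]; [near: i|move: a sa;
  near: i].
Unshelve. all: by end_near. Qed.

Section Base.
Variable R : realType.
Implicit Types (x y z u v w n : 'rV[R]_3) (c M : R).

Definition apex : 'rV[R]_3 := \row_i (i == ord_max)%:R.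

Lemma apexE : (apex 0 0 = 0) * (apex 0 1 = 0) * (apex 0 ord_max = 1).
Proof. by rewrite !mxE. Qed.

Lemma apex_hyp : hyperboloid apex.
Proof. by rewrite /hyperboloid /= minkE !apexE; split; lra. Qed.

(** The vector [2 x_2 x - apex], the image of the apex under the reflection in
    [x], is in the future, so that its product with [y] is nonpositive.  A bound
    on the distance of [x] and [y] thus turns into a bound on heights. *)
Lemma height_mink x y : hyperboloid x -> future y ->
  y 0 ord_max <= 2 * x 0 ord_max * - mink x y.
Proof.
move=> hx fy; have [xx x2] := hx.
have x1 := hyperboloid_ge1 hx.
pose u := (2 * x 0 ord_max) *: x - apex.
have xo z : mink z apex = - z 0 ord_max by rewrite minkE !apexE; ring.
have fu : future u.
  split; first by rewrite /u !minklin xx (minkC apex x) !xo apexE; lra.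
  by rewrite /u !mxE /= -/(x 0 ord_max); nra.
have := future_mink_le0 fu fy.
rewrite /u !minklin (minkC apex) xo; lra.
Qed.

(** Changing the sign of the two spacelike coordinates of [x] gives a future
    vector, whose product with [y] is nonpositive. *)
Lemma mink_height x y : future x -> future y ->
  - mink x y <= 2 * x 0 ord_max * y 0 ord_max.
Proof.
move=> [xx x2] fy.
pose x' : 'rV[R]_3 := \row_i (if i == ord_max then x 0 i else - x 0 i).
have x'E : (x' 0 0 = - x 0 0) * (x' 0 1 = - x 0 1) * (x' 0 ord_max = x 0
  ord_max).
  by rewrite !mxE.
have fx' : future x'.
  by rewrite /future x'E; split=> //; move: xx; rewrite !minkE !x'E; lra.
by have := future_mink_le0 fx' fy; rewrite !minkE !x'E; lra.
Qed.

End Base.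

Section Group.
Variables (R : realType) (G : isometry_group R).
Implicit Types (x y z u v w n : 'rV[R]_3) (A B : 'M[R]_3) (a b c s t : R).

Lemma group_isom A : isometry_set G A -> orientation_preserving_isometry A.
Proof. exact: isometry_setP. Qed.

Lemma cov_eqP (p q : hyp R) : covering_map G p = covering_map G q <->
  exists2 A, isometry_set G A & val q = val p *m A.
Proof.
split=> [h|/asboolP h]; last exact/(@eqmodP _ (orbit_equiv G)).
have /(@eqmodP _ (orbit_equiv G))/asboolP := h.
exact.
Qed.

Lemma cov_continuous : continuous (covering_map G).
Proof. exact: pi_continuous. Qed.

Lemma cov_surj q : exists p, covering_map G p = q.
Proof. by exists (repr q); exact: reprK. Qed.

Definition hyp_act A (iA : orientation_preserving_isometry A) (p : hyp R) : hyp
  R :=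
  mkhyp (isom_hyp iA (hypP p)).

(** The preimage of the image is the union of the translates. *)
Lemma cov_open (U : set (hyp R)) : open U -> open (covering_map G @` U).
Proof.
move=> oU; rewrite /open /= /quotient_open.
have -> : \pi_(surface G)%qT @^-1` (covering_map G @` U) =
    \bigcup_(A in [set A : {A | isometry_set G A} | True])
      (hyp_act (group_isom (isometry_setV (proj2_sig A))) @^-1` U).
  rewrite eqEsubset; split=> p /=.
    move=> [q Uq /cov_eqP[A GA pE]]; exists (exist _ A GA) => //=.
    rewrite (_ : hyp_act _ _ = q)//; apply: val_inj => /=.
    by rewrite pE isom_mulK//; exact: group_isom.
  move=> [[A GA] _ /= Uq]; exists (hyp_act (group_isom (isometry_setV GA)) p)
    => //.
  apply/cov_eqP; exists A => //=; rewrite isom_mulVK//; exact: group_isom.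
apply: bigcup_open => A _; apply: open_comp => // p _; move: p.
apply: continuous_hyp; apply: continuous_mulmx3; exact: continuous_val.
Qed.

(** The form in which proper discontinuity is used. *)
Lemma group_finite_box (c : R) : acts_properly_discontinuously G ->
  finite_set [set A | isometry_set G A /\
  exists x, [/\ hyperboloid x, x 0 ord_max <= c & (x *m A) 0 ord_max <= c]].
Proof.
move=> pd; apply: sub_finite_set (pd _ (@hyp_compact R c)) =>
  A /= [GA [x [hx xc xAc]]].
split=> //; exists (mkhyp hx), (hyp_act (group_isom GA) (mkhyp hx)); split=> //.
Qed.

Lemma group_countable : acts_properly_discontinuously G ->
  countable (isometry_set G).
Proof.
move=> pd; apply: (@sub_countable _ _ _ (\bigcup_(k in [set: nat]) [set A |
  isometry_set G A /\
  exists x, [/\ hyperboloid x, x 0 ord_max <= k%:R & (x *m A) 0 ord_max <=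
    k%:R]])).
  apply: subset_card_le => A GA.
  pose k := (Num.truncn (Num.max 1 ((apex R *m A) 0 ord_max))).+1.
  exists k => //; split=> //; exists (apex R).
  have : Num.max 1 ((apex R *m A) 0 ord_max) <= k%:R by rewrite ltW//
    truncnS_gt.
  rewrite ge_max => /andP[h1 h2].
  by split=> //; [exact: apex_hyp|rewrite apexE].
by apply: bigcup_countable => // k _; apply: finite_set_countable;
  exact: group_finite_box.
Qed.

(** The images of the open balls around the apex increase to the surface. *)
Lemma group_cocompact : compact [set: surface G] ->
  exists2 c, 1 <= c & forall x, hyperboloid x ->
    exists2 A, isometry_set G A & (x *m A) 0 ord_max <= c.
Proof.
move=> /compact_near_coveringP cS.
have := cS nat \oo (fun k q => exists2 p,
  covering_map G p = q & val p 0 ord_max <= k%:R).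
case=> //.
  move=> q _; have [p pq] := cov_surj q.
  pose U := [set p' : hyp R | val p' 0 ord_max < val p 0 ord_max + 1].
  have oU : open U.
    apply: (@open_comp _ _ (fun p : hyp R =>
      val p 0 ord_max) [set y : R | y < val p 0 ord_max + 1]).
      by move=> x _; apply: cvg_coord; exact: continuous_val.
    exact: open_lt.
  pose h := val p 0 ord_max + 1.
  exists (covering_map G @` U, [set k : nat | (Num.truncn h < k)%N]).
    split=> /=; last by exists (Num.truncn h).+1.
    apply: open_nbhs_nbhs; split; first exact: cov_open.
    by exists p => //; rewrite /U /= ltrDl.
  move=> [q' k] /= [[p' Up' <-] kk]; exists p' => //; apply: ltW.
  by apply: lt_le_trans Up' _; apply: ltW;
    apply: lt_le_trans (truncnS_gt _) _; rewrite ler_nat.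
move=> N _ hN; exists (Num.max 1 N%:R); first by rewrite le_max lexx.
move=> x hx; have [p /esym/cov_eqP[A GA pE] pN] :=
  hN N (leqnn N) (covering_map G (mkhyp hx)) I.
by exists A => //; rewrite le_max -pE pN orbT.
Qed.

(** Each nontrivial element moves all points of a fundamental ball by a definite
    amount, since it has no fixed point and the ball is compact; only finitely
    many elements move some point of the ball by a small amount. *)
Lemma group_separated : closed_hyperbolic_surface G ->
  exists2 e, 0 < e & forall x A, hyperboloid x -> isometry_set G A ->
    A <> 1%:M ->
    mink x (x *m A) < - 1 - e.
Proof.
move=> [free pd cS]; have [c c1 cP] := group_cocompact cS.
(* an element that moves a point of height at most c by a distance of
   hyperbolic cosine at most 2 brings it to a height of at most 4 c *)
pose F := [set A | isometry_set G A /\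
  exists x, [/\ hyperboloid x, x 0 ord_max <= 4 * c & (x *m A) 0 ord_max <= 4 *
    c]].
pose K := [set p : hyp R | (val p) 0 ord_max <= c].
have : \forall e \near 0^'+, forall A, F A -> A <> 1%:M ->
  K `<=` [set p | mink (val p) (val p *m A) < - 1 - e].
  apply: near_finite; first exact: group_finite_box.
  move=> A [GA _]; have [->|/eqP A1] := pselect (A = 1%:M); first exact: nearW.
  suff : \forall e \near 0^'+, K `<=` [set p | mink (val p) (val p *m A) < - 1
    - e].
    by apply: filterS => e + _.
  move/compact_near_coveringP: (@hyp_compact R c); apply => p Kp.
  pose f (p : hyp R) := mink (val p) (val p *m A).
  have cf : continuous f.
    apply: continuous_mink; first exact: continuous_val.
    apply: continuous_mulmx3; exact: continuous_val.
  have fp : f p < -1.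
    rewrite lt_neqAle hyperboloid_mink_le ?andbT//; last 2 first.
    - exact: hypP.
    - by apply: isom_hyp (hypP p); exact: group_isom.
    apply/eqP => fp; move/eqP: A1; apply; apply: (free A p) => //.
    by symmetry; apply: hyperboloid_mink_eq (hypP p) _ fp;
      apply: isom_hyp (hypP p); exact: group_isom.
  pose d := (- 1 - f p) / 2.
  exists (f @^-1` [set y | y < -1 - d], [set e | e < d]).
    split=> /=; last by apply: nbhs_right_lt; rewrite /d; lra.
    apply: cf; apply: (@open_nbhs_nbhs R (f p) [set y | y < -1 - d]); split;
      first exact: open_lt.
    by rewrite /d /=; lra.
  by move=> [q e] /= []; rewrite /f; lra.
move=> h; near ((0:R)^'+) => e.
exists e => //; move=> x A hx GA A1.
rewrite ltNge; apply/negP => xA.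
have {}e1 : e < 1 by near: e; exact: nbhs_right_lt.
have [B GB xB] := cP _ hx.
have iB := group_isom GB; have iA := group_isom GA.
pose A' := invmx B *m A *m B.
have hxB := isom_hyp iB hx.
have xBA : x *m B *m A' = x *m A *m B by rewrite /A' !mulmxA isom_mulK.
have mE : mink (x *m B) (x *m B *m A') = mink x (x *m A) by rewrite xBA
  isom_mink.
have GA' : isometry_set G A' by do ?apply: isometry_setM => //;
  exact: isometry_setV.
have A'1 : A' <> 1%:M.
  move=> A'1; apply: A1; apply: (free A (mkhyp hx)) => //=.
  by rewrite -(isom_mulK iB (x *m A)) -xBA A'1 mulmx1 isom_mulK.
have FA' : F A'.
  split=> //; exists (x *m B); split=> //; first by lra.
  have := height_mink hxB (hyperboloid_future (isom_hyp (group_isom GA') hxB)).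
  by have := hyperboloid_ge1 hxB; rewrite mE => *; nra.
have : forall A, F A -> A <> 1%:M -> K `<=` [set p | mink (val p) (val p *m A)
  < - 1 - e].
  by near: e.
move=> /(_ _ FA' A'1 (mkhyp hxB)) => /(_ xB) /=.
by rewrite mE ltNge xA.
Unshelve. all: by end_near. Qed.

(** Suppose that the whole group fixes the ideal point [xi], so that each
    element [B] multiplies [xi] by some factor [k]. Infinitely many elements
    have their factor in a fixed interval: they are needed to bring the points
    [p] of a horocycle at [xi] into a compact ball. Now, near [xi], an element
    of factor [k] moves points by about [|ln k|]. So arbitrarily many elements
    move the same point [y] by a bounded amount; their conjugates by the element
    that brings [y] into the ball contradict proper discontinuity. *)
Lemma no_fixed_null_line (xi : 'rV[R]_3) : closed_hyperbolic_surface G ->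
  future xi -> mink xi xi = 0 ->
  exists2 A, isometry_set G A & forall k, xi *m A <> k *: xi.
Proof.
move=> [free pd cS] fxi xixi; have [c c1 cP] := group_cocompact cS.
apply: contrapT => nex.
have fixed A : isometry_set G A -> exists2 k, 0 < k & xi *m A = k *: xi.
  move=> GA; apply: contrapT => nk; apply: nex; exists A => // k kE;
    apply: nk; exists k => //.
  have [_] := isom_future (group_isom GA) fxi; rewrite kE mxE.
  by have [_ x2] := fxi; rewrite pmulr_lgt0.
have [_ m0] := fxi; set m := xi 0 ord_max in m0 *.
have oxi : mink (apex R) xi = - m by rewrite minkE !apexE /m; ring.
have oo : mink (apex R) (apex R) = -1 by have [] := apex_hyp R.
pose S := [set B | isometry_set G B /\ exists k, [/\ k <= 2 * c,
  k^-1 <= 2 * c & xi *m B = k *: xi]].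
have infS : infinite_set S.
  move=> finS.
  have : \forall M \near +oo, forall B, S B -> forall x, hyperboloid x ->
    x 0 ord_max <= c -> (x *m B) 0 ord_max <= M.
    apply: near_finite => // B [GB _].
    near=> M => x hx xc; apply: le_trans (_ : 2 * c * (2 * (apex R *m B) 0
      ord_max) <= M); last first.
      by near: M; apply: nbhs_pinfty_ge; exact: num_real.
    have iB := group_isom GB.
    have h1 := height_mink (isom_hyp iB (apex_hyp R)) (hyperboloid_future
      (isom_hyp iB hx)).
    apply: le_trans h1 _; rewrite isom_mink// (minkE (apex R)) !apexE.
    have := hyperboloid_ge1 (isom_hyp iB (apex_hyp R)); nra.
  move=> [M [_ hM]].
  have := hM (`|M| + 1); rewrite (le_lt_trans (ler_norm M)) ?ltrDl// =>
    /(_ isT) {}hM.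
  pose s := Num.max 2 (`|M| + 1).
  pose e : 'rV[R]_3 := m^-1 *: \row_i (if i == 0 then - xi 0 1 else if i == 1
    then xi 0 0 else 0).
  (* the point at abscissa s of the horocycle at xi through the apex *)
  pose p := apex R + s *: e + (s ^+ 2 / (2 * m)) *: xi.
  have eE : (e 0 0 = - (xi 0 1 / m)) * (e 0 1 = xi 0 0 / m) * (e 0 ord_max = 0).
    by rewrite !mxE /=; split; [split|]; field; rewrite gt_eqF.
  clearbody e.
  have ee : mink e e = 1.
    rewrite minkE !eE; move: xixi; rewrite minkE -/m => h.
    transitivity ((xi 0 0 * xi 0 0 + xi 0 1 * xi 0 1) / (m * m));
      first by field; rewrite gt_eqF.
    by rewrite (_ : _ + _ = m * m) ?divff ?mulf_neq0 ?gt_eqF//; lra.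
  have eo : mink (apex R) e = 0 by rewrite minkE !eE !apexE; ring.
  have ex : mink e xi = 0 by rewrite minkE !eE; field; rewrite gt_eqF.
  have p2 : p 0 ord_max = 1 + s ^+ 2 / 2.
    by rewrite mxE mxE apexE mxE eE mxE -/m; field; rewrite gt_eqF.
  have hp : hyperboloid p.
    split; last by rewrite p2; have := sqr_ge0 s; lra.
    rewrite /p !minklin oo ee xixi (minkC e (apex R)) (minkC xi e) (minkC xi
      (apex R)) eo ex oxi.
    by field; rewrite gt_eqF.
  have pxi : mink p xi = - m.
    rewrite /p !minklin oxi ex xixi; ring.
  have [A GA pA] := cP _ hp.
  have iA := group_isom GA.
  have GV := isometry_setV GA.
  have [k k0 kE] := fixed _ GV.
  have pAxi : mink (p *m A) xi = - (k * m) by rewrite isom_adj// kE minkZr pxi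
    mulrN.
  have hpA := isom_hyp iA hp.
  have pA1 := hyperboloid_ge1 hpA.
  have SV : S (invmx A).
    split=> //; exists k; split=> //.
      have := mink_height (hyperboloid_future hpA) fxi.
      rewrite pAxi -/m opprK => h.
      rewrite -(ler_pM2r m0); nra.
    have := height_mink hpA fxi; rewrite pAxi opprK -/m => h.
    rewrite -(ler_pM2r k0) mulVf ?gt_eqF// -(ler_pM2r m0) mul1r.
    have km : 0 < k * m by rewrite mulr_gt0.
    nra.
  have := hM _ SV _ hpA pA; rewrite isom_mulK// p2.
  have s2 : 2 <= s by rewrite /s le_max lexx.
  have sM : `|M| + 1 <= s by rewrite /s le_max lexx orbT.
  by rewrite leNgt => /negP; apply; rewrite expr2; nra.
pose M := 2 * c + 1.
pose F := [set D | isometry_set G D /\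
  exists x, [/\ hyperboloid x, x 0 ord_max <= 2 * c * M & (x *m D) 0 ord_max <=
    2 * c * M]].
have [F' FE] := (finite_fsetP.1 (group_finite_box (2 * c * M) pd)).
have [S' S'S cardS'] := infinite_set_fset (#|` F'|).+1 infS.
have : \forall a \near 0^'+, forall B, [set` S'] B ->
  a ^+ 2 * - mink (apex R) (apex R *m B) <= 1.
  apply: near_finite => [|B _]; first exact: finite_fset.
  set D := - mink _ _.
  near=> a; have a0 : 0 < a by [].
  have a1 : a < (1 + `|D|)^-1 by near: a; apply: nbhs_right_lt;
    rewrite invr_gt0 ltr_wpDr.
  have D0 : 0 < 1 + `|D| by rewrite ltr_wpDr.
  have aD : a * (1 + `|D|) < 1 by rewrite -ltr_pdivlMr ?div1r.
  have := ler_norm D; have := normr_ge0 D; rewrite expr2; nra.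
move=> hS'; near ((0:R)^'+) => a.
have a0 : 0 < a by [].
have a1 : a < 1 by near: a; exact: nbhs_right_lt.
have aS' : forall B, [set` S'] B -> a ^+ 2 * - mink (apex R) (apex R *m B) <= 1
  by near: a.
pose b := (1 - a ^+ 2) / (2 * a * m).
have abm : a * b * m = (1 - a ^+ 2) / 2 by rewrite /b; field; rewrite !gt_eqF.
have b0 : 0 < b by rewrite divr_gt0 ?mulr_gt0// expr2; nra.
(* a point on the geodesic ray from the apex to xi, close to xi for small a *)
pose y := a *: apex R + b *: xi.
have hy : hyperboloid y.
  split; last by rewrite mxE mxE apexE mxE -/m mulr1 addr_gt0// mulr_gt0.
  rewrite /y !minklin oo (minkC xi) oxi xixi.
  transitivity (- a ^+ 2 - 2 * (a * b * m)); first by ring.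
  by rewrite abm; field.
have [A GA yA] := cP _ hy.
have iA := group_isom GA; have GV := isometry_setV GA.
have hyA := isom_hyp iA hy.
pose f B := invmx A *m B *m A.
have fF B : B \in S' -> f B \in F'.
  move=> BS'; have [GB [k [k1 k2 kE]]] := S'S _ BS'.
  have iB := group_isom GB.
  have k0 : 0 < k.
    have [_] := isom_future iB fxi; rewrite kE mxE -/m.
    by rewrite pmulr_lgt0.
  suff : F (f B) by rewrite /F FE.
  split; first by do ?apply: isometry_setM.
  have yAf : y *m A *m f B = y *m B *m A by rewrite /f !mulmxA isom_mulK.
  have hyB := isom_hyp iA (isom_hyp iB hy).
  have yAB : - mink (y *m A) (y *m A *m f B) <= M.
    rewrite yAf isom_mink// /y mulmxDl -!scalemxAl kE !minklin.
    have -> : mink xi (apex R *m B) = - (k^-1 * m).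
      have xiB : xi = k^-1 *: (xi *m B) by rewrite kE scalerA mulVf ?scale1r
        ?gt_eqF.
      by rewrite {1}xiB minkZl isom_mink// (minkC xi) oxi mulrN.
    rewrite oxi xixi.
    have h1 := aS' _ BS'.
    set D := mink (apex R) (apex R *m B) in h1 *.
    apply: (@le_trans _ _ (a ^+ 2 * - D + (a * b * m) * (k + k^-1))).
      by rewrite le_eqVlt; apply/orP; left; apply/eqP; ring.
    rewrite abm /M.
    have := sqr_ge0 a; rewrite !expr2 in h1 *.
    have : 0 < k^-1 by rewrite invr_gt0.
    nra.
  have M1 : 1 <= M by rewrite /M; lra.
  exists (y *m A); split=> //.
    by nra.
  rewrite yAf in yAB *.
  have := height_mink hyA (hyperboloid_future hyB).
  have := hyperboloid_ge1 hyA.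
  have := hyperboloid_mink_le hyA hyB.
  move=> h1 h2 h3; apply: le_trans h3 _.
  by nra.
have : (#|` [fset f B | B in S']%fset| <= #|` F'|)%N.
  apply: fsubset_leq_card; apply/fsubsetP => _ /imfsetP[B /= BS' ->]; exact: fF.
rewrite card_in_imfset /=; last first.
  move=> B C _ _ /(congr1 (fun D => A *m D *m invmx A)).
  by rewrite /f !mulmxA !(mulmxV (isom_unit iA)) !mul1mx !mulmxK ?(isom_unit
    iA).
by move=> h; have := leq_trans cardS' h; rewrite ltnn.
Unshelve. all: by end_near. Qed.

End Group.

(** * Geodesics from an ideal point that cross a translate *)
Section Crossing.
Variable R : realType.
Implicit Types (x y z u v w n e xi : 'rV[R]_3) (A B h : 'M[R]_3) (a b c s t :
  R).

Lemma continuous_trip (T : topologicalType) (f g k : T -> 'rV[R]_3) :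
  continuous f -> continuous g -> continuous k ->
  continuous (fun p => trip (f p) (g p) (k p)).
Proof.
move=> cf cg ck; rewrite /trip.
by apply: contD; [apply: contB|]; (apply: contM; [|apply: contB; apply: contM]);
  exact: cvg_coord.
Qed.

Lemma continuous_lin (T : topologicalType) (f g : T -> 'rV[R]_3) (a b : T ->
  R) :
  continuous f -> continuous g -> continuous a -> continuous b ->
  continuous (fun p => a p *: f p + b p *: g p).
Proof.
move=> cf cg ca cb; apply: coord_cvg => i.
rewrite (_ : (fun p => _) = fun p => a p * f p 0 i + b p * g p 0 i); last first.
  by apply/funext => p; rewrite !mxE.
by apply: contD; apply: contM => //; exact: cvg_coord.
Qed.

Definition tangent_frame x v e := [/\ utangent x v,
  utangent x e & mink v e = 0].

Lemma frame_trip x v e : hyperboloid x -> tangent_frame x v e ->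
  trip x v e ^+ 2 = 1.
Proof.
move=> [xx _] [[xv vv] [xe ee] ve].
have := trip_gram x v e; rewrite xx vv ee xv xe ve => h.
by apply: oppr_inj; rewrite -h; ring.
Qed.

(** The difference of the two sides is orthogonal to a basis. *)
Lemma frame_expand x v e u : hyperboloid x -> tangent_frame x v e ->
  u = - mink u x *: x + mink u v *: v + mink u e *: e.
Proof.
move=> hx fr; have t2 := frame_trip hx fr; have [xx _] := hx.
have [[xv vv] [xe ee] ve] := fr.
apply/eqP; rewrite -subr_eq0; apply/eqP; set d := u - _.
have dx : mink x d = 0.
  by rewrite /d !minklin xx xv xe (minkC u x); ring.
have dv : mink v d = 0.
  by rewrite /d !minklin vv ve (minkC v x) xv (minkC u v); ring.
have de : mink e d = 0.
  by rewrite /d !minklin ee (minkC e v) ve (minkC e x) xe (minkC u e); ring.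
have t0 : trip x v e != 0 by rewrite -sqrf_eq0 t2 oner_eq0.
clearbody d.
apply: (@timelike_orth_eq0 _ x) => //; first by rewrite xx ltrN10.
apply: (mulfI t0); rewrite mulr0 -minkZl cramer3 !minklin dx dv de; ring.
Qed.

(** A parametrization by the line of the ideal points other than [x - v], the
    backward endpoint of the geodesic of direction [v]; its forward endpoint is
    the point of parameter [0].  This is the fan of geodesics that rays from a
    far origin look like. *)
Definition cone_pt x v e tau := (x + v) + (2 * tau) *: e + tau ^+ 2 *: (x - v).

Lemma cone_pt_param x v e y : hyperboloid x -> tangent_frame x v e ->
  mink y y = 0 -> mink y (x - v) < 0 ->
  exists al tau, 0 < al /\ y = al *: cone_pt x v e tau.
Proof.
move=> hx fr yy yxi; have yE := frame_expand y hx fr.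
have [xx _] := hx; have [[xv vv] [xe ee] ve] := fr.
set p := mink y x in yE; set q := mink y v in yE; set s := mink y e in yE.
have pq : p - q < 0 by move: yxi; rewrite !minklin.
have ss : s ^+ 2 = (p - q) * (p + q).
  have : mink y y = - p ^+ 2 + q ^+ 2 + s ^+ 2.
    by rewrite {1}yE !minklin -/p -/q -/s (minkC x) (minkC v) (minkC e) -/p -/q
      -/s; ring.
  rewrite yy => h; rewrite -[LHS]subr0 h; ring.
have pq0 : q - p != 0 by rewrite gt_eqF//; lra.
exists ((q - p) / 2), (s / (q - p)); split; first by lra.
have e1 : (q - p) / 2 * (2 * (s / (q - p))) = s by field.
have e2 : (q - p) / 2 * (s / (q - p)) ^+ 2 = - (p + q) / 2.
  transitivity (s ^+ 2 / (2 * (q - p))); first by field.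
  by rewrite ss; field.
rewrite {1}yE /cone_pt !scalerDr !scalerA e1 e2.
by apply: rV3P; rewrite !mxE; field.
Qed.

Lemma isom_invmx A : orientation_preserving_isometry A ->
  orientation_preserving_isometry (invmx A).
Proof.
move=> iA; have mA x y : mink (x *m invmx A) (y *m invmx A) = mink x y.
  by rewrite -(isom_mink iA) !isom_mulVK.
split=> //; last by rewrite det_inv; have [_ _ ->] := iA; rewrite invr1.
move=> x hx; have [xx _] := hx; split; first by rewrite mA.
suff [] : future (x *m invmx A) by [].
apply: (future_mink (apex_hyp R)); first by rewrite mA xx.
rewrite -(isom_mink iA) isom_mulVK//.
apply: future_mink_lt0; last exact: hyperboloid_future.
exact: isom_hyp (apex_hyp R).
Qed.

(** The two hypotheses of the crossing criterion, as functions of the origin and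
    of the ideal end.  They are homogeneous polynomials, so that they make sense
    for an ideal origin as well and define open conditions. *)
Definition crosses1 h z w := trip (z *m invmx h) z w * trip (w *m invmx h) z w.
Definition crosses2 h z w := trip (z *m h) z w * trip (w *m h) z w.

(** Three distinct ideal points are linearly independent. *)
Lemma null_trip_neq0 x y z : mink x x = 0 -> mink y y = 0 -> mink z z = 0 ->
  mink x y < 0 -> mink y z < 0 -> mink x z < 0 -> trip x y z != 0.
Proof.
move=> xx yy zz xy yz xz; have := trip_gram x y z; rewrite xx yy zz => h.
apply/eqP => t0; move: h; rewrite t0.
have h1 : 0 < mink x y * mink y z by rewrite nmulr_rgt0.
have h2 : mink x y * mink y z * mink x z < 0 by rewrite pmulr_rlt0.
by rewrite expr2; lra.
Qed.

(** In the half-plane model with [x - v] at infinity, [h] is a homography with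
    pole [h^-1 infinity]. Near the pole, on the side of it given by the position
    of [h infinity], an ideal point [w] is sent far away to the other side of
    [w] than [h infinity], so that the vertical line at [w] crosses its image.

    The proof reads this off determinants. At the pole [w0] one factor of each
    of the two products vanishes, and on moving by [s] along the circle at
    infinity both products get the sign of [s * D * E], where [D] and [E] do not
    vanish. *)
Lemma crossing_parameter x v e h : hyperboloid x -> tangent_frame x v e ->
  orientation_preserving_isometry h ->
  (forall y, hyperboloid y -> y *m h <> y) ->
  (forall k, (x - v) *m h <> k *: (x - v)) ->
  exists tau, crosses1 h (x - v) (cone_pt x v e tau) < 0 /\
              crosses2 h (x - v) (cone_pt x v e tau) < 0.
Proof.
move=> hx fr ih free nfix; set xi := x - v.
have [xx _] := hx; have [[xv vv] [xe ee] ve] := fr.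
have fxi : future xi by exact: (utangent_future hx (conj xv vv)).2.
have xixi : mink xi xi = 0 by rewrite /xi !minklin xx vv (minkC v x) xv; ring.
have fxh := isom_future ih fxi.
have xh0 : mink (xi *m h) xi < 0.
  rewrite lt_neqAle future_mink_le0// andbT; apply/eqP => h0.
  by have [_ /nfix] := future_mink_eq0 fxh fxi h0.
have xhxh : mink (xi *m h) (xi *m h) = 0 by rewrite isom_mink.
set y0 := xi *m invmx h.
have y0h : y0 *m h = xi by rewrite /y0 isom_mulVK.
have y0y0 : mink y0 y0 = 0 by rewrite -(isom_mink ih) y0h.
have y0xi : mink y0 xi < 0 by rewrite -(isom_mink ih) y0h minkC.
have fy0 : future y0 by apply: isom_future => //; exact: isom_invmx.
(* h would otherwise exchange two ideal points, and fix a point between them *)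
have y0xh : mink y0 (xi *m h) < 0.
  change (forall k, xi *m h <> k *: xi) in nfix; clearbody xi.
  rewrite lt_neqAle future_mink_le0// andbT; apply/eqP => h0.
  have [_] := future_mink_eq0 fxh fy0 (etrans (minkC _ _) h0).
  set k := _ / _ => kE.
  have k0 : 0 < k by rewrite divr_gt0//; [case: fxh|case: fy0].
  have xhh : xi *m h *m h = k *: xi by rewrite kE -scalemxAl y0h.
  pose a := Num.sqrt k.
  have aa : a * a = k by rewrite -expr2 sqr_sqrtr// ltW.
  have a0 : 0 < a by rewrite sqrtr_gt0.
  pose p := a *: xi + xi *m h.
  have ph : p *m h = a *: p.
    by rewrite /p mulmxDl -scalemxAl xhh [RHS]scalerDr scalerA aa addrC.
  have pp : mink p p < 0.
    rewrite /p !minklin xixi xhxh (minkC xi); nra.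
  pose m := Num.sqrt (- mink p p).
  have mm : m * m = - mink p p by rewrite -expr2 sqr_sqrtr// oppr_ge0 ltW.
  have m0 : 0 < m by rewrite sqrtr_gt0 oppr_gt0.
  have hp : hyperboloid (m^-1 *: p).
    split.
      rewrite minkZl minkZr -[mink p p]opprK -mm; by field; rewrite gt_eqF.
    rewrite mxE mulr_gt0 ?invr_gt0//.
    rewrite /p !mxE -/(xi 0 ord_max) addr_gt0 ?mulr_gt0//; first by case: fxi.
    by case: fxh; rewrite mxE.
  apply: (free _ hp); apply: (@hyperboloid_scale _ _ _ 1 a) => //.
    exact: isom_hyp.
  by rewrite scale1r -scalemxAl ph !scalerA mulrC.
have [al [tau [al0 y0E]]] := cone_pt_param hx fr y0y0 y0xi.
set w0 := cone_pt x v e tau in y0E.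
pose e' := e + tau *: xi.
pose W s := w0 + (2 * s) *: e' + s ^+ 2 *: xi.
have WE s : cone_pt x v e (tau + s) = W s.
  by rewrite /W /w0 /cone_pt /e' /xi; apply: rV3P; rewrite !mxE; ring.
have w0E : w0 = al^-1 *: y0 by rewrite y0E scalerA mulVf ?scale1r// gt_eqF.
have w0h : w0 *m h = al^-1 *: xi by rewrite w0E -scalemxAl y0h.
have iy0 : xi *m invmx h = al *: w0 by [].
have w0e' : mink w0 e' = 0.
  rewrite /w0 /cone_pt /e' /xi !minklin xx vv ee xv xe ve.
  by rewrite (minkC v x) (minkC e x) (minkC e v) xv xe ve; ring.
pose D := trip w0 xi e'.
have D0 : D != 0.
  have -> : D = - (2 * trip x v e).
    by rewrite /D /w0 /cone_pt /e' /xi /trip !mxE; ring.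
  rewrite oppr_eq0 mulf_neq0 ?pnatr_eq0//.
  by rewrite -sqrf_eq0 (frame_trip hx fr) oner_eq0.
clearbody w0.
have w0xi : mink w0 xi < 0.
  by rewrite w0E minkZl pmulr_rlt0 ?invr_gt0.
have w0w0 : mink w0 w0 = 0 by rewrite w0E !minklin y0y0; ring.
pose E := trip w0 (xi *m h) xi.
have E0 : E != 0.
  apply: null_trip_neq0 => //; rewrite w0E minkZl pmulr_rlt0 ?invr_gt0//.
clearbody e'.
(* the factors of the two products that do not vanish at s = 0 *)
pose g1 s := trip (W s) (xi *m h) (W s *m h).
pose g2 s := trip (xi *m h) xi (W s).
pose g3 s := 2 * trip (e' *m h) xi (W s) + s * trip (xi *m h) xi (W s).
have c1E s : crosses1 h xi (W s) = 2 * al * s * D * g1 s.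
  rewrite /crosses1 -(isom_trip ih (W s *m _)) isom_mulVK// iy0 -/(g1 s);
    congr (_ * _).
  rewrite /W tripZ1 !tripD3 !tripZ3 trip121 trip122 /D; ring.
have c2E s : crosses2 h xi (W s) = g2 s * (s * g3 s).
  rewrite /crosses2 -/(g2 s); congr (_ * _).
  rewrite {1}/W !mulmxDl -!scalemxAl w0h !tripD1 !tripZ1 trip112 /g3; ring.
have cW : continuous W.
  have cid : continuous (fun s : R => s) by move=> ?; exact: cvg_id.
  rewrite (_ : W = fun s => 1 *: (1 *: w0 + (2 * s) *: e') + s ^+ 2 *: xi);
    last first.
    by apply/funext => s; rewrite !scale1r.
  apply: continuous_lin; [|exact: cst_continuous|exact: cst_continuous|].
    apply: continuous_lin; [exact: cst_continuous|exact: cst_continuous|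
      exact: cst_continuous|].
    by apply: contM => //; exact: cst_continuous.
  by apply: contM.
have g10 : g1 0 = al^-1 * E.
  rewrite /g1 /W mulr0 scale0r expr0n /= scale0r !addr0 w0h tripZ3 //.
have g20 : g2 0 = E.
  rewrite /g2 /W mulr0 scale0r expr0n /= scale0r !addr0 /E.
  by rewrite [RHS]trip_rot.
(* e' and w0 span the tangent plane of the light cone along w0 *)
have [rho [rho0 g30]] : exists rho, 0 < rho /\ g3 0 = rho * D.
  pose y := w0 *m invmx h.
  have w0y : mink y w0 < 0.
    rewrite /y w0E -(isom_mink ih) -!scalemxAl isom_mulVK// y0h.
    by rewrite minkZl minkZr !pmulr_rlt0 ?invr_gt0.
  exists (2 * al * (mink y w0 / mink w0 xi)); split.
    by apply: mulr_gt0; [rewrite mulr_gt0|rewrite nmulr_rgt0 ?invr_lt0].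
  have h1 : D * mink y w0 = trip e' w0 y * mink w0 xi.
    have := congr1 (mink w0) (cramer3 w0 e' xi y).
    rewrite !minklin w0w0 w0e' (minkC y w0) => h2.
    rewrite [trip e' _ _]trip_swap.
    have -> : D = - trip w0 e' xi by rewrite /D /trip; ring.
    by rewrite mulNr h2; ring.
  rewrite /g3 mul0r addr0 /W mulr0 scale0r expr0n /= scale0r !addr0.
  have -> : trip (e' *m h) xi w0 = al * trip e' w0 y.
    have -> : trip e' w0 y = trip (e' *m h) (w0 *m h) w0.
      by rewrite -(isom_trip ih) /y isom_mulVK.
    by rewrite w0h tripZ2 mulrA divff ?mul1r// gt_eqF.
  have -> : trip e' w0 y = D * mink y w0 / mink w0 xi.
    by rewrite h1 mulfK// lt_eqF.
  ring.
have cWh : continuous (fun s => W s *m h) by exact: continuous_mulmx3.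
have cxh : continuous (fun _ : R => xi *m h) by exact: cst_continuous.
have cxi : continuous (fun _ : R => xi) by exact: cst_continuous.
have ceh : continuous (fun _ : R => e' *m h) by exact: cst_continuous.
have c2r : continuous (fun _ : R => 2 : R) by exact: cst_continuous.
have cid : continuous (fun s : R => s) by move=> ?; exact: cvg_id.
have cg1 : continuous g1 by exact: (continuous_trip cW cxh cWh).
have cg2 : continuous g2 by exact: (continuous_trip cxh cxi cW).
have cg3 : continuous g3.
  exact: (contD (contM c2r (continuous_trip ceh cxi cW)) (contM cid cg2)).
have pos (g : R -> R) c : continuous g -> 0 < g 0 * c ->
  \forall s \near (0:R), 0 < g s * c.
  move=> cg g0.
  have cgc : continuous (fun s => g s * c) by apply: contM => //;
    exact: cont_cst.
  exact: (cgc 0 [set y | 0 < y] (open_nbhs_nbhs (conj (@open_gt _ 0) g0))).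
have E2 : 0 < E * E by rewrite -expr2 exprn_even_gt0.
have D2 : 0 < D * D by rewrite -expr2 exprn_even_gt0.
have n1 : \forall s \near (0:R), 0 < g1 s * E.
  by apply: pos => //; rewrite g10 -mulrA mulr_gt0// invr_gt0.
have n2 : \forall s \near (0:R), 0 < g2 s * E by apply: pos => //; rewrite g20.
have n3 : \forall s \near (0:R), 0 < g3 s * D.
  by apply: pos => //; rewrite g30 -mulrA mulr_gt0.
have [r /= r0 hr] : \forall s \near (0:R),
  0 < g1 s * E /\ (0 < g2 s * E /\ 0 < g3 s * D).
  by near=> s; do 2?split; near: s.
(* the sign of s selects the side on which both products are negative *)
pose s := - Num.sg (D * E) * (r / 2).
have DE0 : D * E != 0 by rewrite mulf_neq0.
have [h1 [h2 h3]] : 0 < g1 s * E /\ (0 < g2 s * E /\ 0 < g3 s * D).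
  apply: hr; rewrite /ball /= sub0r normrN normrM normrN normr_sg DE0 mul1r.
  by rewrite ger0_norm; lra.
have sDE : s * (D * E) < 0.
  rewrite /s mulNr mulNr oppr_lt0 -mulrA (mulrC (r / 2)) mulrA -normrEsg.
  by rewrite mulr_gt0 ?normr_gt0//; lra.
exists (tau + s); rewrite WE c1E c2E.
split.
  suff : 2 * al * s * D * g1 s * (E * E) < 0 by rewrite pmulr_llt0.
  have -> : 2 * al * s * D * g1 s * (E * E) = (2 * al) * ((s * (D * E)) * (g1 s
    * E)) by ring.
  by rewrite pmulr_rlt0 ?mulr_gt0// nmulr_rlt0.
suff : g2 s * (s * g3 s) * (E * E) * (D * D) < 0 by rewrite pmulr_llt0//
  pmulr_llt0.
have -> : g2 s * (s * g3 s) * (E * E) * (D * D) = (g2 s * E) * ((s * (D * E)) *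
  (g3 s * D)) by ring.
by rewrite pmulr_rlt0 // nmulr_rlt0.
Unshelve. all: by end_near. Qed.

End Crossing.

(** * Rays seen from a far point *)
Section Tips.
Variable R : realType.
Implicit Types (x y z u v w n e xi : 'rV[R]_3) (A B h : 'M[R]_3) (a b c s t :
  R).

(** Up to a factor, the origin of a ray seen from its point at the time [T],
    with [ep = exp (- 2 T)]; it tends to the ideal point [x - v]. *)
Definition near_xi x v ep := (1 + ep) *: x - (1 - ep) *: v.
(** Up to a factor, the ideal end of the ray whose direction makes the angle
    [2 d] with the axis of the frame, seen from the same point, with
    [c = cos d] and [a = exp T * sin d].  For a fixed [a] and [c = 1], this is
    [cone_pt x v e a]. *)
Definition near_cone x v e a c :=
  c ^+ 2 *: (x + v) + a ^+ 2 *: (x - v) + (2 * (a * c)) *: e.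

Lemma crossing_stable x v e tau h :
  crosses1 h (x - v) (cone_pt x v e tau) < 0 ->
  crosses2 h (x - v) (cone_pt x v e tau) < 0 ->
  exists2 r : R, 0 < r & forall x' v' e' (ep a c : R),
    ball x r x' -> ball v r v' -> ball e r e' ->
    ball (0 : R) r ep -> ball tau r a -> ball (1 : R) r c ->
    crosses1 h (near_xi x' v' ep) (near_cone x' v' e' a c) < 0 /\
    crosses2 h (near_xi x' v' ep) (near_cone x' v' e' a c) < 0.
Proof.
move=> h1 h2.
pose T : topologicalType := ('rV[R]_3 * 'rV[R]_3 * 'rV[R]_3 * (R * R * R))%type.
pose px (p : T) := p.1.1.1. pose pv (p : T) := p.1.1.2. pose pe (p : T) :=
  p.1.2.
pose pep (p : T) : R := p.2.1.1. pose pa (p : T) : R := p.2.1.2.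
  pose pc (p : T) : R := p.2.2.
have c1 (U V : topologicalType) : continuous (fst : U * V -> U) by move=> ?;
  exact: cvg_fst.
have c2 (U V : topologicalType) : continuous (snd : U * V -> V) by move=> ?;
  exact: cvg_snd.
have cpx : continuous px by do 2!(apply: (cont_comp _ (c1 _ _))); exact: c1.
have cpv : continuous pv by apply: (cont_comp _ (c2 _ _));
  apply: (cont_comp _ (c1 _ _)); exact: c1.
have cpe : continuous pe by apply: (cont_comp _ (c2 _ _)); exact: c1.
have cpep : continuous pep by do 2!(apply: (cont_comp _ (c1 _ _))); exact: c2.
have cpa : continuous pa by apply: (cont_comp _ (c2 _ _));
  apply: (cont_comp _ (c1 _ _)); exact: c2.
have cpc : continuous pc by apply: (cont_comp _ (c2 _ _)); exact: c2.
pose Z p := near_xi (px p) (pv p) (pep p).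
pose W p := near_cone (px p) (pv p) (pe p) (pa p) (pc p).
have k1 : continuous (fun _ : T => 1 : R) by exact: cst_continuous.
have cZ : continuous Z.
  rewrite (_ : Z = fun p => (1 + pep p) *: px p + (- (1 - pep p)) *: pv p);
    last first.
    by apply/funext => p; rewrite /Z /near_xi scaleNr.
  exact: (continuous_lin cpx cpv (contD k1 cpep) (contN (contB k1 cpep))).
have cW : continuous W.
  rewrite (_ : W = fun p => 1 *: (pc p * pc p *: (1 *: px p + 1 *: pv p)
     + pa p * pa p *: (1 *: px p + (-1) *: pv p)) + (2 * (pa p * pc p)) *: pe
       p); last first.
    by apply/funext => p; rewrite /W /near_cone !scale1r scaleN1r -!expr2.
  have kN : continuous (fun _ : T => - 1 : R) by exact: cst_continuous.
  have k2 : continuous (fun _ : T => 2 : R) by exact: cst_continuous.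
  have cp := continuous_lin cpx cpv k1 k1; have cm :=
    continuous_lin cpx cpv k1 kN.
  have cpm := continuous_lin cp cm (contM cpc cpc) (contM cpa cpa).
  exact: (continuous_lin cpm cpe k1 (contM k2 (contM cpa cpc))).
have cZh A : continuous (fun p => Z p *m A) by exact: continuous_mulmx3.
have cWh A : continuous (fun p => W p *m A) by exact: continuous_mulmx3.
have cC A : continuous (fun p => trip (Z p *m A) (Z p) (W p) * trip (W p *m A)
  (Z p) (W p)).
  exact: (contM (continuous_trip (cZh A) cZ cW) (continuous_trip (cWh A) cZ
    cW)).
have cC1 : continuous (fun p => crosses1 h (Z p) (W p)) by exact: (cC (invmx
  h)).
have cC2 : continuous (fun p => crosses2 h (Z p) (W p)) by exact: (cC h).
pose p0 : T := (x, v, e, (0, tau, 1)).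
have Z0 : Z p0 = x - v by rewrite /Z /near_xi /= addr0 subr0 !scale1r.
have W0 : W p0 = cone_pt x v e tau.
  rewrite /W /near_cone /cone_pt /pa /pc /=; apply: rV3P; rewrite !mxE; ring.
have n1 : \forall p \near p0, crosses1 h (Z p) (W p) < 0.
  rewrite -Z0 -W0 in h1.
  exact: (cC1 p0 [set y | y < 0] (open_nbhs_nbhs (conj (@open_lt _ 0) h1))).
have n2 : \forall p \near p0, crosses2 h (Z p) (W p) < 0.
  rewrite -Z0 -W0 in h2.
  exact: (cC2 p0 [set y | y < 0] (open_nbhs_nbhs (conj (@open_lt _ 0) h2))).
have /nbhs_ballP[r /= r0 hr] : \forall p \near (p0 : ('rV[R]_3 * 'rV[R]_3 *
  'rV[R]_3 * (R * R * R))%type),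
    crosses1 h (Z p) (W p) < 0 /\ crosses2 h (Z p) (W p) < 0.
  by near=> p; split; near: p.
exists r => // x' v' e' ep a c bx bv be bep ba bc.
apply: (hr (x', v', e', (ep, a, c))); split; [split; [split|]|split;
  [split|]]; assumption.
Unshelve. all: by end_near. Qed.

Lemma direction_utangent z v e d : tangent_frame z v e ->
  utangent z (direction v e d).
Proof.
move=> [[zv vv] [ze ee] ve]; split; rewrite /direction !minklin ?zv ?ze ?vv ?ee
  ?(minkC e v) ?ve.
  ring.
by rewrite -[RHS](cos2Dsin2 d); ring.
Qed.

(** Parallel transport of the frame along the ray. *)
Lemma tip_frame z v e T : hyperboloid z -> tangent_frame z v e ->
  hyperboloid (geo z v T) /\
  tangent_frame (geo z v T) (sinh T *: z + cosh T *: v) e.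
Proof.
move=> hz [[zv vv] [ze ee] ve]; have [zz _] := hz; split; first exact: geo_hyp.
have c2 := cosh2 T.
split; [split|split|]; rewrite /geo ?minklin ?zz ?vv ?(minkC v z) ?zv ?ee ?ve
  ?ze.
- ring.
- by rewrite -[RHS]c2; ring.
- ring.
- by [].
- ring.
Qed.

Lemma tangent_frame_mulmx x v e A : orientation_preserving_isometry A ->
  tangent_frame x v e -> tangent_frame (x *m A) (v *m A) (e *m A).
Proof. by move=> iA [[h1 h2] [h3 h4] h5]; split; [split|split|];
  rewrite isom_mink. Qed.

Lemma crossesZ h z w k l : 0 < k -> 0 < l ->
  crosses1 h (k *: z) (l *: w) < 0 -> crosses2 h (k *: z) (l *: w) < 0 ->
  crosses1 h z w < 0 /\ crosses2 h z w < 0.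
Proof.
move=> k0 l0; have p0 : 0 < k ^+ 3 * l ^+ 3 by rewrite mulr_gt0// exprn_gt0.
have e1 : crosses1 h (k *: z) (l *: w) = k ^+ 3 * l ^+ 3 * crosses1 h z w.
  by rewrite /crosses1 -!scalemxAl !tripZ1 !tripZ2 !tripZ3; ring.
have e2 : crosses2 h (k *: z) (l *: w) = k ^+ 3 * l ^+ 3 * crosses2 h z w.
  by rewrite /crosses2 -!scalemxAl !tripZ1 !tripZ2 !tripZ3; ring.
rewrite e1 e2 (pmulr_rlt0 _ p0) (pmulr_rlt0 _ p0); split=> //.
Qed.

Variable G : isometry_group R.

(** A self-intersection of the projected ray, in terms of lifts. *)
Definition self_crosses z v := exists s t B,
  [/\ 0 <= s, 0 <= t, isometry_set G B, B <> 1%:M & geo z v t = geo z v s *m B].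

(** Conjugating by [A] turns a crossing of the ray seen from its tip into a
    crossing of the original ray. *)
Lemma tip_crossing z v e T d A h : hyperboloid z -> tangent_frame z v e ->
  isometry_set G A -> isometry_set G h -> h <> 1%:M ->
  let x' := geo z v T *m A in
  let v' := (sinh T *: z + cosh T *: v) *m A in
  let e' := e *m A in
  let w := near_cone x' v' e' (expR T * sin d) (cos d) in
  crosses1 h (near_xi x' v' (expR (- (2 * T)))) w < 0 ->
  crosses2 h (near_xi x' v' (expR (- (2 * T)))) w < 0 ->
  self_crosses z (direction v e (d *+ 2)).
Proof.
move=> hz fr GA Gh h1 x' v' e' w.
have ET : expR T * expR (- T) = 1 by rewrite -expRD subrr expR0.
have E2T : expR (- (2 * T)) = expR (- T) * expR (- T).
  by rewrite -expRD; congr expR; ring.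
have ET0 := expR_gt0 T.
have ENT0 := expR_gt0 (- T).
have zE : near_xi x' v' (expR (- (2 * T))) = (2 * expR (- T)) *: (z *m A).
  rewrite /near_xi /x' /v' !scalemxAl -mulmxBl; congr (_ *m _).
  set q := expR (- (2 * T)) in E2T *.
  have k1 : (1 + q) * cosh T - (1 - q) * sinh T = 2 * expR (- T).
    transitivity (expR (- T) + expR (- T) * (expR T * expR (- T)));
      last by rewrite ET; ring.
    by rewrite E2T /cosh /sinh; field.
  have k2 : (1 + q) * sinh T - (1 - q) * cosh T = 0.
    transitivity (- expR (- T) + expR (- T) * (expR T * expR (- T)));
      last by rewrite ET; ring.
    by rewrite E2T /cosh /sinh; field.
  transitivity (((1 + q) * cosh T - (1 - q) * sinh T) *: z
    + ((1 + q) * sinh T - (1 - q) * cosh T) *: v).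
    by rewrite /geo; apply: rV3P; rewrite !mxE; ring.
  by rewrite k1 k2 scale0r addr0.
have wE : w = expR T *: ((z + direction v e (d *+ 2)) *m A).
  rewrite /w /near_cone /x' /v' /e' -mulmxDl -mulmxBl !scalemxAl -!mulmxDl;
    congr (_ *m _).
  have -> : geo z v T + (sinh T *: z + cosh T *: v) = expR T *: (z + v).
    by rewrite -coshDsinh /geo; apply: rV3P; rewrite !mxE; ring.
  have -> : geo z v T - (sinh T *: z + cosh T *: v) = expR (- T) *: (z - v).
    by rewrite -coshBsinh /geo; apply: rV3P; rewrite !mxE; ring.
  have k1 : (expR T * sin d) ^+ 2 * expR (- T) = expR T * sin d ^+ 2.
    transitivity (expR T * sin d ^+ 2 * (expR T * expR (- T))); first by ring.
    by rewrite ET mulr1.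
  rewrite /direction cos_mulr2n sin_mulr2n !scalerA k1.
  have -> : cos d ^+ 2 *+ 2 - 1 = cos d ^+ 2 - sin d ^+ 2.
    by have := cos2Dsin2 d => cs; lra.
  transitivity (expR T *: ((cos d ^+ 2 + sin d ^+ 2) *: z
    + ((cos d ^+ 2 - sin d ^+ 2) *: v + (cos d * sin d *+ 2) *: e))).
    by apply: rV3P; rewrite !mxE; ring.
  by rewrite cos2Dsin2 scale1r.
rewrite zE wE => c1 c2.
have [||{}c1 {}c2] := crossesZ _ _ c1 c2; rewrite ?mulr_gt0//.
have iA := group_isom GA.
have rt := direction_utangent (d *+ 2) fr.
have hzA := isom_hyp iA hz.
have rtA : utangent (z *m A) (direction v e (d *+ 2) *m A).
  by case: rt => r1 r2; split; rewrite isom_mink.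
rewrite mulmxDl in c1 c2.
have [s [t [s0 t0 st]]] := ray_crosses hzA rtA (group_isom Gh) c1 c2.
exists s, t, (A *m h *m invmx A); split=> //.
- by apply: isometry_setM; [exact: isometry_setM|exact: isometry_setV].
- move=> e1; apply: h1; have := congr1 (fun D => invmx A *m D *m A) e1.
  by rewrite !mulmxA (mulVmx (isom_unit iA)) mul1mx mulmxKV ?(isom_unit iA)//
    mulmx1 mulVmx ?(isom_unit iA).
move: st; rewrite -!geo_mulmx => /(congr1 (fun u => u *m invmx A)).
by rewrite isom_mulK// !mulmxA.
Qed.
End Tips.

Section Density.
Variable R : realType.
Implicit Types (x y z u v w n e xi : 'rV[R]_3) (A B h : 'M[R]_3) (a b c s t :
  R).

Lemma sin_near0 (ep : R) : 0 < ep ->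
  \forall y \near (0:R), `|sin y - y| <= ep * `|y|.
Proof.
move=> ep0; have dv := @derivable_sin R 0.
have lE : 'D_1 (@sin R) 0 = 1 by rewrite derive_val cos0.
have : h^-1 *: ((@sin R \o shift 0) (h *: 1) - sin 0) @[h --> (0:R)^'] -->
  (1:R).
  by rewrite -[X in _ --> X]lE; exact: dv.
move/cvgrPdist_lt => /(_ _ ep0) [d /= d0 hd].
exists d => //= y yd; have [->|y0] := eqVneq y 0.
  by rewrite sin0 subrr normr0 mulr0.
have := hd y yd y0; rewrite sin0 subr0 /= addr0 /GRing.scale /= mulr1 => h.
have -> : sin y - y = - (y * (1 - y^-1 * sin y)) by field.
rewrite normrN normrM mulrC ler_wpM2r// ltW//.
Qed.

Lemma expRN_nat_small (d : R) : 0 < d -> \forall n \near \oo,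
  expR (- (n%:R : R)) < d.
Proof.
move=> d0; near=> n.
have n1 : d^-1 <= n%:R by near: n; exact: nbhs_infty_ger.
rewrite expRN invf_plt ?posrE ?expR_gt0//.
apply: le_lt_trans n1 _; apply: lt_le_trans (expR_ge1Dx _).
by rewrite ltrDr.
Unshelve. all: by end_near. Qed.

(** The angle [2 * expR (- n) * u] is [2 d] with [expR n * sin d] close to [u]
    and [cos d] close to 1. *)
Lemma tip_parameters (tau r : R) : 0 < r -> exists2 r', 0 < r' &
  \forall n \near \oo, forall u : R, `|u - tau| < r' ->
    [/\ ball (0:R) r (expR (- (2 * n%:R))),
        ball tau r (expR n%:R * sin (expR (- n%:R) * u)) &
        ball (1:R) r (cos (expR (- n%:R) * u))].
Proof.
move=> r0; pose r' := Num.min 1 (r / 2).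
have r'0 : 0 < r' by rewrite lt_min ltr01 divr_gt0.
exists r' => //; pose M := `|tau| + 1.
have M0 : 0 < M by rewrite ltr_wpDl.
have [d1 /= d10 h1] := sin_near0 (divr_gt0 r0 (mulr_gt0 (ltr0Sn R 1) (M0))).
have [d2 /= d20 h2] : \forall y \near (0:R), ball (1:R) r (cos y).
  have := @continuous_cos R 0; rewrite /continuous_at cos0; apply.
  exact: nbhsx_ballx.
near=> n => u ut.
set q := expR (- n%:R).
have q0 : 0 < q := expR_gt0 _.
have EN : expR n%:R * q = 1 by rewrite -expRD subrr expR0.
have qd1 : q < d1 / M by rewrite /q; near: n; apply: expRN_nat_small;
  rewrite divr_gt0.
have qd2 : q < d2 / M by rewrite /q; near: n; apply: expRN_nat_small;
  rewrite divr_gt0.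
have qr : q < r by rewrite /q; near: n; exact: expRN_nat_small.
have q1 : q < 1 by rewrite /q; near: n; exact: expRN_nat_small.
have ur : `|u - tau| < r / 2 by rewrite (lt_le_trans ut)// ge_min lexx orbT.
have uM : `|u| < M.
  rewrite -(subrK tau u) (le_lt_trans (ler_normD _ _))// /M addrC ltrD2l.
  by rewrite (lt_le_trans ut)// ge_min lexx.
have qu : `|q * u| = q * `|u| by rewrite normrM gtr0_norm.
split.
- rewrite /ball /= sub0r normrN gtr0_norm ?expR_gt0//.
  have -> : expR (- (2 * n%:R)) = q * q by rewrite -expRD; congr expR; ring.
  by nra.
- have := h1 (q * u); rewrite /ball /= sub0r normrN qu => h.
  have {h} : `|sin (q * u) - q * u| <= r / (2 * M) * (q * `|u|).
    apply: h; apply: le_lt_trans (_ : q * M < _);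
      first by rewrite ler_wpM2l// ltW.
    by rewrite -ltr_pdivlMr.
  move=> h.
  have h3 : `|expR n%:R * sin (q * u) - u| <= r / 2.
    have -> : expR n%:R * sin (q * u) - u = expR n%:R * (sin (q * u) - q * u).
      by rewrite mulrBr mulrA EN mul1r.
    rewrite normrM gtr0_norm ?expR_gt0//.
    apply: le_trans (ler_wpM2l (expR_ge0 _) h) _.
    have -> : expR n%:R * (r / (2 * M) * (q * `|u|)) = (expR n%:R * q) * (r /
      (2 * M) * `|u|) by ring.
    rewrite EN mul1r; apply: le_trans (_ : r / (2 * M) * M <= _).
      by rewrite ler_wpM2l ?divr_ge0 ?(ltW r0) ?(ltW uM)// mulr_ge0// ltW.
    rewrite le_eqVlt; apply/orP; left; apply/eqP; field; exact: lt0r_neq0.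
  rewrite -(subrKA u) (le_lt_trans (ler_normD _ _))//.
  rewrite (distrC tau) (distrC u (_ * _)).
  by rewrite [ltRHS]splitr ltr_leD.
- apply: h2; rewrite /= sub0r normrN qu.
  apply: le_lt_trans (_ : q * M < _); first by rewrite ler_wpM2l// ltW.
  by rewrite -ltr_pdivlMr.
Unshelve. all: by end_near. Qed.

(** A unit vector orthogonal to a point of bounded height is bounded, by the
    Cauchy-Schwarz inequality. *)
Lemma frames_compact (c : R) : compact [set p : 'rV[R]_3 * 'rV[R]_3 * 'rV[R]_3 |
  [/\ hyperboloid p.1.1, p.1.1 0 ord_max <= c & tangent_frame p.1.1 p.1.2 p.2]].
Proof.
pose B := [set x : 'rV[R]_3 | forall i, `[- c, c]%classic (x 0 i)].
apply: (@subclosed_compact _ _ (B `*` B `*` B)); last first.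
- move=> [[x v] e] /= [hx xc [[xv vv] [xe ee] _]].
  have x1 := hyperboloid_ge1 hx; have [xx x2] := hx.
  have bnd u : mink x u = 0 -> mink u u = 1 -> forall i, `[- c,
    c]%classic (u 0 i).
    move: xx; rewrite !minkE.
    set x0 := x 0 0; set x1' := x 0 1; set x2' := x 0 ord_max in xc x1 x2 *.
    set u0 := u 0 0; set u1 := u 0 1; set u2 := u 0 ord_max => xx xu uu.
    have h1 : u2 * u2 <= x2' * x2' - 1.
      have : (x2' * u2) ^+ 2 <= (x0 * x0 + x1' * x1') * (u0 * u0 + u1 * u1).
        have -> : x2' * u2 = x0 * u0 + x1' * u1 by lra.
        by rewrite -subr_ge0; have := sqr_ge0 (x0 * u1 - x1' * u0);
          rewrite !expr2 => ?; lra.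
      have -> : x0 * x0 + x1' * x1' = x2' * x2' - 1 by lra.
      have -> : u0 * u0 + u1 * u1 = u2 * u2 + 1 by lra.
      by rewrite expr2; lra.
    have cc : x2' * x2' <= c * c by nra.
    have := sqr_ge0 u0; have := sqr_ge0 u1; have := sqr_ge0 u2;
      rewrite !expr2 => q2 q1 q0.
    move=> i; rewrite /= in_itv /=; move: i; apply: ord3P;
      rewrite -/u0 -/u1 -/u2; nra.
  do 2?split; [|exact: bnd|exact: bnd] => i.
  move: xx; rewrite minkE => xx.
  have := sqr_ge0 (x 0 0); have := sqr_ge0 (x 0 1); rewrite !expr2 => *.
  rewrite /= in_itv/=; move: i; apply: ord3P; nra.
- by apply: compact_setX; [apply: compact_setX|]; exact: compact_box.
pose T : topologicalType := ('rV[R]_3 * 'rV[R]_3 * 'rV[R]_3)%type.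
pose px (p : T) := p.1.1. pose pv (p : T) := p.1.2. pose pe (p : T) := p.2.
have c1 (U V : topologicalType) : continuous (fst : U * V -> U) by move=> ?;
  exact: cvg_fst.
have c2 (U V : topologicalType) : continuous (snd : U * V -> V) by move=> ?;
  exact: cvg_snd.
have cpx : continuous px by apply: (cont_comp _ (c1 _ _)); exact: c1.
have cpv : continuous pv by apply: (cont_comp _ (c2 _ _)); exact: c1.
have cpe : continuous pe by exact: c2.
have ceq (f : T -> R) a : continuous f -> closed [set p | f p = a].
  move=> cf; apply: (@preimage_closed _ _ f [set y : R | y = a]);
    last exact: closed_eq.
  by move=> p _; exact: cf.
have -> : [set p : 'rV[R]_3 * 'rV[R]_3 * 'rV[R]_3 |
  [/\ hyperboloid p.1.1, p.1.1 0 ord_max <= c & tangent_frame p.1.1 p.1.2 p.2]]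
    =
  (px @^-1` @hyperboloid R) `&` [set p | px p 0 ord_max <= c] `&`
  ([set p | mink (px p) (pv p) = 0] `&` [set p | mink (pv p) (pv p) = 1] `&`
  ([set p | mink (px p) (pe p) = 0] `&` [set p | mink (pe p) (pe p) = 1]) `&`
   [set p | mink (pv p) (pe p) = 0]).
  rewrite eqEsubset; split=> p /=.
    by move=> [h1 h2 [[h3 h4] [h5 h6] h7]].
  by move=> [[h1 h2] [[[h3 h4] [h5 h6]] h7]].
apply: closedI; last first.
  apply: closedI; [apply: closedI; apply: closedI|]; apply: ceq;
    exact: continuous_mink.
apply: closedI.
  by apply: preimage_closed (@closed_hyperboloid R) => p _; exact: cpx.
apply: (@preimage_closed _ _ (fun p => px p 0 ord_max) [set y : R | y <= c]);
  last exact: closed_le.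
by move=> p _; apply: cvg_coord.
Qed.

End Density.

(** * Almost every ray crosses itself *)
Section Simple.
Variables (R : realType) (G : isometry_group R).
Hypothesis G_closed : closed_hyperbolic_surface G.
Implicit Types (x y z u v w n e xi : 'rV[R]_3) (A B h : 'M[R]_3) (a b c s t :
  R).

(** The frames at the tips of a ray, brought back over a compact set, cluster at
    some frame; the crossing found for the limit frame persists, for an interval
    of parameters, for infinitely many tips. *)
Lemma crossing_proportion z v e : hyperboloid z -> tangent_frame z v e ->
  exists tau r : R, 0 < r /\ forall N, exists2 n : nat, (N <= n)%N &
    forall u : R, `|u - tau| < r ->
      self_crosses G z (direction v e (expR (- n%:R) * u *+ 2)).
Proof.
move=> hz fr; have [free pd cS] := G_closed.
have [c c1 cP] := group_cocompact cS.
have /choice[A hA] : forall k : nat, exists A,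
  isometry_set G A /\ (geo z v k%:R *m A) 0 ord_max <= c.
  move=> k; have [|A GA Ac] := cP (geo z v k%:R); last by exists A.
  by apply: geo_hyp => //; case: fr.
pose U (k : nat) := (geo z v k%:R *m A k,
  (sinh k%:R *: z + cosh k%:R *: v) *m A k, e *m A k).
pose K := [set p : 'rV[R]_3 * 'rV[R]_3 * 'rV[R]_3 |
  [/\ hyperboloid p.1.1, p.1.1 0 ord_max <= c & tangent_frame p.1.1 p.1.2 p.2]].
have UK k : K (U k).
  have [GA Ac] := hA k; have iA := group_isom GA.
  have [h1 h2] := tip_frame k%:R hz fr.
  split=> //=; first exact: isom_hyp.
  exact: tangent_frame_mulmx.
have [|[[x v'] e'] [Kp clp]] := @frames_compact R c (U @ \oo) _.
  by exists 0%N => // k _; exact: UK.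
have [/= hx _ fr'] := Kp.
have [xx _] := hx; have [[xv vv] _ _] := fr'.
have fxi : future (x - v') by exact: (utangent_future hx (conj xv vv)).2.
have xixi : mink (x - v') (x - v') = 0 by rewrite !minklin xx vv (minkC v' x)
  xv; ring.
have [h Gh hxi] := no_fixed_null_line G_closed fxi xixi.
have h1 : h <> 1%:M by move=> e1; apply: (hxi 1); rewrite e1 mulmx1 scale1r.
have ih := group_isom Gh.
have fh y : hyperboloid y -> y *m h <> y.
  by move=> hy yh; apply: h1; exact: (free h (mkhyp hy)).
have [tau [t1 t2]] := crossing_parameter hx fr' ih fh hxi.
have [r r0 hr] := crossing_stable t1 t2.
have [r' r'0 [N0 _ hN0]] := tip_parameters tau r0.
exists tau, r'; split=> // N.
pose B := ball ((x, v', e') : 'rV[R]_3 * 'rV[R]_3 * 'rV[R]_3) r.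
have [||p [[k kN <-] Bp]] := clp (U @` [set k | (maxn N N0 <= k)%N]) B.
- by exists (maxn N N0) => // k kN; exists k.
- exact: nbhsx_ballx.
exists k; first by rewrite (leq_trans (leq_maxl _ _) kN).
move=> u ur; have [b1 b2 b3] := hN0 k (leq_trans (leq_maxr _ _) kN) u ur.
have [GA _] := hA k.
have [[bx bv] be] := Bp.
have [q1 q2] := hr _ _ _ _ _ _ bx bv be b1 b2 b3.
exact: (tip_crossing hz fr GA Gh h1 q1 q2).
Qed.

Lemma directionD v e th d :
  direction (direction v e th) (direction v e (th + pi / 2)) d = direction v e
    (th + d).
Proof.
rewrite /direction cosDpihalf sinDpihalf cosD sinD.
by apply: rV3P; rewrite !mxE; ring.
Qed.

Lemma direction_frame z v e th : tangent_frame z v e ->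
  tangent_frame z (direction v e th) (direction v e (th + pi / 2)).
Proof.
move=> fr; split; [exact: direction_utangent|exact: direction_utangent|].
have [[zv vv] [ze ee] ve] := fr.
rewrite /direction cosDpihalf sinDpihalf !minklin vv ee (minkC e v) ve; ring.
Qed.

Local Notation mu := (@lebesgue_measure R).

(** At the scale [expR (- n)], the directions with parameter within [r] of [tau]
    fill a fraction [r / (|tau| + r)] of a ball around [th]. *)
Lemma simple_not_density z v e (Z := [set th | ~ self_crosses G z (direction v
  e th)]) th :
  hyperboloid z -> tangent_frame z v e -> measurable Z -> 
  ~ (mu (Z `&` ball th r) * (mu (ball th r))^-1 @[r --> 0^'+] --> 1)%E.
Proof.
move=> hz fr mZ lim1.
have fr' := direction_frame th fr.
have [tau [r [r0 hr]]] := crossing_proportion hz fr'.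
pose M := `|tau| + r.
have M0 : 0 < M by rewrite ltr_wpDl.
(* q bounds the density at the scales where crossings were found *)
pose q := 1 - r / M.
have q1 : q < 1 by rewrite /q ltrBlDr ltrDl divr_gt0.
have nq : nbhs (1%:E : \bar R) [set y | (q%:E < y)%E].
  apply: open_nbhs_nbhs; split; first exact: open_ereal_gt_ereal.
  by rewrite /= lte_fin.
have [d /= d0 hd] := lim1 _ nq.
have [N _ hN] := expRN_nat_small (divr_gt0 d0 (mulr_gt0 (ltr0Sn R 1) M0)).
have [n nN hn] := hr N.
have {hN} := hN n nN; set s := expR _ => sd.
have s0 : 0 < s := expR_gt0 _.
pose rho := 2 * s * M.
have rho0 : 0 < rho by rewrite !mulr_gt0.
have rd : rho < d.
  by move: sd; rewrite ltr_pdivlMr ?mulr_gt0// /rho; lra.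
have := hd rho; rewrite /= sub0r normrN gtr0_norm// => /(_ rd rho0).
apply/negP; rewrite -leNgt.
pose J := ball (th + 2 * s * tau) (2 * s * r).
have JB : J `<=` ball th rho.
  move=> y; rewrite /J /ball /= => yJ.
  have -> : th - y = (th + 2 * s * tau - y) - (2 * s) * tau by ring.
  rewrite (le_lt_trans (ler_normB _ _))// normrM [X in _ + X * _]gtr0_norm
    ?mulr_gt0//.
  rewrite /rho /M; have : 0 < 2 * s by rewrite mulr_gt0.
  by move=> *; lra.
have JZ : Z `&` ball th rho `<=` ball th rho `\` J.
  move=> y [Zy By]; split=> // Jy; apply: Zy.
  have := hn ((y - th) / (2 * s)); rewrite directionD.
  have -> : th + s * ((y - th) / (2 * s)) *+ 2 = y.
    by field; rewrite gt_eqF.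
  apply.
  have -> : (y - th) / (2 * s) - tau = - ((th + 2 * s * tau - y) / (2 * s)).
    by field; rewrite gt_eqF.
  rewrite normrN normrM normfV [X in _ / X]gtr0_norm ?mulr_gt0//.
  rewrite ltr_pdivrMr ?mulr_gt0// [ltRHS]mulrC; exact: Jy.
have muB : mu (ball th rho) = (rho *+ 2)%:E by rewrite lebesgue_measure_ball//
  ltW.
have muJ : mu J = ((2 * s * r) *+ 2)%:E.
  by rewrite lebesgue_measure_ball//; apply/ltW; rewrite !mulr_gt0.
have h1 : (mu (Z `&` ball th rho) <= (rho *+ 2 - (2 * s * r) *+ 2)%:E)%E.
  apply: le_trans (_ : mu (ball th rho `\` J) <= _)%E.
    apply: le_measure => //; rewrite inE.
      by apply: measurableI => //; exact: measurable_realfun.measurable_ball.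
    by apply: measurableD; exact: measurable_realfun.measurable_ball.
  have fin : (mu (ball th rho) < +oo)%E by rewrite muB ltry.
  have mB1 : @measurable _ (measurableTypeR R) (ball th rho).
    exact: measurable_realfun.measurable_ball.
  have mB2 : @measurable _ (measurableTypeR R) J.
    exact: measurable_realfun.measurable_ball.
  have -> : mu (ball th rho `\` J) = (mu (ball th rho) - mu (ball th rho `&`
    J))%E.
    exact: (@measureD _ _ _ mu _ _ mB1 mB2 fin).
  by rewrite (setIidr JB) muB muJ EFinB.
rewrite muB inver mulrn_eq0 /= gt_eqF//.
have k0 : 0 < (rho *+ 2)^-1 by rewrite invr_gt0 mulrn_wgt0.
apply: le_trans (lee_wpmul2r _ h1) _; first by rewrite lee_fin ltW.
rewrite -EFinM lee_fin le_eqVlt; apply/orP; left; apply/eqP.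
by rewrite /q /rho; field; rewrite !gt_eqF.
Qed.

Lemma simple_null z v e (Z := [set th | ~ self_crosses G z (direction v e th)])
  :
  hyperboloid z -> tangent_frame z v e -> measurable Z -> mu Z = 0%E.
Proof.
move=> hz fr mZ; apply/negligibleP => //.
apply: negligibleS (lebesgue_density mZ) => th Zth /=.
rewrite indicE mem_set// => lim1; exact: (simple_not_density hz fr mZ lim1).
Qed.

End Simple.

(** * Lifting homotopies *)
Lemma lebesgue_number (R : realType) (T : pseudoMetricType R) (K : set T) (C :
  T -> T -> Prop) :
  compact K ->
  (forall p, K p -> exists2 r : R, 0 < r & forall q q', K q -> K q' ->
    ball p r q -> ball p r q' -> C q q') ->
  exists2 d : R, 0 < d & forall q q', K q -> K q' -> ball q d q' -> C q q'.
Proof.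
move=> /compact_near_coveringP cK h.
have : \forall d \near (0:R)^'+, K `<=` [set q | K q -> forall q', K q' ->
  ball q d q' -> C q q'].
  apply: (cK R _ (fun d q => K q -> forall q', K q' -> ball q d q' ->
    C q q')) => p Kp.
  have [r r0 hr] := h p Kp.
  exists (ball p (r / 2), [set d | d < r / 2]).
    split=> /=; first by apply: nbhsx_ballx; rewrite divr_gt0.
    by apply: nbhs_right_lt; rewrite divr_gt0.
  move=> [q d] /= [pq dr] Kq q' Kq' qq'; apply: hr => //.
    by apply: le_ball pq; rewrite ler_pdivrMr// ler_pMr// ler1n.
  by apply: (@ball_split _ _ q) => //; apply: le_ball qq'; exact: ltW.
move=> hd; near (0:R)^'+ => d.
exists d => // q q' Kq Kq'.
suff : K `<=` [set q | K q -> forall q', K q' -> ball q d q' ->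
  C q q'] by move=> /(_ q Kq Kq q' Kq').
by near: d.
Unshelve. all: by end_near. Qed.

Section Homotopy.
Variables (R : realType) (G : isometry_group R).
Hypothesis G_closed : closed_hyperbolic_surface G.
Implicit Types (p q : hyp R) (x y : R) (u v w : 'rV[R]_3).
Local Notation cov := (covering_map G).

(** The triangle inequality, weakened to the case where both distances are at
    most [d]: then [cosh (2 d) = 2 * cosh d ^+ 2 - 1]. *)
Lemma mink_triangle u v w (c : R) : hyperboloid u -> hyperboloid v ->
  hyperboloid w ->
  - mink u v <= c -> - mink v w <= c -> - mink u w <= 2 * c ^+ 2 - 1.
Proof.
move=> hu hv hw uv vw; have [uu _] := hu; have [vv _] := hv; have [ww _] := hw.
have h1 := hyperboloid_mink_le hu hv; have h2 := hyperboloid_mink_le hv hw.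
have : 0 <= mink (u + w + (mink u v + mink v w) *: v) (u + w + (mink u v + mink
  v w) *: v).
  apply: (@timelike_orth_ge0 _ v); rewrite ?vv ?ltrN10//.
  by rewrite !minklin vv (minkC v u); ring.
rewrite !minklin uu vv ww (minkC v u) (minkC w u) (minkC w v) => h.
set a := mink u v in uv h1 h; set b := mink v w in vw h2 h.
have h3 : 0 <= (2 * c + (a + b)) * (2 * c - (a + b)) by apply: mulr_ge0; lra.
by rewrite expr2; lra.
Qed.

(** Closeness is measured by hyperbolic cosines, for which the triangle
    inequality costs the factor 7 of [close_trans]. *)
Definition hclose (ep : R) p q := - mink (val p) (val q) < 1 + ep.

Lemma closeC ep p q : hclose ep p q -> hclose ep q p.
Proof. by rewrite /hclose minkC. Qed.

Lemma close_refl ep p : 0 < ep -> hclose ep p p.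
Proof. by move=> ep0; rewrite /hclose; have [-> _] := hypP p;
  rewrite opprK ltrDl. Qed.

Lemma close_trans ep p q r : 0 < ep -> ep <= 1 -> hclose ep p q ->
  hclose ep q r ->
  hclose (7 * ep) p r.
Proof.
move=> e0 e1 /ltW pq /ltW qr.
apply: le_lt_trans (mink_triangle (hypP p) (hypP q) (hypP r) pq qr) _.
rewrite expr2; nra.
Qed.

Lemma close_nbhs ep p : 0 < ep -> \forall q \near p, hclose ep p q.
Proof.
move=> e0.
have cf : continuous (fun q : hyp R => mink (val p) (val q)).
  by apply: continuous_mink; [exact: cst_continuous|exact: continuous_val].
have : - (1 + ep) < mink (val p) (val p) by have [-> _] := hypP p; lra.
move=> h; have h' := cf p [set y | - (1 + ep) < y] (open_nbhs_nbhs (conj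
  (@open_gt _ _) h)).
have : \forall q \near p, - (1 + ep) < mink (val p) (val q) by exact: h'.
apply: filterS => q; rewrite /hclose; lra.
Qed.

Lemma cov_lift (P : surface G) p p' : cov p = P -> cov p' = P ->
  exists2 A, isometry_set G A & val p' = val p *m A.
Proof. by move=> <- e; apply/cov_eqP. Qed.

Lemma close_unique : exists ep : R, [/\ 0 < ep, ep <= 1 &
  forall p q, hclose (100 * ep) p q -> cov p = cov q -> p = q].
Proof.
have [e e0 he] := group_separated G_closed.
exists (Num.min 1 (e / 100)); split.
- by rewrite lt_min ltr01 divr_gt0.
- by rewrite ge_min lexx.
move=> p q pq /cov_eqP[A GA qE].
have ee : 100 * Num.min 1 (e / 100) <= e.
  by rewrite mulrC -ler_pdivlMr// ge_min lexx orbT.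
have [A1|A1] := pselect (A = 1%:M).
  by apply: val_inj; rewrite qE A1 mulmx1.
exfalso; have := he _ _ (hypP p) GA A1; clear A1; move: pq;
  rewrite /hclose qE; lra.
Qed.

Definition sclose ep (P Q : surface G) := exists p q, [/\ cov p = P,
  cov q = Q & hclose ep p q].

Lemma sclose_lift ep P Q p : sclose ep P Q -> cov p = P ->
  exists2 q, cov q = Q & hclose ep p q.
Proof.
move=> [p' [q' [Pp' Qq' pq']]] Pp.
have [A GA pE] := cov_lift Pp' Pp.
have iA := group_isom GA.
exists (hyp_act iA q').
  by rewrite -Qq'; symmetry; apply/cov_eqP; exists A.
by rewrite /hclose pE /= isom_mink.
Qed.

(** The balls of the hyperbolic plane project to open sets, which form a cover
    of the image; take a Lebesgue number of its preimage. *)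
Lemma sclose_cont (K : set (R * R)) (F : R * R -> surface G) ep : 0 < ep ->
  ep <= 1 ->
  compact K -> {within K, continuous F} ->
  exists2 d : R, 0 < d & forall P Q, K P -> K Q -> ball P d Q ->
    sclose (7 * ep) (F P) (F Q).
Proof.
move=> e0 e1 cK cF; apply: lebesgue_number => // P KP.
have [p FP] := cov_surj (F P).
have : nbhs (F P) (cov @` [set q | hclose ep p q]).
  have : nbhs p [set q | hclose ep p q] by exact: close_nbhs.
  rewrite nbhsE => -[U [oU Up] sU].
  rewrite nbhsE; exists (cov @` U); last by move=> _ [q Uq <-]; exists q =>
    //; exact: sU.
  split; [exact: cov_open|by exists p].
have cFP : F @ within K (nbhs P) --> F P.
  by move/subspace_continuousP: cF; apply.
move=> /cFP; rewrite /= /within /= => /nbhs_ballP[r /= r0 hr].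
exists r => // Q Q' KQ KQ' PQ PQ'.
have [q pq Qq] := hr Q PQ KQ.
have [q' pq' Qq'] := hr Q' PQ' KQ'.
exists q, q'; split=> //; apply: (close_trans e0 e1 _ pq'); exact: closeC.
Qed.

Section Grid.
Variables (F : R * R -> surface G) (N : nat) (ep : R) (z0 : hyp R).

(** The possible [i]-th points of a discrete lift, starting at [z0], of the
    horizontal path at the height [y]: consecutive points are close. *)
Fixpoint reach (y : R) (i : nat) (p : hyp R) : Prop :=
  match i with
  | 0 => p = z0
  | i.+1 => cov p = F (i.+1%:R / N%:R, y) /\ exists2 q,
    reach y i q & hclose ep q p
  end.

Hypotheses (ep0 : 0 < ep) (ep1 : 7 * ep <= 1).
Hypothesis ep_unique : forall p q, hclose (49 * ep) p q -> cov p = cov q ->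
  p = q.

Lemma reach_cov y i p : cov z0 = F (0, y) -> reach y i p ->
  cov p = F (i%:R / N%:R, y).
Proof. by case: i => [h ->|i _ []//]; rewrite mul0r. Qed.

(** Lifts of two neighbouring rows stay close: the lift of the next point of the
    second row that is close to the first lift is within reach of the previous
    points, and two points of an orbit at such a small distance are equal. *)
Lemma reach_close y y' i p p' :
  (forall i, (i <= N)%N -> sclose ep (F (i%:R / N%:R, y)) (F (i%:R / N%:R,
    y'))) ->
  cov z0 = F (0, y) -> cov z0 = F (0, y') ->
  (i <= N)%N -> reach y i p -> reach y' i p' -> hclose ep p p'.
Proof.
move=> hF zy zy'; elim: i p p' => [|i IH] p p' iN.
  by move=> -> ->; exact: close_refl.
move=> ry ry'; have pE := reach_cov zy ry; have p'E := reach_cov zy' ry'.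
move: ry ry' => [_ [q rq qp]] [_ [q' rq' qp']].
have qq' := IH _ _ (ltnW iN) rq rq'.
have [w wE pw] := sclose_lift (hF _ iN) pE.
suff -> : p' = w by [].
apply: ep_unique; last by rewrite wE.
have ep1' : ep <= 1 by move: ep0 ep1; lra.
have c1 : hclose (7 * ep) p' q by apply: (close_trans (q := q')) => //;
  exact: closeC.
have c2 : hclose (7 * ep) q w by apply: (close_trans (q := p)).
have : hclose (7 * (7 * ep)) p' w.
  by apply: (close_trans _ _ c1 c2); move: ep0 ep1; lra.
by rewrite /hclose; lra.
Qed.

End Grid.

(** From one row of a fine grid to the next, the ends of the discrete lifts stay
    close; they project to the same point, so that they are equal.  The given
    lifts [l0] and [l1] provide discrete lifts of the first and last rows. *)
Lemma homotopy_endpoint (F : R * R -> surface G) (l0 l1 : R -> hyp R) :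
  {within @square R, continuous F} -> continuous l0 -> continuous l1 ->
  (forall x, x \in `[0, 1] -> F (x, 0) = cov (l0 x) /\ F (x, 1) = cov (l1 x)) ->
  (forall y, y \in `[0, 1] -> F (0, y) = cov (l0 0) /\ F (1, y) = cov (l0 1)) ->
  l0 0 = l1 0 -> l0 1 = l1 1.
Proof.
move=> cF cl0 cl1 Fx Fy l01.
have [e [e0 e1 eU]] := close_unique.
(* two uses of [close_trans] turn ep into 49 ep, less than 100 e *)
pose ep0 := e / 100; have ep00 : 0 < ep0 by rewrite divr_gt0.
have eE : e = 100 * ep0 by rewrite /ep0; field.
pose ep := 7 * ep0.
have csq : compact (@square R) by apply: compact_setX; exact: segment_compact.
have cI : compact `[0, 1 : R] by exact: segment_compact.
have ep01 : ep0 <= 1 by lra.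
have [d d0 hd] := sclose_cont ep00 ep01 csq cF.
have lu (l : R -> hyp R) : continuous l -> exists2 d : R, 0 < d &
    forall x x', `[0, 1]%classic x -> `[0, 1]%classic x' -> ball x d x' ->
      hclose ep (l x) (l x').
  move=> cl; apply: lebesgue_number => // x _.
  have := cl x _ (close_nbhs (l x) ep00) => /nbhs_ballP[r /= r0 hr].
  exists r => // q q' _ _ xq xq'.
  apply: (close_trans ep00 _ _ (hr _ xq')); first by lra.
  by apply: closeC; exact: hr.
have [d1 d10 h1] := lu l0 cl0; have [d2 d20 h2] := lu l1 cl1.
have small (k : R) : 0 < k -> \forall N \near \oo, (N%:R : R)^-1 < k.
  move=> k0; near=> M; rewrite invf_plt ?posrE//; near: M.
    exact: nbhs_infty_gtr.
  by exists 1%N => // j /=; rewrite ltr0n.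
near \oo => N.
have N0 : (0 < N)%N by near: N; exists 1%N.
have NR : 0 < (N%:R : R) by rewrite ltr0n.
have iN (i : nat) : (i <= N)%N -> `[0, 1]%classic (i%:R / N%:R : R).
  by move=> iN; rewrite /= in_itv /= divr_ge0 ?ler0n// ler_pdivrMr// mul1r
    ler_nat.
have step (i : nat) (k : R) : N%:R^-1 < k ->
  ball (i%:R / N%:R : R) k (i.+1%:R / N%:R).
  move=> Nk; rewrite /ball /= -mulrBl -natr1 opprD addrA subrr sub0r normrM
    normrN1 mul1r.
  by rewrite gtr0_norm ?invr_gt0.
have Nd : N%:R^-1 < d by near: N; exact: small.
have Nd1 : N%:R^-1 < d1 by near: N; exact: small.
have Nd2 : N%:R^-1 < d2 by near: N; exact: small.
have i0 : (0:R) \in `[0, 1] by rewrite in_itv /= lexx ler01.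
have i1 : (1:R) \in `[0, 1] by rewrite in_itv /= lexx ler01.
pose rch := reach F N ep (l0 0).
have rl (l : R -> hyp R) (y : R) (k : R) : 
    (forall x x', `[0, 1]%classic x -> `[0, 1]%classic x' -> ball x k x' ->
      hclose ep (l x) (l x')) ->
    N%:R^-1 < k -> l 0 = l0 0 -> (forall x, x \in `[0, 1] -> F (x,
      y) = cov (l x)) ->
    forall i, (i <= N)%N -> rch y i (l (i%:R / N%:R)).
  move=> lc Nk ll Fl; elim=> [_|i IH iN']; first by rewrite /rch /= mul0r.
  split; first by rewrite Fl//; exact: iN.
  exists (l (i%:R / N%:R)); first by apply: IH; exact: ltnW.
  by apply: lc; [exact/iN/ltnW|exact: iN|exact: step].
have zF (y : R) : y \in `[0, 1] -> cov (l0 0) = F (0, y) by move=> /Fy[].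
have iNN : N%:R / N%:R = 1 :> R by rewrite divff// gt_eqF.
have ep_pos : 0 < ep by rewrite mulr_gt0.
have ep_le : 7 * ep <= 1 by rewrite /ep; lra.
have epU p q : hclose (49 * ep) p q -> cov p = cov q -> p = q.
  by move=> c; apply: eU; move: c; rewrite /hclose /ep; lra.
have epU1 p q : hclose ep p q -> cov p = cov q -> p = q.
  by move=> c; apply: epU; move: c; rewrite /hclose; lra.
have key : forall j, (j <= N)%N -> forall p, rch (j%:R / N%:R) N p -> p = l0 1.
  elim=> [_|j IH jN] p rp.
    rewrite mul0r in rp.
    have r0 : rch 0 N (l0 (N%:R / N%:R)).
      by apply: (rl l0 0 d1) => // x x01; case: (Fx x x01).
    rewrite -iNN; apply: epU1.
      apply: (reach_close ep_pos ep_le epU _ (zF _ i0) (zF _ i0) (leqnn N) rp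
        r0).
      move=> i ii; apply: hd; [split; [exact: iN|by []]|split;
        [exact: iN|by []]|].
      by split; exact: ballxx.
    apply: etrans (reach_cov (zF _ i0) rp) _; apply/esym.
    exact: reach_cov (zF _ i0) r0.
  have jy := iN _ (ltnW jN); have jy' := iN _ jN.
  have ex : forall i, (i <= N)%N -> exists q, rch (j%:R / N%:R) i q.
    elim=> [_|i IHi iN']; first by exists (l0 0).
    have [q rq] := IHi (ltnW iN').
    have sc : sclose ep (F (i%:R / N%:R, j%:R / N%:R)) (F (i.+1%:R / N%:R,
      j%:R / N%:R)).
      apply: hd; [by split; [exact/iN/ltnW|]|by split; [exact: iN|]|].
      by split; [exact: step|exact: ballxx].
    have [q' q'E qq'] := sclose_lift sc (reach_cov (zF _ jy) rq).
    by exists q'; split=> //; exists q.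
  have [q rq] := ex N (leqnn N).
  rewrite -(IH (ltnW jN) q rq); apply/esym/epU1.
    apply: (reach_close ep_pos ep_le epU _ (zF _ jy) (zF _ jy') (leqnn N) rq
      rp).
    move=> i ii; apply: hd; [by split; [exact: iN|]|by split; [exact: iN|]|].
    by split; [exact: ballxx|exact: step].
  apply: etrans (reach_cov (zF _ jy) rq) _; apply/esym.
  apply: etrans (reach_cov (zF _ jy') rp) _; rewrite iNN.
  by have [_ ->] := Fy _ jy; have [_ ->] := Fy _ jy'.
apply/esym/(key N (leqnn N)); rewrite iNN -{2}iNN.
apply: (rl l1 1 d2) => //.
by move=> x x01; case: (Fx x x01).
Unshelve. all: by end_near. Qed.

(** The homotopy is constant. *)
Lemma lift_endpoint (l0 l1 : R -> hyp R) : continuous l0 -> continuous l1 ->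
  (forall x, x \in `[0, 1] -> cov (l0 x) = cov (l1 x)) -> l0 0 = l1 0 ->
    l0 1 = l1 1.
Proof.
move=> c0 c1 e e0; pose F (P : R * R) := cov (l0 P.1).
apply: (homotopy_endpoint (F := F)) => //.
  apply: continuous_subspaceT => P.
  apply: (@continuous_comp _ _ _ (fun P : R * R => l0 P.1));
    last exact: cov_continuous.
  by apply: continuous_comp; [exact: cvg_fst|exact: c0].
by move=> x x01; rewrite /F /= e.
Qed.

End Homotopy.

(** * Geodesic loops and classes of lassos *)
Section StraightHomotopy.
Variables (R : realType) (G : isometry_group R).
Implicit Types (x y : R) (u v w : 'rV[R]_3).
Local Notation cov := (covering_map G).

(** Homotopies are functions on the whole plane: outside of [0, 1] the parameter
    is clamped, so that convex combinations remain timelike. *)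
Definition clamp y : R := Num.max 0 (Num.min 1 y).

Lemma clamp01 y : 0 <= clamp y <= 1.
Proof. by rewrite /clamp le_max lexx ge_max ler01 ge_min lexx. Qed.

Lemma clamp_id y : y \in `[0, 1] -> clamp y = y.
Proof. by rewrite in_itv /= => /andP[y0 y1];
  rewrite /clamp (min_idPr y1) (max_idPr y0). Qed.

Lemma convex_timelike u v y : hyperboloid u -> hyperboloid v -> 0 <= y <= 1 ->
  mink ((1 - y) *: u + y *: v) ((1 - y) *: u + y *: v) <= -1 /\
  0 < ((1 - y) *: u + y *: v) 0 ord_max.
Proof.
move=> hu hv /andP[y0 y1]; have uv := hyperboloid_mink_le hu hv.
have [uu u2] := hu; have [vv v2] := hv; split.
  rewrite !minklin uu vv (minkC v u).
  have : y * (1 - y) * (mink u v + 1) <= 0.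
    by rewrite mulr_ge0_le0 ?mulr_ge0 ?subr_ge0//; lra.
  by move=> h; lra.
rewrite !mxE; move: y0; rewrite le_eqVlt => /predU1P[<-|y0];
  first by rewrite subr0 mul1r mul0r addr0.
by rewrite ltr_wpDl ?mulr_gt0// mulr_ge0 ?subr_ge0// ltW.
Qed.

Lemma normalize_hyp u : mink u u < 0 -> 0 < u 0 ord_max ->
  hyperboloid ((Num.sqrt (- mink u u))^-1 *: u).
Proof.
move=> uu u2; set m := Num.sqrt _.
have m0 : 0 < m by rewrite sqrtr_gt0 oppr_gt0.
have mm : m ^+ 2 = - mink u u by rewrite sqr_sqrtr// oppr_ge0 ltW.
split; last by rewrite mxE mulr_gt0// invr_gt0.
have -> : mink (m^-1 *: u) (m^-1 *: u) = mink u u / m ^+ 2.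
  by rewrite minkZl minkZr; field; rewrite gt_eqF.
by rewrite mm invrN mulrN divff// lt_eqF.
Qed.

(** The point at the parameter [y] of the chord from [u] to [v], projected back
    to the hyperboloid. *)
Definition straight u v y := let w := (1 - clamp y) *: u + clamp y *: v in
  (Num.sqrt (- mink w w))^-1 *: w.

Lemma straight_hyp u v y : hyperboloid u -> hyperboloid v ->
  hyperboloid (straight u v y).
Proof.
move=> hu hv; have [h1 h2] := convex_timelike hu hv (clamp01 y).
by apply: normalize_hyp => //; lra.
Qed.

Lemma sqrt_minkN u : hyperboloid u -> (Num.sqrt (- mink u u))^-1 *: u = u.
Proof. by move=> [-> _]; rewrite opprK sqrtr1 invr1 scale1r. Qed.

Lemma straight0 u v : hyperboloid u -> straight u v 0 = u.
Proof.
move=> hu; rewrite /straight clamp_id ?in_itv/= ?lexx ?ler01//.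
by rewrite subr0 scale1r scale0r addr0 sqrt_minkN.
Qed.

Lemma straight1 u v : hyperboloid v -> straight u v 1 = v.
Proof.
move=> hu; rewrite /straight clamp_id ?in_itv/= ?lexx ?ler01//.
by rewrite subrr scale1r scale0r add0r sqrt_minkN.
Qed.

Lemma straight_id u y : hyperboloid u -> straight u u y = u.
Proof. by move=> hu; rewrite /straight -scalerDl subrK scale1r sqrt_minkN. Qed.

Lemma clamp_continuous : continuous clamp.
Proof.
move=> y; apply: (@continuous_max _ _ (fun=> 0) (fun y => Num.min 1 y));
  first exact: cvg_cst.
apply: (@continuous_min _ _ (fun=> 1) (fun y => y));
  [exact: cvg_cst|exact: cvg_id].
Qed.

Lemma straight_homotopy (a b : R -> surface G) (l0 l1 : R -> hyp R) :
  continuous l0 -> continuous l1 -> l0 0 = l1 0 -> l0 1 = l1 1 ->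
  (forall x, x \in `[0, 1] -> a x = cov (l0 x)) ->
  (forall x, x \in `[0, 1] -> b x = cov (l1 x)) ->
  path_homotopic a b.
Proof.
move=> c0 c1 e0 e1 aE bE.
pose H (P : R * R) : hyp R := mkhyp (straight_hyp P.2 (hypP (l0 P.1)) (hypP (l1
  P.1))).
have i0 : (0:R) \in `[0, 1] by rewrite in_itv /= lexx ler01.
have i1 : (1:R) \in `[0, 1] by rewrite in_itv /= lexx ler01.
have k1 : continuous (fun P : R * R => P.1) by move=> ?; exact: cvg_fst.
have k2 : continuous (fun P : R * R => P.2) by move=> ?; exact: cvg_snd.
have cH : continuous H.
  apply: continuous_hyp => /=.
  pose w (P : R * R) := (1 - clamp P.2) *: val (l0 P.1) + clamp P.2 *: val (l1
    P.1).
  have cl2 : continuous (fun P : R * R =>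
    clamp P.2) by apply: cont_comp k2 clamp_continuous.
  have cw : continuous w.
    apply: continuous_lin => //.
    - exact: cont_comp k1 (cont_comp c0 (@continuous_val R)).
    - exact: cont_comp k1 (cont_comp c1 (@continuous_val R)).
    - by apply: contB => //; exact: cst_continuous.
  pose f (P : R * R) : R := (Num.sqrt (- mink (w P) (w P)))^-1.
  have cf : continuous f.
    move=> P; apply: cvgV.
      rewrite gt_eqF// sqrtr_gt0 oppr_gt0.
      by have [+ _] := convex_timelike (hypP (l0 P.1)) (hypP (l1 P.1)) (clamp01
        P.2); rewrite -/(w P); lra.
    apply: (@cont_comp _ _ _ (fun P => - mink (w P) (w P)) Num.sqrt);
      last exact: sqrt_continuous.
    by apply: contN; exact: continuous_mink.
  rewrite (_ : (fun p => _) = fun P => f P *: w P + 0 *: w P); last first.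
    by apply/funext => P; rewrite scale0r addr0.
  by apply: continuous_lin => //; exact: cst_continuous.
exists (cov \o H); split.
- apply: continuous_subspaceT => P; apply: continuous_comp;
  [exact: cH|exact: cov_continuous].
- move=> x x01; rewrite aE// bE//; split; congr cov; apply: val_inj => /=.
    by rewrite straight0//; exact: hypP.
  by rewrite straight1//; exact: hypP.
- move=> y y01; rewrite !aE//; split; congr cov; apply: val_inj => /=.
    by rewrite -e0 straight_id//; exact: hypP.
  by rewrite -e1 straight_id//; exact: hypP.
Qed.

End StraightHomotopy.

Section Arcs.
Variables (R : realType) (G : isometry_group R).
Hypothesis G_closed : closed_hyperbolic_surface G.
Variables (z : hyp R) (e1 e2 : 'rV[R]_3).
Hypothesis fr : tangent_frame (val z) e1 e2.
Implicit Types (x y th s t : R) (u v w n : 'rV[R]_3) (A B : 'M[R]_3).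
Implicit Types (g : R -> surface G).
Local Notation cov := (covering_map G).

Definition ray th t : hyp R := mkhyp (geo_hyp t (hypP z) (direction_utangent th
  fr)).

Lemma rayE th t : val (ray th t) = geo (val z) (direction e1 e2 th) t.
Proof. by []. Qed.

Lemma ray0 th : ray th 0 = z.
Proof. by apply: val_inj; rewrite rayE geo0. Qed.

Lemma ray_unique th l : geodesic_from z (direction e1 e2 th) l -> l = ray th.
Proof. by move=> [_ lE]; apply/funext => t; apply: val_inj; rewrite lE. Qed.

Lemma ray_geodesic th : geodesic_from z (direction e1 e2 th) (ray th).
Proof. by split=> //; exact: direction_utangent. Qed.

Lemma continuous_geo (T : topologicalType) (f : T ->
  R) u v : continuous f -> continuous (fun p => geo u v (f p)).
Proof.
move=> cf; have ce : continuous (fun p => expR (f p)).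
  by move=> p; apply: continuous_comp (cf p) _; exact: continuous_expR.
have cne : continuous (fun p => expR (- f p)).
  move=> p; apply: (@continuous_comp _ _ _ (fun p => - f p) (@expR R)).
    exact: contN.
  exact: continuous_expR.
apply: continuous_lin; [exact: cst_continuous|exact: cst_continuous| |];
  (apply: contM; [|exact: cst_continuous]).
  exact: contD.
exact: contB.
Qed.

Lemma free1 A (p : hyp R) : isometry_set G A -> val p *m A = val p -> A = 1%:M.
Proof. by case: G_closed => free _ _; exact: free. Qed.

Lemma group_eq A B (p : hyp R) : isometry_set G A -> isometry_set G B ->
  val p *m A = val p *m B -> A = B.
Proof.
move=> GA GB e; have iB := group_isom GB.
have : A *m invmx B = 1%:M.
  apply: (@free1 _ p); first by apply: isometry_setM => //;
    exact: isometry_setV.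
  by rewrite mulmxA e isom_mulK.
by move=> /(congr1 (mulmxr B)) /=; rewrite mulmxKV ?(isom_unit iB)// mul1mx.
Qed.

(** The geodesic loop at the marked point in the class of [B]. *)
Definition is_arc B g := exists v l L,
  [/\ geodesic_from z v l, 0 < L, val (l L) = val z *m B & forall x,
    g x = cov (l (L * x))].

Lemma geodesic_continuous v l L : geodesic_from z v l ->
  continuous (fun x : R => l (L * x)).
Proof.
move=> [_ lE]; apply: continuous_hyp.
rewrite (_ : (fun x => _) = fun x => geo (val z) v (L * x));
  last by apply/funext => x; rewrite lE.
by apply: continuous_geo; apply: contM; [exact: cst_continuous|move=> ?;
  exact: cvg_id].
Qed.

Lemma geodesic_origin v l : geodesic_from z v l -> l 0 = z.
Proof. by move=> [_ lE]; apply: val_inj; rewrite lE -/(geo _ _ _) geo0. Qed.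

Lemma arc_exists B : isometry_set G B -> B <> 1%:M -> exists g, is_arc B g.
Proof.
move=> GB B1.
have [|v [L [uv L0 vL]]] := geo_exists (hypP z) (isom_hyp (group_isom GB) (hypP
  z)).
  by move=> zB; apply: B1; apply: (@free1 _ z).
pose l t : hyp R := mkhyp (geo_hyp t (hypP z) uv).
by exists (fun x => cov (l (L * x))), v, l, L; split.
Qed.

Lemma arc_unique B g g' : is_arc B g -> is_arc B g' -> g = g'.
Proof.
move=> [v [l [L [[uv lE] L0 lL gE]]]] [v' [l' [L' [[uv' lE'] L0' lL' gE']]]].
have [vv LL] : v = v' /\ L = L'.
  by apply: (geo_uniq (hypP z) uv uv' L0 L0'); rewrite /geo -lE -lE' lL lL'.
apply/funext => x; rewrite gE gE' LL; congr cov; apply: val_inj.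
by rewrite lE lE' vv.
Qed.

(** Two lifts of the loop starting at [z] have the same end. *)
Lemma arc_inj B B' g : isometry_set G B -> isometry_set G B' ->
  is_arc B g -> is_arc B' g -> B = B'.
Proof.
move=> GB GB' [v [l [L [gf L0 lL gE]]]] [v' [l' [L' [gf' L0' lL' gE']]]].
apply: (@group_eq _ _ z) => //; rewrite -lL -lL'; congr val.
rewrite -[L]mulr1 -[L']mulr1.
apply: (lift_endpoint G_closed (geodesic_continuous (L :=
  L) gf) (geodesic_continuous (L := L') gf')).
  by move=> x _; rewrite -gE -gE'.
by rewrite !mulr0 (geodesic_origin gf) (geodesic_origin gf').
Qed.

(** Translated by [invmx B], the reversed lift starts at [z]. *)
Lemma arc_reverse B B' g : isometry_set G B -> isometry_set G B' ->
  is_arc B g -> is_arc B' (reverse g) -> B' = invmx B.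
Proof.
move=> GB GB' [v [l [L [gf L0 lL gE]]]] [v' [l' [L' [gf' L0' lL' gE']]]].
have GV := isometry_setV GB; have iV := group_isom GV; have iB := group_isom GB.
apply: (@group_eq _ _ z) => //; rewrite -lL'.
pose m x := hyp_act iV (l (L * (1 - x))).
have cm : continuous m.
  apply: continuous_hyp; apply: continuous_mulmx3.
  have [_ lE] := gf.
  rewrite (_ : (fun x => _) = fun x => geo (val z) v (L * (1 - x))); last first.
    by apply/funext => x; rewrite lE.
  apply: continuous_geo; apply: contM; first exact: cst_continuous.
  by apply: contB; [exact: cst_continuous|move=> ?; exact: cvg_id].
have : m 1 = l' (L' * 1).
  apply: (lift_endpoint G_closed cm (geodesic_continuous (L := L') gf')).
    move=> x _; rewrite -gE' /reverse gE; symmetry.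
    by apply/cov_eqP; exists (invmx B).
  apply: val_inj; rewrite /m /= subr0 mulr1 lL isom_mulK// mulr0.
  by rewrite (geodesic_origin gf').
rewrite mulr1 => <-; rewrite /m /= subrr mulr0 (geodesic_origin gf)//.
Qed.

(** The spoke is run back along its image under [B], which is where the lifted
    ray meets the translate of its spoke. *)
Definition lasso_lift th (s t : R) B (iB : orientation_preserving_isometry B) x
  : hyp R :=
  let u := (s + t) * x in
  if u <= t then ray th u else hyp_act iB (ray th (s + t - u)).

Lemma lasso_lift_continuous th s t B (iB : orientation_preserving_isometry B) :
  val (ray th t) = val (ray th s) *m B -> continuous (lasso_lift th s t iB).
Proof.
move=> st; apply: continuous_hyp.
pose r t := geo (val z) (direction e1 e2 th) t.
(* the vector formula has no case distinction: each of the two terms is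
   constant on the part of the path that the other one describes *)
rewrite (_ : (fun x => _) = fun x => 1 *: r (Num.min ((s + t) * x) t) +
   1 *: (1 *: (r (Num.min s (s + t - (s + t) * x)) *m B) + (-1) *: (r s *m
     B))); last first.
  apply/funext => x; rewrite /lasso_lift; set u := (s + t) * x.
  rewrite !scale1r scaleN1r; have [ut|ut] := leP u t.
    by rewrite (min_idPl _) ?subrr ?addr0//; lra.
  rewrite (min_idPr _); last by lra.
  by rewrite /= /r -!rayE st [RHS]addrC subrK.
have cu : continuous (fun x : R => (s + t) * x).
  by apply: contM; [exact: cst_continuous|move=> ?; exact: cvg_id].
have cr (f : R -> R) : continuous f -> continuous (fun x =>
  r (f x)) by exact: continuous_geo.
apply: continuous_lin; [| |exact: cst_continuous|exact: cst_continuous].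
  apply: (cr (fun x => Num.min ((s + t) * x) t)) => x.
  by apply: (@continuous_min _ _ (fun x => (s + t) * x) (fun=> t));
    [exact: cu|exact: cvg_cst].
apply: continuous_lin; [|exact: cst_continuous|exact: cst_continuous|
  exact: cst_continuous].
apply: continuous_mulmx3; apply: (cr (fun x =>
  Num.min s (s + t - (s + t) * x))) => x.
apply: (@continuous_min _ _ (fun=> s) (fun x => s + t - (s + t) * x));
  first exact: cvg_cst.
by apply: contB => //; exact: cst_continuous.
Qed.

Lemma lasso_lift_cov th s t B (iB : orientation_preserving_isometry B) x :
  isometry_set G B ->
  lasso_loop (fun t => cov (ray th t)) s t x = cov (lasso_lift th s t iB x).
Proof.
move=> GB; rewrite /lasso_loop /lasso_lift; case: ifP => // _.
by apply/cov_eqP; exists B.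
Qed.

Lemma lasso_lift0 th s t B (iB : orientation_preserving_isometry B) :
  0 <= t -> lasso_lift th s t iB 0 = z.
Proof. by move=> t0; rewrite /lasso_lift mulr0 t0 ray0. Qed.

Lemma lasso_lift1 th s t B (iB : orientation_preserving_isometry B) :
  0 <= s -> val (ray th t) = val (ray th s) *m B ->
  val (lasso_lift th s t iB 1) = val z *m B.
Proof.
move=> s0 st; rewrite /lasso_lift mulr1; case: ifP => h.
  have -> : s = 0 by lra.
  by rewrite /= add0r -rayE st (_ : s = 0) ?ray0//; lra.
by rewrite /= subrr -rayE ray0.
Qed.

(** From left to right, the homotopy lifts: a lift of [g] starting at [z] ends
    where the lift of the lasso does.  From right to left, two paths of the
    hyperbolic plane with the same ends are homotopic along chords. *)
Lemma lasso_arc th s t B g : isometry_set G B -> 0 <= s -> s < t ->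
  val (ray th t) = val (ray th s) *m B ->
  (geodesic_arc g /\ path_homotopic (lasso_loop (fun t =>
    cov (ray th t)) s t) g) <->
  is_arc B g.
Proof.
move=> GB s0 st stB; have iB := group_isom GB.
have i0 : (0:R) \in `[0, 1] by rewrite in_itv /= lexx ler01.
have i1 : (1:R) \in `[0, 1] by rewrite in_itv /= lexx ler01.
have t0 : 0 <= t by lra.
have cm := lasso_lift_continuous (iB := iB) stB.
set m := lasso_lift th s t iB in cm.
have mE x : lasso_loop (fun t => cov (ray th t)) s t x = cov (m x) by exact:
  lasso_lift_cov.
have m0 : m 0 = z by exact: lasso_lift0.
have m1 : val (m 1) = val z *m B by exact: lasso_lift1.
split.
  move=> [[l [L [[z' [v [uv' lE]]] L0 gE]]] [F [cF Fx Fy]]].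
  have l0 : l 0 = z' by apply: val_inj; rewrite lE -/(geo _ _ _) geo0.
  have : cov z' = cov z.
    have [_ h1] := Fx 0 i0; have [h2 _] := Fy 1 i1.
    by rewrite -l0 -[0](mulr0 L) -gE -h1 h2 mE m0.
  move=> /cov_eqP[A GA zE]; have iA := group_isom GA.
  pose l' t := hyp_act iA (l t).
  have gf : geodesic_from z (v *m A) l'.
    split; first by case: uv' => h1 h2; split; rewrite ?zE isom_mink.
    by move=> r; rewrite /= lE mulmxDl -!scalemxAl zE.
  have gE' x : g x = cov (l' (L * x)) by rewrite gE; apply/cov_eqP; exists A.
  exists (v *m A), l', L; split=> //.
  rewrite -m1 -[L]mulr1; congr val; apply/esym.
  apply: (homotopy_endpoint G_closed cF cm (geodesic_continuous (L := L) gf)).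
  - by move=> x x01; rewrite -mE -gE'; exact: Fx.
  - by move=> y y01; have [-> ->] := Fy y y01; rewrite !mE.
  - by rewrite m0 mulr0 (geodesic_origin gf).
move=> [v [l [L [gf L0 lL gE]]]]; split.
  by exists l, L; split=> //; exists z, v.
apply: (straight_homotopy cm (geodesic_continuous (L := L) gf)) => [||x _|x _].
- by rewrite m0 mulr0 (geodesic_origin gf).
- by apply: val_inj; rewrite m1 mulr1 lL.
- exact: mE.
- exact: gE.
Qed.

End Arcs.

(** * Countable families and half circles *)
Section CountableFamilies.
Context (d : measure_display) (T : measurableType d) (R : realType) (I :
  choiceType).
Variables (D : set I) (F : I -> set T).
Hypotheses (cD : countable D) (mF : forall i, D i -> measurable (F i)).

Let fiber (f : I -> nat) k := \bigcup_(i in [set i | D i /\ f i = k]) F i.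

Local Lemma fiberE f i : {in D &, injective f} -> D i -> fiber f (f i) = F i.
Proof.
move=> fI Di; rewrite eqEsubset; split=> x.
  by move=> [j [Dj /fI ->]] //; rewrite inE.
by move=> Fx; exists i.
Qed.

Local Lemma fiber_measurable f k : {in D &, injective f} ->
  measurable (fiber f k).
Proof.
move=> fI; have [[i [Di <-]]|nk] := pselect (exists i, D i /\ f i = k).
  by rewrite fiberE//; exact: mF.
rewrite (_ : fiber f k = set0)//; rewrite -subset0 => x [i [Di fi] _].
by apply: nk; exists i.
Qed.

Local Lemma bigcup_fiber f : \bigcup_(i in D) F i = \bigcup_(k in f @` D) fiber
  f k.
Proof.
rewrite eqEsubset; split=> x.
  by move=> [i Di Fx]; exists (f i); [exists i|exists i].
by move=> [_ _ [i [Di _] Fx]]; exists i.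
Qed.

Lemma countable_bigcup_measurable : measurable (\bigcup_(i in D) F i).
Proof.
have /countable_injP[f fI] := cD; rewrite (bigcup_fiber f).
by apply: bigcup_measurable => k _; exact: fiber_measurable.
Qed.

(** Sigma-additivity for families indexed by any countable set. *)
Lemma esum_measure_bigcup (mu : {measure set T -> \bar R}) : trivIset D F ->
  \esum_(i in D) mu (F i) = mu (\bigcup_(i in D) F i).
Proof.
move=> tF; have /countable_injP[f fI] := cD.
rewrite (bigcup_fiber f) measure_bigcup; last 2 first.
- by move=> k _; exact: fiber_measurable.
- move=> _ _ [i Di <-] [j Dj <-]; rewrite !fiberE// => /(tF _ _ Di Dj) ->//.
rewrite nneseries_esum; last by move=> k _; exact: measure_ge0.
rewrite set_mem_set (esum_image D f (fun k => mu (fiber f k))) //.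
by apply: eq_esum => i Di; rewrite fiberE.
Qed.

End CountableFamilies.

Section HalfCircle.
Variable R : realType.
Implicit Types (th b a : R).
Local Notation mu := (@lebesgue_measure R).

Lemma sin_gt0_itv (x : R) : - pi < x < 2 * pi -> 0 < sin x -> 0 < x < pi.
Proof.
move=> /andP[x1 x2] sx; apply/andP; split; rewrite ltNge; apply/negP => h.
  have : 0 <= sin (- x) by apply: sin_ge0_pi; apply/andP; split; lra.
  by rewrite sinN; lra.
have : 0 <= sin (x - pi) by apply: sin_ge0_pi; apply/andP; split; lra.
by have := @sinDpi R (x - pi); rewrite subrK => e; rewrite e in sx; lra.
Qed.

Lemma sin_lt0_itv (x : R) : - pi < x < 2 * pi -> sin x < 0 -> x < 0 \/ pi < x.
Proof.
move=> /andP[x1 x2] sx; have [?|x0] := ltP x 0; first by left.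
right; rewrite ltNge; apply/negP => h.
have : 0 <= sin x by apply: sin_ge0_pi; rewrite x0.
by rewrite leNgt sx.
Qed.

Lemma sin_eq0_itv (x : R) : - pi < x < 2 * pi -> sin x = 0 -> x = 0 \/ x = pi.
Proof.
move=> /andP[x1 x2] sx; have := @pi_gt0 R => p0.
have [xl|xg|->] := ltgtP x 0; last by left.
  have : 0 < sin (- x) by apply: sin_gt0_pi; apply/andP; split; lra.
  by rewrite sinN sx oppr0 ltxx.
have [xl'|xg'|->] := ltgtP x pi; last by right.
  have : 0 < sin x by apply: sin_gt0_pi; rewrite xg.
  by rewrite sx ltxx.
have : 0 < sin (x - pi) by apply: sin_gt0_pi; apply/andP; split; lra.
by have := @sinDpi R (x - pi); rewrite subrK sx => /eqP;
  rewrite eq_sym oppr_eq0 => /eqP ->; rewrite ltxx.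
Qed.

(** The zero [th0] is taken in [0, pi[, so that [th - th0] ranges over an
    interval where the sign of the sine is known. *)
Lemma linear_form_sin (b1 b2 : R) : b1 != 0 \/ b2 != 0 ->
  exists k th0, [/\ k != 0, 0 <= th0 < pi &
    forall th, cos th * b1 + sin th * b2 = k * sin (th - th0)].
Proof.
have p0 := @pi_gt0 R.
have [->|b20] := eqVneq b2 0.
  case=> // b10; exists (- b1), (pi / 2); split.
  - by rewrite oppr_eq0.
  - by apply/andP; split; lra.
  - by move=> th; rewrite sinBpihalf mulr0 addr0; ring.
move=> _; pose t := atan (- (b1 / b2)).
have ct : 0 < cos t.
  by apply: cos_gt0_pihalf; rewrite atan_gtNpi2 atan_ltpi2.
have st : sin t * b2 = - (b1 * cos t).
  have := atanK (- (b1 / b2)); rewrite -/t /tan => h.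
  have -> : sin t = (sin t / cos t) * cos t by rewrite divfK// gt_eqF.
  by rewrite h; field.
have tb1 : - (pi / 2) < t := atan_gtNpi2 _.
have tb2 : t < pi / 2 := atan_ltpi2 _.
have bE th : cos th * b1 + sin th * b2 = b2 / cos t * sin (th - t).
  rewrite sinB; apply: (mulIf (lt0r_neq0 ct)).
  transitivity (cos th * (b1 * cos t) + sin th * b2 * cos t); first by ring.
  transitivity (cos th * - (sin t * b2) + sin th * b2 * cos t);
    first by rewrite st opprK.
  by field; rewrite gt_eqF.
have [t0|t0] := leP 0 t.
  exists (b2 / cos t), t; split=> //; last by apply/andP; split; lra.
  by rewrite mulf_neq0// invr_neq0// gt_eqF.
exists (- (b2 / cos t)), (t + pi); split.
- by rewrite oppr_eq0 mulf_neq0// invr_neq0// gt_eqF.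
- by apply/andP; split; lra.
- move=> th; rewrite bE (_ : th - t = (th - (t + pi)) + pi); last by ring.
  by rewrite sinDpi; ring.
Qed.

Lemma zeros_countable (b1 b2 : R) : b1 != 0 \/ b2 != 0 ->
  countable [set th : R | 0 <= th < 2 * pi /\ cos th * b1 + sin th * b2 = 0].
Proof.
move=> b0; have [k [th0 [k0 /andP[t1 t2] kE]]] := linear_form_sin b0.
apply: (@sub_countable _ _ _ [set th0; th0 + pi]); last first.
  by apply: finite_set_countable; exact: finite_set2.
apply: subset_card_le => th [/andP[h1 h2]]; rewrite kE => /eqP;
  rewrite mulf_eq0 (negbTE k0) /= => /eqP s0.
have [|h|h] := sin_eq0_itv _ s0; first by apply/andP; split; lra.
  by left; lra.
by right; lra.
Qed.

(** The negative set of a shifted sine is an interval of length [pi] or the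
    complement of such an interval. *)
Lemma half_circle (b1 b2 : R) (A : set R) : measurable A ->
  A `<=` [set th | 0 <= th < 2 * pi /\ cos th * b1 + sin th * b2 < 0] ->
  (mu A <= pi%:E)%E.
Proof.
move=> mA sA; have p0 := @pi_gt0 R.
have [b0|/not_orP[/negP/negPn/eqP b1E /negP/negPn/eqP b2E]] :=
  pselect (b1 != 0 \/ b2 != 0); last first.
  rewrite (_ : A = set0) ?measure0 ?lee_fin ?ltW//.
  by rewrite -subset0 => th /sA [_]; rewrite b1E b2E !mulr0 addr0 ltxx.
have [k [th0 [k0 /andP[t1 t2] kE]]] := linear_form_sin b0.
have [kn|kp|ke] := ltgtP k 0; last by rewrite ke eqxx in k0.
  have sub : A `<=` `[th0, th0 + pi].
    move=> th /sA [/andP[h1 h2]]; rewrite kE nmulr_rlt0// => s0.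
    have /andP[q1 q2] := sin_gt0_itv (x := th - th0) ltac:(apply/andP; split;
      lra) s0.
    by rewrite /= in_itv /=; apply/andP; split; lra.
  apply: (@le_trans _ _ (mu `[th0, th0 + pi]%classic)).
    by apply: le_measure => //; rewrite inE.
  rewrite lebesgue_measure_itv /= lte_fin ltrDl p0 EFinN.
  by rewrite -EFinB lee_fin addrC addKr.
have sub : A `<=` `[0, th0] `|` `[th0 + pi, 2 * pi].
  move=> th /sA [/andP[h1 h2]]; rewrite kE pmulr_rlt0// => s0.
  have [|q|q] := sin_lt0_itv (x := th - th0) _ s0; first by apply/andP; split;
    lra.
    by left; rewrite /= in_itv /=; apply/andP; split; lra.
  by right; rewrite /= in_itv /=; apply/andP; split; lra.
apply: (@le_trans _ _ (mu (`[0, th0]%classic `|` `[th0 + pi, 2 * pi]%classic))).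
  by apply: le_measure => //; rewrite inE//; exact: measurableU.
pose I1 : set R := `[0, th0]%classic; pose I2 : set R := `[th0 + pi,
  2 * pi]%classic.
apply: (@le_trans _ _ (mu I1 + mu I2)%E); first exact: measureU2.
rewrite /I1 /I2.
have -> : mu `[0, th0] = th0%:E.
  rewrite lebesgue_measure_itv /= lte_fin; case: ltP => h;
    first by rewrite -EFinB subr0.
  by congr (_%:E); lra.
rewrite lebesgue_measure_itv /= lte_fin.
have -> : th0 + pi < 2 * pi by lra.
by rewrite -EFinB -EFinD lee_fin; lra.
Qed.

End HalfCircle.

(** * The directions with a given class *)
Section Classes.
Variables (R : realType) (G : isometry_group R).
Hypothesis G_closed : closed_hyperbolic_surface G.
Variables (z : hyp R) (e1 e2 : 'rV[R]_3).
Hypothesis fr : tangent_frame (val z) e1 e2.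
Implicit Types (th s t q : R) (u v w n : 'rV[R]_3) (A B C : 'M[R]_3).
Implicit Type g : R -> surface G.
Local Notation cov := (covering_map G).
Local Notation ray := (ray fr).
Local Notation aray th := (fun t => cov (ray th t)).
Local Notation is_arc := (is_arc z).

(** Both [cosh] and [sinh] increase strictly from [s] to [t]. *)
Lemma cosh_sinh_eq (a b s t : R) : 0 <= s -> s < t ->
  cosh s * a + sinh s * b = cosh t * a + sinh t * b ->
  a * b < 0 \/ (a = 0 /\ b = 0).
Proof.
move=> s0 st e.
have hc := coshS s0 st; have hs := sinhS st.
have e' : (cosh t - cosh s) * a = - ((sinh t - sinh s) * b).
  by apply/eqP; rewrite -subr_eq0 opprK; apply/eqP; move: e; lra.
have c0 : 0 < cosh t - cosh s by rewrite subr_gt0.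
have k0 : 0 < sinh t - sinh s by rewrite subr_gt0.
set c := cosh t - cosh s in e' c0; set k := sinh t - sinh s in e' k0.
have [a0|a0|a0] := ltgtP a 0.
- left; have : 0 < b by rewrite -(pmulr_rgt0 b k0); nra.
  by move=> b0; rewrite nmulr_rlt0.
- left; have : b < 0 by rewrite -(pmulr_rlt0 b k0); nra.
  by move=> b0; rewrite pmulr_rlt0.
- right; split=> //; move/eqP: e'; rewrite a0 mulr0 eq_sym oppr_eq0 mulf_eq0
  (gt_eqF k0).
  by move/eqP.
Qed.

Lemma fixed_mink A n u : orientation_preserving_isometry A -> n *m A = n ->
  mink (u *m A) n = mink u n.
Proof. by move=> iA nA; rewrite -{1}nA isom_mink. Qed.

Lemma mink_geo u v n t : mink (geo u v t) n = cosh t * mink u n + sinh t * mink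
  v n.
Proof. by rewrite /geo !minklin. Qed.

(** [n] is fixed by [B], so that the products of [n] with the two ends of the
    loop coincide. *)
Lemma class_sign th s t B n : isometry_set G B -> n *m B = n -> 0 <= s ->
  s < t ->
  val (ray th t) = val (ray th s) *m B ->
  mink (val z) n * mink (direction e1 e2 th) n < 0 \/
  (mink (val z) n = 0 /\ mink (direction e1 e2 th) n = 0).
Proof.
move=> GB nB s0 st e; apply: (cosh_sinh_eq s0 st).
by rewrite -!mink_geo -!rayE e (fixed_mink _ (group_isom GB) nB).
Qed.

Lemma fixed_vector_frame n : n != 0 -> mink (val z) n = 0 ->
  mink e1 n != 0 \/ mink e2 n != 0.
Proof.
move=> n0 zn; apply: contrapT => /not_orP[/negP/negPn/eqP h1 /negP/negPn/eqP
  h2].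
move/eqP: n0; apply; rewrite (frame_expand n (hypP z) fr).
by rewrite (minkC n (val z)) (minkC n e1) (minkC n e2) zn h1 h2 oppr0 !scale0r
  !addr0.
Qed.

(** A smooth loop would satisfy [l (u + L) = l u *m B] for small [u], by
    continuity and separation of the orbits.  Then [u |-> mink (l u) n], a
    combination of [expR u] and [expR (- u)], would take the same values at [u]
    and [u + L] for two values of [u], and vanish. *)
Lemma arc_not_closed B g n : isometry_set G B -> is_arc B g -> n *m B = n ->
  mink (val z) n != 0 -> ~ closed_geodesic g.
Proof.
move=> GB [v [l [L [gf L0 lL gE]]]] nB zn [_ per].
have iB := group_isom GB.
have [ep [ep0 _ epU]] := close_unique G_closed.
have [_ lE] := gf.
have cc := @geodesic_continuous R z v l L gf.
have vE (x : R) : val (l (L * x)) = geo (val z) v (L * x) by rewrite lE.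
pose c (x : R) := mink (geo (val z) v (L * (x + 1))) (geo (val z) v (L * x) *m
  B).
have cid : continuous (fun x : R => x) by move=> ?; exact: cvg_id.
have cc' : continuous c.
  apply: continuous_mink; last apply: continuous_mulmx3; apply: continuous_geo;
    apply: contM => //; try exact: cst_continuous.
  by apply: contD => //; exact: cst_continuous.
have c0 : c 0 = -1.
  rewrite /c add0r mulr0 mulr1 geo0 -lL lE -/(geo _ _ _).
  have [-> _]// := geo_hyp L (hypP z) (gf.1).
have [r /= r0 hr] : \forall x \near (0:R), - (1 + 100 * ep) < c x.
  have h : - (1 + 100 * ep) < c 0 by rewrite c0; lra.
  exact: (cc' 0 [set y | - (1 + 100 * ep) < y] (open_nbhs_nbhs (conj (@open_gt
    _ _) h))).
have same (x : R) : `|x| < r -> geo (val z) v (L * (x + 1)) = geo (val z) v (L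
  * x) *m B.
  move=> xr; rewrite -!vE; apply: (congr1 val (x := l _) (y :=
    hyp_act iB (l _))).
  apply: epU.
    have := hr x; rewrite /= sub0r normrN => /(_ xr).
    by rewrite /hclose /= !vE -/(c x); lra.
  rewrite -gE per gE; apply/cov_eqP; exists B => //.
have f (x : R) : `|x| < r -> mink (geo (val z) v (L * (x + 1))) n = mink (geo
  (val z) v (L * x)) n.
  by move=> xr; rewrite same// fixed_mink.
have := f 0; rewrite normr0 => /(_ r0); have := f (r / 2).
rewrite ger0_norm ?divr_ge0 ?(ltW r0)// => /(_ ltac:(lra)).
rewrite add0r mulr0 mulr1 geo0 mulrDr mulr1 !mink_geo.
move/eqP: zn; set a := mink (val z) n; set b := mink v n => zn.
have d0 : 0 < L * (r / 2) by rewrite mulr_gt0 ?divr_gt0.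
set d := L * (r / 2) in d0 *.
rewrite /cosh /sinh opprD !expRD.
have E1 : 1 < expR L by rewrite expR_gt1.
have D1 : 1 < expR d by rewrite expR_gt1.
have EL : expR L * expR (- L) = 1 by rewrite -expRD subrr expR0.
have ED : expR d * expR (- d) = 1 by rewrite -expRD subrr expR0.
set E := expR L in E1 EL *; set E' := expR (- L) in EL *.
set D := expR d in D1 ED *; set D' := expR (- d) in ED *.
(* the coefficients of [expR u] and [expR (- u)] *)
pose P := (a + b) / 2; pose Q := (a - b) / 2 => h1 h2.
have k2 : (E - 1) * (P - Q * E') = 0.
  have -> : (E - 1) * (P - Q * E') = P * E + Q * E' - P - Q * (E * E') by ring.
  by rewrite EL /P /Q; move: h2; lra.
have k1 : (E - 1) * (P * D - Q * D' * E') = 0.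
  have -> : (E - 1) * (P * D - Q * D' * E') = P * D * E + Q * D' * E' - P * D -
    Q * D' * (E * E') by ring.
  by rewrite EL /P /Q; move: h1; lra.
have E10 : E - 1 != 0 by rewrite subr_eq0 gt_eqF.
move/eqP: k2; rewrite mulf_eq0 (negbTE E10) subr_eq0 /= => /eqP k2.
move/eqP: k1; rewrite mulf_eq0 (negbTE E10) subr_eq0 /= => /eqP k1.
have P0 : P * (D * D - 1) = 0.
  have : (P * D) * D = P.
    rewrite k1; transitivity (Q * E' * (D * D')); first by ring.
    by rewrite ED mulr1 -k2.
  by move=> h; rewrite mulrBr mulr1 mulrA h subrr.
have DD : D * D - 1 != 0 by rewrite subr_eq0 gt_eqF//; nra.
move/eqP: P0; rewrite mulf_eq0 (negbTE DD) orbF => /eqP P0.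
have Q0 : Q = 0.
  by rewrite -[Q]mulr1 -EL mulrCA -k2 P0 mulr0.
by apply: zn; move: P0 Q0; rewrite /P /Q; lra.
Qed.

Lemma ray_inj th : injective (ray th).
Proof.
move=> s t /(congr1 val); rewrite !rayE.
exact/geo_inj/(direction_utangent th fr).
Qed.

Lemma crossing_neq th s t B : isometry_set G B -> B <> 1%:M ->
  val (ray th t) = val (ray th s) *m B -> s <> t.
Proof. by move=> GB B1 e st; apply: B1; apply: (free1 G_closed GB (p :=
  ray th s)); rewrite -e st. Qed.

Definition crosses_by th B s t := [/\ 0 <= s,
  s <= t & val (ray th t) = val (ray th s) *m B].

(** Equality as one closed scalar condition. *)
Lemma crossing_mink th B s t : isometry_set G B ->
  (val (ray th t) = val (ray th s) *m B) <-> mink (val (ray th t)) (val (ray th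
    s) *m B) = -1.
Proof.
move=> GB; have iB := group_isom GB; have hB := isom_hyp iB (hypP (ray th s)).
split=> [->|h]; first by case: hB.
exact: hyperboloid_mink_eq (hypP _) hB h.
Qed.

Lemma continuous_ray (T : topologicalType) (f h : T -> R) : continuous f ->
  continuous h ->
  continuous (fun p => val (ray (f p) (h p))).
Proof.
move=> cf ch.
have ce : continuous (fun p => expR (h p)) by apply: cont_comp => //;
  exact: continuous_expR.
have ce' : continuous (fun p => expR (- h p)).
  by apply: (@cont_comp _ _ _ (fun p => - h p) (@expR R));
    [exact: contN|exact: continuous_expR].
apply: continuous_lin; [exact: cst_continuous| | |].
- apply: continuous_lin; [exact: cst_continuous|exact: cst_continuous| |];
    apply: cont_comp => //.
    exact: continuous_cos.
  exact: continuous_sin.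
- by apply: contM; [exact: contD|exact: cst_continuous].
- by apply: contM; [exact: contB|exact: cst_continuous].
Qed.

(** Up to a given time, only finitely many elements can produce a crossing, and
    for each of them crossings form a compact set of pairs of times. *)
Lemma first_crossing th (D : set 'M[R]_3) : D `<=` isometry_set G ->
  (exists B s t, D B /\ crosses_by th B s t) ->
  exists B s t, [/\ D B, crosses_by th B s t &
    forall B' s' t', D B' -> crosses_by th B' s' t' -> t <= t'].
Proof.
move=> DG [B1 [s1 [q [DB1 [s10 s1q e1q]]]]].
have [_ pd _] := G_closed.
(* by convexity, heights along the ray up to q are at most c *)
pose w := val z + direction e1 e2 th; pose w' := val z - direction e1 e2 th.
have [[_ w0] [_ w'0]] := utangent_future (hypP z) (direction_utangent th fr).
pose c := expR q * w 0 ord_max + w' 0 ord_max.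
have hgt (u : R) : 0 <= u -> u <= q -> val (ray th u) 0 ord_max <= c.
  move=> u0 uq; rewrite rayE geoE mxE mxE [X in _ + X]mxE -/w -/w' /c.
  have h1 : expR u <= expR q by rewrite ler_expR.
  have h2 : expR (- u) <= 1 by rewrite -expR0 ler_expR oppr_le0.
  have := expR_gt0 u; rewrite -/w -/w' in w0 w'0; nra.
pose F := D `&` [set A | isometry_set G A /\
  exists x, [/\ hyperboloid x, x 0 ord_max <= c & (x *m A) 0 ord_max <= c]].
have finF : finite_set F by apply: sub_finite_set (group_finite_box c pd) =>
  A [].
have FP B s t : D B -> crosses_by th B s t -> t <= q -> F B.
  move=> DB [s0 st e] tq; split=> //; split; first exact: DG.
  exists (val (ray th s)); split; first exact: hypP.
    by apply: hgt => //; exact: le_trans tq.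
  by rewrite -e; apply: hgt => //; exact: le_trans st.
pose W := (`[0, q]%classic `*` `[0, q]%classic) `&` ([set p : R * R | p.1 <=
  p.2] `&`
  \bigcup_(B in F) [set p | mink (val (ray th p.2)) (val (ray th p.1) *m B) =
    -1]).
have k1 : continuous (fun P : R * R => P.1) by move=> ?; exact: cvg_fst.
have k2 : continuous (fun P : R * R => P.2) by move=> ?; exact: cvg_snd.
have cW : compact W.
  rewrite /W; apply: compact_closedI; first by apply: compact_setX;
    exact: segment_compact.
  apply: closedI.
    rewrite (_ : [set p : R * R | p.1 <= p.2] = [set p | 0 <= p.2 - p.1]);
      last first.
      by rewrite eqEsubset; split=> p /=; rewrite subr_ge0.
    apply: (@preimage_closed _ _ (fun p : R * R =>
      p.2 - p.1) [set y : R | 0 <= y]); last exact: closed_ge.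
    by move=> p _; exact: contB.
  apply: closed_bigcup => // B _.
  apply: (@preimage_closed _ _ (fun p : R * R =>
    mink (val (ray th p.2)) (val (ray th p.1) *m B)) [set y : R | y = -1]);
      last exact: closed_eq.
  move=> p _; apply: continuous_mink; last apply: continuous_mulmx3;
    apply: continuous_ray => //; exact: cst_continuous.
have [|[s t] stW tmin] := @compact_EVT_min _ _ (fun p : R * R =>
  p.2) W _ cW (continuous_subspaceT k2).
  exists (s1, q); split.
    by split; rewrite /= in_itv /= ?lexx ?s10 ?s1q// (le_trans s10).
  split=> //; exists B1; first exact: (FP B1 s1 q DB1 (And3 s10 s1q e1q) (lexx
    q)).
  by apply/crossing_mink => //; exact: DG.
move: stW; rewrite inE => -[[/= sq tq] [/= st [B FB /= e]]].
have [DB _] := FB; move: sq tq; rewrite !in_itv /= => /andP[s0 sq] /andP[t0 tq].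
have cr : crosses_by th B s t.
  by split=> //; apply/crossing_mink => //; exact: DG.
exists B, s, t; split=> // B' s' t' DB' cr'.
have [t'q|/ltW qt'] := leP t' q; last exact: le_trans qt'.
have [s'0 s't' e'] := cr'.
apply: (tmin (s', t')); rewrite inE; split.
  by split; rewrite /= in_itv /= ?s'0 ?t'q ?(le_trans s't')// (le_trans s'0).
split=> //; exists B'; first exact: (FP _ s' t').
by apply/crossing_mink => //; exact: DG.
Qed.

Lemma lasso_class_exists th s t : is_lasso (aray th) s t ->
  exists2 B, isometry_set G B & val (ray th t) = val (ray th s) *m B.
Proof. by move=> [_ _ /cov_eqP]. Qed.

Lemma lasso_unique a s t s' t' : @is_lasso R G a s t -> is_lasso a s' t' ->
  s = s' /\ t = t'.
Proof.
have key s1 t1 s2 t2 : @is_lasso R G a s1 t1 -> is_lasso a s2 t2 -> t2 <= t1.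
  move=> [s0 st e inj] [s20 st2 eb inj2]; rewrite leNgt; apply/negP => tt.
  have := inj2 s1 t1; rewrite !in_itv /= => /(_ _ _ e) h.
  suff : s1 = t1 by move: st => /[swap] ->; rewrite ltxx.
  by apply: h; [rewrite s0 (lt_trans st)|rewrite (le_trans s0 (ltW st)) tt].
move=> l l'; have tt : t = t' by apply/eqP;
  rewrite eq_le (key _ _ _ _ l l') (key _ _ _ _ l' l).
split=> //; move: l l' => [s0 st e inj] [s0' st' e' _].
apply: inj; rewrite ?in_itv /= ?s0 ?s0' ?st//; first by rewrite tt.
by rewrite e e' tt.
Qed.

Definition nontrivial : set 'M[R]_3 := [set A | isometry_set G A /\ A <> 1%:M].

Lemma nontrivial_sub : nontrivial `<=` isometry_set G.
Proof. by move=> A []. Qed.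

Lemma first_lasso th B s t : nontrivial B -> crosses_by th B s t ->
  (forall B' s' t', nontrivial B' -> crosses_by th B' s' t' -> t <= t') ->
  is_lasso (aray th) s t.
Proof.
move=> [GB B1] [s0 st e] tmin.
have sNt := crossing_neq GB B1 e.
split=> //; first by rewrite lt_neqAle st andbT; apply/eqP.
  by apply/cov_eqP; exists B.
have key s1 s2 : 0 <= s1 -> s1 < s2 -> s2 < t ->
  cov (ray th s1) = cov (ray th s2) -> False.
  move=> s10 s12 s2t /cov_eqP[C GC e'].
  have C1 : C <> 1%:M.
    move=> C1; move: e'; rewrite C1 mulmx1 => /val_inj /ray_inj s21.
    by move: s12; rewrite s21 ltxx.
  have := tmin C s1 s2 (conj GC C1) (And3 s10 (ltW s12) e').
  by rewrite leNgt s2t.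
move=> s1 s2; rewrite !in_itv /= => /andP[s10 s1t] /andP[s20 s2t] e'.
have [lt12|lt21|//] := ltgtP s1 s2; exfalso.
  exact: (key s1 s2).
exact: (key s2 s1).
Qed.

Definition class_dirs B : set R := [set th | exists s t,
  is_lasso (aray th) s t /\ val (ray th t) = val (ray th s) *m B].

Lemma class_dirs_neq1 B th : class_dirs B th -> B <> 1%:M.
Proof.
move=> [s [t [[_ st _ _] e]]] B1; move: e; rewrite B1 mulmx1 =>
  /val_inj /ray_inj ts.
by move: st; rewrite ts ltxx.
Qed.

Lemma class_dirs_inj B B' th : isometry_set G B -> isometry_set G B' ->
  class_dirs B th -> class_dirs B' th -> B = B'.
Proof.
move=> GB GB' [s [t [l e]]] [s' [t' [l' e']]].
have [ss tt] := lasso_unique l l'; subst s' t'.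
by apply: (group_eq G_closed GB GB' (p := ray th s)); rewrite -e -e'.
Qed.

Definition crossed_before B q : set R := [set th | exists s t,
  crosses_by th B s t /\ t <= q].

(** The pairs of times range over a compact set. *)
Lemma crossed_before_closed B q : isometry_set G B ->
  closed (crossed_before B q).
Proof.
move=> GB; rewrite -openC openE => th0 nX.
pose K := (`[0, q]%classic `*` `[0, q]%classic) `&` [set p : R * R | p.1 <=
  p.2].
have k1 : continuous (fun P : R * R => P.1) by move=> ?; exact: cvg_fst.
have k2 : continuous (fun P : R * R => P.2) by move=> ?; exact: cvg_snd.
have cK : compact K.
  rewrite /K; apply: compact_closedI; first by apply: compact_setX;
    exact: segment_compact.
  rewrite (_ : [set p : R * R | p.1 <= p.2] = [set p | 0 <= p.2 - p.1]);
    last first.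
    by rewrite eqEsubset; split=> p /=; rewrite subr_ge0.
  apply: (@preimage_closed _ _ (fun p : R * R =>
    p.2 - p.1) [set y : R | 0 <= y]); last exact: closed_ge.
  by move=> p _; exact: contB.
pose f (p : R * R * R) := mink (val (ray p.2 p.1.2)) (val (ray p.2 p.1.1) *m B).
have cf : continuous f.
  have j1 : continuous (fun p : R * R * R => p.1) by move=> ?; exact: cvg_fst.
  have j2 : continuous (fun p : R * R * R => p.2) by move=> ?; exact: cvg_snd.
  by apply: continuous_mink; last apply: continuous_mulmx3;
    apply: continuous_ray => //;
    [exact: cont_comp j1 k2|exact: cont_comp j1 k1].
have : \forall th \near th0, K `<=` [set p | f (p, th) < -1].
  move/compact_near_coveringP : cK => cK.
  apply: (cK R (nbhs th0) (fun th p => f (p, th) < -1)) =>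
    -[s t] [[/= sq tq] st].
  have ft : f ((s, t), th0) < -1.
    rewrite lt_neqAle hyperboloid_mink_le ?andbT; last 2 first.
    - exact: hypP.
    - exact: (isom_hyp (group_isom GB) (hypP (ray th0 s))).
    apply/eqP => e; apply: nX; exists s, t.
    move: sq tq; rewrite /= !in_itv /= => /andP[s0 _] /andP[_ tq]; split=> //.
    by split=> //; apply/crossing_mink.
  have := cf ((s, t), th0) [set y | y < -1] (open_nbhs_nbhs (conj (@open_lt _
    _) ft)).
  by [].
apply: filterS => th hK [s [t [[s0 st e] tq]]].
have : K (s, t).
  by split=> //; split; rewrite /= in_itv /= ?s0 ?tq ?(le_trans st)// (le_trans
    s0).
by move=> /hK /=; rewrite /f /= (crossing_mink th s t GB).1// ltxx.
Qed.

(** The first crossing has the class [B] if and only if [B] produces a crossing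
    before any rational time at which the ray has crossed itself. This expresses
    the set by countably many closed sets. *)
Lemma class_dirsE B : nontrivial B ->
  class_dirs B = (\bigcup_(k in [set: nat]) crossed_before B k%:R) `\`
    \bigcup_(r in [set: rat]) ((\bigcup_(C in nontrivial) crossed_before C
      (ratr r)) `\` crossed_before B (ratr r)).
Proof.
move=> nB; have [GB B1] := nB; rewrite eqEsubset; split=> th.
  move=> [s [t [la e]]]; have [s0 st ea inj] := la.
  have cr : crosses_by th B s t by split=> //; exact: ltW.
  split.
    exists (Num.truncn t).+1 => //; exists s, t; split=> //.
    by apply/ltW/truncnS_gt.
  move=> [r _ [[C [GC C1] [s' [t' [cr' t'r]]]] nBr]]; apply: nBr.
  exists s, t; split=> //; apply: le_trans t'r; rewrite leNgt; apply/negP =>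
    t't.
  have [s'0 s't' e'] := cr'.
  apply: (crossing_neq GC C1 e'); apply: inj.
  - by rewrite in_itv /= s'0 (le_lt_trans s't').
  - by rewrite in_itv /= t't (le_trans s'0).
  - by apply/cov_eqP; exists C.
move=> [[k _ [sk [tk [crk _]]]] nr].
have [B' [s [t [-> cr tmin]]]] := @first_crossing th [set B] (fun _ =>
  fun e => eq_ind_r _ GB e)
  (ex_intro _ B (ex_intro _ sk (ex_intro _ tk (conj erefl crk)))).
have [C [s0 [t0 [nC cr0 t0min]]]] := @first_crossing th nontrivial
  nontrivial_sub
  (ex_intro _ B (ex_intro _ sk (ex_intro _ tk (conj nB crk)))).
have t0t : t <= t0.
  rewrite leNgt; apply/negP => tt.
  have [r /itvP rI] := rat_in_itvoo tt.
  apply: nr; exists r => //; split.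
    by exists C => //; exists s0, t0; rewrite rI.
  move=> [s' [t' [cr' t'r]]].
  have := tmin B s' t' erefl cr'; rewrite leNgt (le_lt_trans t'r)// rI//.
exists s, t; split; last by case: cr.
by apply: (first_lasso nB cr) => B'' s' t' nB'' cr''; apply: le_trans t0t _;
  exact: t0min nB'' cr''.
Qed.

Lemma nontrivial_countable : countable nontrivial.
Proof.
have [_ pd _] := G_closed.
by apply: sub_countable (group_countable pd); apply: subset_card_le => A [].
Qed.

Lemma class_dirs_measurable B : isometry_set G B -> measurable (class_dirs B).
Proof.
move=> GB; have [B1|B1] := pselect (B = 1%:M).
  rewrite (_ : class_dirs B = set0)// -subset0 => th /class_dirs_neq1; exact.
rewrite class_dirsE//; apply: measurableD.
  by apply: bigcup_measurable => k _; apply: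
    measurable_realfun.closed_measurable; exact: crossed_before_closed.
apply: countable_bigcup_measurable => [|r _];
  [exact: countableP|apply: measurableD].
  apply: countable_bigcup_measurable; first exact: nontrivial_countable.
  by move=> C [GC _]; apply: measurable_realfun.closed_measurable;
    exact: crossed_before_closed.
by apply: measurable_realfun.closed_measurable; exact: crossed_before_closed.
Qed.

Lemma self_crosses_class th : self_crosses G (val z) (direction e1 e2 th) <->
  exists2 B, nontrivial B & class_dirs B th.
Proof.
split; last first.
  move=> [B [GB B1] [s [t [[s0 st _ _] e]]]].
  by exists s, t, B; split=> //; rewrite (le_trans s0)// ltW.
move=> [s [t [B [s0 t0 GB B1 e]]]].
have ex : exists C s t, nontrivial C /\ crosses_by th C s t.
  have [st|ts] := leP s t; first by exists B, s, t.
  have iB := group_isom GB.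
  exists (invmx B), t, s; split.
    split; first exact: isometry_setV.
    by move=> h; apply: B1; rewrite -[B]invmxK h invmx1.
  split=> //; first exact: ltW.
  by rewrite !rayE e isom_mulK.
have [C [s' [t' [nC cr tmin]]]] := first_crossing nontrivial_sub ex.
exists C => //; exists s', t'; split; last by case: cr.
exact: first_lasso nC cr tmin.
Qed.

Lemma simple_dirs_measurable :
  measurable [set th | ~ self_crosses G (val z) (direction e1 e2 th)].
Proof.
rewrite (_ : mkset _ = ~` \bigcup_(B in nontrivial) class_dirs B).
  apply: measurableC; apply: countable_bigcup_measurable;
    first exact: nontrivial_countable.
  by move=> B [GB _]; exact: class_dirs_measurable.
by rewrite eqEsubset; split=> th /= h ?; apply: h; apply/self_crosses_class.
Qed.

End Classes.

(** * Half-pants and their gaps *)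
Section HalfPants.
Variables (R : realType) (G : isometry_group R).
Hypothesis G_closed : closed_hyperbolic_surface G.
Variables (z : hyp R) (e1 e2 : 'rV[R]_3).
Hypothesis fr : tangent_frame (val z) e1 e2.
Implicit Types (th s t : R) (n : 'rV[R]_3) (B : 'M[R]_3) (P : half_pants G).
Implicit Type g : R -> surface G.
Local Notation mu := (@lebesgue_measure R).
Local Notation dirs := (@inducing_directions R G z e1 e2).
Local Notation cls := (class_dirs G fr).

Definition zipper_classes P : set 'M[R]_3 := [set B | isometry_set G B /\
  exists g, [/\ is_arc z B g, ~ closed_geodesic g & P = half_pants_of g]].

Lemma ray_inducesE th P : ray_induces z e1 e2 th P <->
  exists2 B, zipper_classes P B & cls B th.
Proof.
split.
  move=> [l gl [s [t [g [la ga ph nc PE]]]]].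
  have lE := ray_unique fr gl; subst l.
  have [s0 st _ _] := la.
  have [B GB e] := lasso_class_exists la.
  exists B; last by exists s, t.
  split=> //; exists g; split=> //.
  exact: (lasso_arc G_closed g GB s0 st e).1 (conj ga ph).
move=> [B [GB [g [ag nc PE]]] [s [t [la e]]]].
exists (ray fr th); first exact: ray_geodesic.
have [s0 st _ _] := la.
have [ga ph] := (lasso_arc G_closed g GB s0 st e).2 ag.
by exists s, t, g.
Qed.

Lemma half_pants_of_eq g g' : half_pants_of g = half_pants_of g' ->
  g' = g \/ g' = reverse g.
Proof.
move=> /(congr1 (@zipper R G)) /= e.
have : zipper_of g' g' by left.
by rewrite -e.
Qed.

(** The half-pants remember the loop up to reversal. *)
Lemma zipper_classes_eq P B B' : zipper_classes P B -> zipper_classes P B' ->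
  B' = B \/ B' = invmx B.
Proof.
move=> [GB [g [ag _ PE]]] [GB' [g' [ag' _ PE']]].
have [gE|gE] := half_pants_of_eq (etrans (esym PE) PE').
  by left; rewrite gE in ag'; exact: (arc_inj G_closed GB' GB ag' ag).
by right; rewrite gE in ag'; exact: (arc_reverse G_closed GB GB' ag ag').
Qed.

Lemma inducing_directionsE P : dirs P =
  `[0, 2 * pi[%classic `&` \bigcup_(B in zipper_classes P) cls B.
Proof.
rewrite eqEsubset; split=> th /=.
  by move=> [th0 /ray_inducesE[B PB Bth]]; split; [rewrite in_itv|exists B].
by move=> [+ [B PB Bth]]; rewrite in_itv /= => th0; split=> //;
  apply/ray_inducesE; exists B.
Qed.

Lemma inducing_directions_measurable P : measurable (dirs P).
Proof.
have [_ pd _] := G_closed.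
rewrite inducing_directionsE; apply: measurableI => //.
apply: countable_bigcup_measurable.
  by apply: sub_countable (group_countable pd); apply: subset_card_le => B [].
by move=> B [GB _]; exact: class_dirs_measurable.
Qed.

Lemma mink_direction th n : mink (direction e1 e2 th) n = cos th * mink e1 n +
  sin th * mink e2 n.
Proof. by rewrite /direction !minklin. Qed.

(** The inverse of [B] fixes the same vectors as [B], so that all directions
    that induce [P] satisfy the same sign condition. *)
Lemma gap_le_pi P : lasso_half_pants z e1 e2 P -> (mu (dirs P) <= pi%:E)%E.
Proof.
move=> [th0 [_ /ray_inducesE[B PB _]]].
have [GB _] := PB; have iB := group_isom GB.
have [n n0 nB] := isom_fixed_vector iB.
have sgn th : dirs P th -> 0 <= th < 2 * pi /\
    (mink (val z) n * (cos th * mink e1 n + sin th * mink e2 n) < 0 \/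
    (mink (val z) n = 0 /\ cos th * mink e1 n + sin th * mink e2 n = 0)).
  move=> [thI /ray_inducesE[B' PB' [s [t [[s0 st _ _] e]]]]]; split=> //.
  rewrite -mink_direction; have [GB' _] := PB'.
  apply: (class_sign GB' _ s0 st e).
  have [->//|->] := zipper_classes_eq PB PB'.
  by rewrite -{1}nB isom_mulK.
have mP := inducing_directions_measurable P.
have [a0|a0] := eqVneq (mink (val z) n) 0.
  have b0 := fixed_vector_frame fr n0 a0.
  rewrite countable_lebesgue_measure0 ?lee_fin ?pi_ge0//.
  apply: sub_countable (zeros_countable b0); apply: subset_card_le =>
    th /sgn[thI].
  by rewrite a0 mul0r ltxx => -[//|[_ h]].
apply: (half_circle (b1 := mink (val z) n * mink e1 n) (b2 :=
  mink (val z) n * mink e2 n) mP).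
move=> th /sgn[thI [h|[h _]]]; last by rewrite h eqxx in a0.
by split=> //; move: h; lra.
Qed.

(** Each of the half-pants is determined by any of its classes. *)
Lemma lasso_half_pants_countable : countable (lasso_half_pants (G :=
  G) z e1 e2).
Proof.
have [_ pd _] := G_closed.
have /countable_injP[h hI] := group_countable pd.
pose f P := xget (0 : 'M[R]_3) (zipper_classes P).
have fP P : lasso_half_pants z e1 e2 P -> zipper_classes P (f P).
  by move=> [th [_ /ray_inducesE[B PB _]]]; rewrite /f; case: xgetP => [? ->
    //|/(_ B)].
apply/countable_injP; exists (h \o f) => P Q; rewrite !inE =>
  /fP fPP /fP fQQ /= e.
have GP : isometry_set G (f P) by case: fPP.
have GQ : isometry_set G (f Q) by case: fQQ.
have fe : f P = f Q by apply: hI => //; rewrite inE.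
move: fPP fQQ => [_ [g [ag _ ->]]] [_ [g' [ag' _ ->]]].
by rewrite fe in ag; rewrite (arc_unique ag ag').
Qed.

Lemma inducing_directions_trivIset : trivIset (lasso_half_pants (G :=
  G) z e1 e2) dirs.
Proof.
move=> P Q _ _ [th [[_ /ray_inducesE[B PB Bth]] [_ /ray_inducesE[B' QB'
  B'th]]]].
move: PB QB' => [GB [g [ag _ ->]]] [GB' [g' [ag' _ ->]]].
have BB := class_dirs_inj G_closed GB GB' Bth B'th; subst B'.
by rewrite (arc_unique ag ag').
Qed.

(** By [arc_not_closed], a lasso can induce nothing only if [z] lies on the
    plane orthogonal to the fixed vector; the direction is then orthogonal to
    that vector. *)
Lemma smooth_directions_countable B : nontrivial G B ->
  countable [set th | [/\ 0 <= th < 2 * pi, cls B th & forall P,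
    ~ ray_induces z e1 e2 th P]].
Proof.
move=> [GB B1]; have iB := group_isom GB.
have [n n0 nB] := isom_fixed_vector iB.
have [a0|a0] := eqVneq (mink (val z) n) 0.
  have b0 := fixed_vector_frame fr n0 a0.
  apply: sub_countable (zeros_countable b0); apply: subset_card_le =>
    th [thI [s [t [[s0 st _ _] e]]] _].
  split=> //; rewrite -mink_direction.
  by have [|[]//] := class_sign GB nB s0 st e; rewrite a0 mul0r ltxx.
rewrite (_ : mkset _ = set0); first exact: countable0.
rewrite -subset0 => th [_ Bth /(_ (half_pants_of _)) ni].
have [g ag] := arc_exists G_closed z GB B1.
apply: (ni g); apply/ray_inducesE; exists B => //; split=> //; exists g;
  split=> //.
exact: arc_not_closed GB ag nB a0.
Qed.

(** What is left out is the null set of simple rays and countably many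
    directions of smooth loops. *)
Lemma inducing_directions_total :
  mu (\bigcup_(P in lasso_half_pants (G := G) z e1 e2) dirs P) = (2 * pi)%:E.
Proof.
pose I : set R := `[0, 2 * pi[%classic.
set U := \bigcup_(P in _) _.
have mU : measurable U.
  apply: countable_bigcup_measurable; first exact: lasso_half_pants_countable.
  by move=> P _; exact: inducing_directions_measurable.
have mI : measurable I by exact: measurable_itv.
have UI : U `<=` I by move=> th [P _ [thI _]]; rewrite /I /= in_itv.
pose Z := [set th | ~ self_crosses G (val z) (direction e1 e2 th)].
have mZ : measurable Z := simple_dirs_measurable G_closed fr.
pose S := \bigcup_(B in nontrivial G)
  [set th | [/\ 0 <= th < 2 * pi, cls B th & forall P,
    ~ ray_induces z e1 e2 th P]].
have cS : countable S.
  apply: bigcup_countable; first exact: nontrivial_countable.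
  exact: smooth_directions_countable.
have IU : I `\` U `<=` Z `|` S.
  move=> th [thI nU]; have {thI} thI : 0 <= th < 2 * pi by move: thI;
    rewrite /I /= in_itv.
  have [sc|] := pselect (self_crosses G (val z) (direction e1 e2 th));
    last by left.
  right; have [B nB Bth] := (self_crosses_class G_closed fr th).1 sc.
  exists B => //; split=> // P Pth; apply: nU; exists P; last by split.
  by exists th; split.
have IU0 : mu (I `\` U) = 0%E.
  apply/negligibleP; first exact: measurableD.
  apply: (@negligibleS _ _ _ mu _ _ IU); apply: negligibleU.
    by apply/negligibleP => //; apply: simple_null => //; exact: hypP.
  have mS : measurable S by apply: countable_measurable => // t;
    exact: measurable_set1.
  by apply/negligibleP => //; exact: countable_lebesgue_measure0.
have mIE : mu I = (mu (I `\` U) + mu (I `&` U))%E by exact: measureDI.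
rewrite IU0 add0e (setIidr UI) in mIE; rewrite -mIE.
by rewrite lebesgue_measure_itv /= lte_fin mulr_gt0 ?pi_gt0// -EFinB subr0.
Qed.

End HalfPants.

Unset Implicit Arguments.

(** * The sum of the gaps *)

Theorem theorem10 (R : realType) (G : isometry_group R)
    (G_closed : closed_hyperbolic_surface G)
    (z : hyp R) (e1 e2 : 'rV[R]_3) (frame : orthonormal_frame z e1 e2) :
  (forall P : half_pants G, lasso_half_pants z e1 e2 P ->
     measurable (inducing_directions z e1 e2 P) /\
     (0%:E <= gap z e1 e2 P <= pi%:E)%E) /\
  \esum_(P in lasso_half_pants (G := G) z e1 e2) gap z e1 e2 P = (2 * pi)%:E.
Proof.
have fr : tangent_frame (val z) e1 e2 := frame.
split=> [P LP|].
  split; first exact: (inducing_directions_measurable G_closed fr P).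
  by apply/andP; split; [exact: measure_ge0|exact: gap_le_pi].
rewrite -(inducing_directions_total G_closed fr).
apply: esum_measure_bigcup.
- exact: lasso_half_pants_countable.
- by move=> P _; exact: inducing_directions_measurable.
- exact: inducing_directions_trivIset.
Qed.
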